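(* Fix $r>d/2$. Assume that $$\Vert z(0)\Vert_{r+3}+\Vert c^{-1}\langle\nabla\rangle_c^{-1}z'(0)\Vert_{r+3}\le M_3$$ uniformly in $c$, and that there exist functions $\varphi,\gamma$ (independent of $c$) such that $$\Vert z(0)-\varphi\Vert_r+\Vert c^{-1}\langle\nabla\rangle_c^{-1}z'(0)-\gamma\Vert_r\le k_rc^{-1}$$ for some constant $k_r$ independent of $c$. Let $u_\ast^n$ be the second-order exponential-type scheme and $u_{\ast,\infty}^n$ the Strang splitting scheme for the limit nonlinear Schr\''odinger equation, both with step size $\tau$, as given in the context. Then there exist $T>0$ and $\tau_0>0$ such that for all $\tau\le\tau_0$, all $t_n=n\tau\le T$ and all $c>0$ with $$\tau c\ge1$$ it holds that $$\Vert u_\ast^n-u_{\ast,\infty}^n\Vert_r\le c^{-1}k_r(M_3,T)$$ for some constant $k_r(M_3,T)$ that depends on $M_3$ and $T$, but is independent of $c$.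
   Context: Setting: for $c>0$, the cubic Klein--Gordon equation $c^{-2}\partial_{tt}z-\Delta z+c^2z=|z|^2z$ on $\mathbb{T}^d$ (periodic boundary conditions) with $z$ real-valued and initial data $z(0)$, $z'(0):=\partial_tz(0)$, which may depend on $c$. Norm: $\Vert u\Vert_r^2=\sum_{k\in\mathbb{Z}^d}(1+|k|^2)^r|\hat u_k|^2$, with $\hat u_k$ the Fourier coefficients normalized by $(2\pi)^{-d}$. Operators: $\langle\nabla\rangle_c=\sqrt{-\Delta+c^2}$ and $\mathcal{A}_c=c\langle\nabla\rangle_c-c^2$ (Fourier multipliers). Functions of $\Delta$ and $\mathcal{A}_c$ are Fourier multipliers. An operator acts on the whole product of functions standing to its right. $\varphi_0(\zeta)=\mathrm{e}^\zeta$, $\varphi_1(\zeta)=\frac{\mathrm{e}^\zeta-1}{\zeta}$, $\varphi_2(\zeta)=\frac{\varphi_0(\zeta)-\varphi_1(\zeta)}{\zeta}$, extended continuously to $\zeta=0$ (not to be confused with the function $\varphi$). Auxiliary functions: $$\begin{aligned}\theta(t_n,\tau,w)&=-\tfrac12\tfrac{9}{64}\mathrm{e}^{i\frac\tau2\mathcal{A}_c}\left(c\langle\nabla\rangle_c^{-1}-1\right)|w|^4w-\tfrac12\tfrac9{32}c\langle\nabla\rangle_c^{-1}\mathrm{e}^{i\frac\tau2\mathcal{A}_c}|w|^2\left(c\langle\nabla\rangle_c^{-1}-1\right)|w|^2w\\&\quad+\tfrac12\tfrac9{64}c\langle\nabla\rangle_c^{-1}\mathrm{e}^{i\frac\tau2\mathcal{A}_c}w^2\left(c\langle\nabla\rangle_c^{-1}-1\right)|w|^2\overline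 w,\end{aligned}$$ $$\vartheta_{c^2}(t_n,\tau,w)=\mathrm{e}^{2ic^2t_n}\tfrac{\varphi_1(2ic^2\tau)-1}{2i\tau c^2}w^3+3\mathrm{e}^{-2ic^2t_n}\tfrac{\varphi_1(-2ic^2\tau)-1}{-2i\tau c^2}|w|^2\overline w+\mathrm{e}^{-4ic^2t_n}\tfrac{\varphi_1(-4ic^2\tau)-1}{-4i\tau c^2}\overline w^3,$$ and for $l\in\mathbb{Z}$ $$\begin{aligned}\Omega_{c^2,l}(t_n,\tau,w)&=\mathrm{e}^{2ic^2t_n}\tfrac{\varphi_1((l+2)ic^2\tau)-\varphi_1(lic^2\tau)}{2i\tau c^2}w^3+3\mathrm{e}^{-2ic^2t_n}\tfrac{\varphi_1((l-2)ic^2\tau)-\varphi_1(lic^2\tau)}{-2i\tau c^2}|w|^2\overline w\\&\quad+\mathrm{e}^{-4ic^2t_n}\tfrac{\varphi_1((l-4)ic^2\tau)-\varphi_1(lic^2\tau)}{-4i\tau c^2}\overline w^3.\end{aligned}$$ Further set $$\begin{aligned}I^1_{c^2}(\tau,t_n,w)&=\tau\mathrm{e}^{2ic^2t_n}\mathrm{e}^{i\tau\mathcal{A}_c}\varphi_1\left(i\tau(2c^2-\tfrac12\Delta)\right)w^3\\&+i\tau^2\mathrm{e}^{2ic^2t_n}\mathrm{e}^{i\tau\mathcal{A}_c}\varphi_2\left(i\tau(2c^2-\tfrac12\Delta)\right)\left[(\tfrac12\Delta-\mathcal{A}_c)w^3+3w^2\mathcal{A}_cw\right]\\&+3\tau\mathrm{e}^{-2ic^2t_n}\mathrm{e}^{i\tau\mathcal{A}_c}\varphi_1\left(i\tau(-2c^2-\mathcal{A}_c)\right)|w|^2\overline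 w\\&+3i\tau^2\mathrm{e}^{-2ic^2t_n}\mathrm{e}^{i\tau\mathcal{A}_c}\varphi_2\left(i\tau(-2c^2-\mathcal{A}_c)\right)\left[\overline w^2\mathcal{A}_cw-2|w|^2\mathcal{A}_c\overline w\right]\\&+\tau\mathrm{e}^{-4ic^2t_n}\mathrm{e}^{i\tau\mathcal{A}_c}\varphi_1\left(i\tau(-4c^2-\mathcal{A}_c)\right)\overline w^3-i\tau^2\mathrm{e}^{-4ic^2t_n}\mathrm{e}^{i\tau\mathcal{A}_c}\varphi_2\left(i\tau(-4c^2-\mathcal{A}_c)\right)3\overline w^2\mathcal{A}_c\overline w\\&-\tau^2\tfrac{3i}8\mathrm{e}^{2ic^2t_n}w^2c\langle\nabla\rangle_c^{-1}\left[3\varphi_2(2ic^2\tau)|w|^2w+\Omega_{c^2,2}(t_n,\tau,w)\right]\\&-\tau^2\tfrac{3i}8\mathrm{e}^{-2ic^2t_n}\overline w^2c\langle\nabla\rangle_c^{-1}\left[3\varphi_2(-2ic^2\tau)|w|^2w+\Omega_{c^2,-2}(t_n,\tau,w)\right]\\&+\tau^2\tfrac{6i}8\mathrm{e}^{-2ic^2t_n}|w|^2c\langle\nabla\rangle_c^{-1}\left[3\varphi_2(-2ic^2\tau)|w|^2\overline w+\overline{\Omega_{c^2,2}(t_n,\tau,w)}\right]\\&+\tau^2\tfrac{3i}8\mathrm{e}^{-4ic^2t_n}\overline w^2c\langle\nabla\rangle_c^{-1}\left[3\varphi_2(-4ic^2\tau)|w|^2\overline w+\overline{\Omega_{c^2,4}(t_n,\tau,w)}\right].\end{aligned}$$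 Second-order scheme with step size $\tau>0$, $t_n=n\tau$: $u_\ast^0=z(0)-ic^{-1}\langle\nabla\rangle_c^{-1}z'(0)$, $\mathcal{U}_\ast^n=\mathrm{e}^{i\frac\tau2\mathcal{A}_c}u_\ast^n$, and $$\begin{aligned}u_\ast^{n+1}&=\mathrm{e}^{i\frac\tau2\mathcal{A}_c}\mathrm{e}^{-i\tau\frac38|\mathcal{U}_\ast^n|^2}\mathcal{U}_\ast^n-\tau\tfrac{3i}8\left(c\langle\nabla\rangle_c^{-1}-1\right)\mathrm{e}^{i\frac\tau2\mathcal{A}_c}|\mathcal{U}_\ast^n|^2\mathcal{U}_\ast^n+\tau^2\theta(t_n,\tau,\mathcal{U}_\ast^n)\\&\quad-\tau^2\tfrac3{64}c\langle\nabla\rangle_c^{-1}\left[2|u_\ast^n|^2c\langle\nabla\rangle_c^{-1}\vartheta_{c^2}(t_n,\tau,u_\ast^n)-(u_\ast^n)^2c\langle\nabla\rangle_c^{-1}\overline{\vartheta_{c^2}(t_n,\tau,u_\ast^n)}\right]-\tfrac i8c\langle\nabla\rangle_c^{-1}I^1_{c^2}(\tau,t_n,u_\ast^n).\end{aligned}$$ Strang splitting for the limit equation $i\partial_tu_{\ast,\infty}=\frac12\Delta u_{\ast,\infty}+\frac38|u_{\ast,\infty}|^2u_{\ast,\infty}$: $$u_{\ast,\infty}^{n+1}=\mathrm{e}^{-i\frac\tau2\frac\Delta2}\,\mathrm{e}^{-i\tau\frac38\left|\mathrm{e}^{-i\frac\tau2\frac\Delta2}u_{\ast,\infty}^n\right|^2}\,\mathrm{e}^{-i\frac\tau2\frac\Delta2}u_{\ast,\infty}^n,\qquad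 u_{\ast,\infty}^0=\varphi-i\gamma.$$ *)

(* Defs.v *)
From HB Require Import structures.
From mathcomp Require Import all_boot all_order all_algebra.
From mathcomp Require Import all_classical all_reals all_analysis.
From mathcomp Require Import complex.

Set Implicit Arguments.
Unset Strict Implicit.
Unset Printing Implicit Defensive.

Import Order.TTheory GRing.Theory Num.Theory.
Import numFieldNormedType.Exports.

Local Open Scope classical_set_scope.
Local Open Scope complex_scope.
Local Open Scope ring_scope.

Section ComplexFunctions.
Context {R : realType}.
Implicit Types z : R[i].

Definition cexp z : R[i] :=
  (expR (complex.Re z))%:C * (cos (complex.Im z) +i* sin (complex.Im z)).

(* The values at 0 are the continuous extensions.  Note that varphi2 is
   (e^z - varphi1 z) / z, hence 1 - 1/2 = 1/2 at 0. *)
Definition varphi1 z : R[i] := if z == 0 then 1 else (cexp z - 1) / z.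
Definition varphi2 z : R[i] := if z == 0 then 2^-1 else (cexp z - varphi1 z) / z.

End ComplexFunctions.

(* A function on the torus T^d = (R / 2 pi Z)^d is a 2 pi-periodic function on
   R^d.  Elements of H^s, s > d/2, are identified with their continuous
   representatives. *)
Section Torus.
Context {R : realType}.

Definition torus_continuous d (u : 'rV[R]_d -> R[i]) : Prop :=
  [/\ continuous (fun x => complex.Re (u x)),
      continuous (fun x => complex.Im (u x)) &
      forall x (i : 'I_d), u (x + (2 * pi) *: delta_mx 0 i) = u x].

(* Iterated Lebesgue integral over [0, 2 pi]^d. *)
Fixpoint torus_int d : ('rV[R]_d -> R) -> R :=
  match d with
  | 0 => fun f => f 0
  | d'.+1 => fun f =>
      \int[lebesgue_measure]_(t in `[0, 2 * pi])
        torus_int (fun y : 'rV[R]_d' => f (row_mx (t%:M : 'rV[R]_1) y))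
  end.

Context {d : nat}.
Implicit Types (u : 'rV[R]_d -> R[i]) (k : 'rV[int]_d) (x : 'rV[R]_d).

Definition freq_dot k x : R := \sum_(i < d) (k 0 i)%:~R * x 0 i.
Definition freq_sq k : R := \sum_(i < d) (k 0 i)%:~R ^+ 2.

Definition fourier u k : R[i] :=
  ((2 * pi) ^- d)%:C *
  (torus_int (fun x => complex.Re (u x * cexp (- ('i * (freq_dot k x)%:C)))) +i*
   torus_int (fun x => complex.Im (u x * cexp (- ('i * (freq_dot k x)%:C))))).

(* Takes the value +oo when u is not in H^s. *)
Definition sobolev (s : R) u : \bar R :=
  ((\esum_(k in [set: 'rV[int]_d])
      ((1 + freq_sq k) `^ s * complex.Re (`|fourier u k| ^+ 2))%:E) `^ 2^-1)%E.

(* The index j ranges over {0, ..., 2N}^d, so that k = j - (N, ..., N) ranges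
   over the cube {-N, ..., N}^d. *)
Definition fourier_psum (a : 'rV[int]_d -> R[i]) (N : nat) x : R[i] :=
  \sum_(j : 'rV['I_(N.*2).+1]_d)
    let k := map_mx (fun m : 'I_(N.*2).+1 => m%:Z - N%:Z) j in
    a k * cexp ('i * (freq_dot k x)%:C).

(* The Fourier multiplier with symbol m, that is,
   x |-> \sum_k m k * fourier u k * e^{i k.x}.
   Its values are only meaningful where the series converges, which has to be
   ensured by the smoothness of u. *)
Definition fmult (m : 'rV[int]_d -> R[i]) u x : R[i] :=
  let S N := fourier_psum (fun k => m k * fourier u k) N x in
  limn (fun N => complex.Re (S N)) +i* limn (fun N => complex.Im (S N)).

End Torus.

Section Operators.
Context {R : realType} {d : nat}.
Implicit Types (c tau s tn : R) (u w : 'rV[R]_d -> R[i]) (k : 'rV[int]_d).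

Definition bracket c k : R := Num.sqrt (freq_sq k + c ^+ 2).
Definition symA c k : R := c * bracket c k - c ^+ 2.

Definition opA c u := fmult (fun k => (symA c k)%:C) u.
(* c <nabla>_c^{-1} *)
Definition opB c u := fmult (fun k => (c / bracket c k)%:C) u.
(* c <nabla>_c^{-1} - 1 *)
Definition opB1 c u := fmult (fun k => (c / bracket c k - 1)%:C) u.
(* c^{-1} <nabla>_c^{-1} *)
Definition opV c u := fmult (fun k => (c^-1 * (bracket c k)^-1)%:C) u.
(* e^{i s A_c} *)
Definition opE c s u := fmult (fun k => cexp ('i * (s * symA c k)%:C)) u.
(* e^{- i s Delta / 2}; the symbol of Delta is - |k|^2 *)
Definition opS s u := fmult (fun k => cexp ('i * (s * (freq_sq k / 2))%:C)) u.

Definition theta c tau w : 'rV[R]_d -> R[i] := fun x =>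
  - (1 / 2) * (9 / 64)
    * opE c (tau / 2) (opB1 c (fun y => `|w y| ^+ 4 * w y)) x
  - (1 / 2) * (9 / 32)
    * opB c (opE c (tau / 2) (fun y =>
        `|w y| ^+ 2 * opB1 c (fun y' => `|w y'| ^+ 2 * w y') y)) x
  + (1 / 2) * (9 / 64)
    * opB c (opE c (tau / 2) (fun y =>
        w y ^+ 2 * opB1 c (fun y' => `|w y'| ^+ 2 * (w y')^*) y)) x.

Definition vartheta c tn tau w : 'rV[R]_d -> R[i] := fun x =>
  let ic2 : R[i] := 'i * (c ^+ 2)%:C in
  let t : R[i] := tau%:C in
  cexp (2 * ic2 * tn%:C)
    * ((varphi1 (2 * ic2 * t) - 1) / (2 * ic2 * t)) * w x ^+ 3
  + 3 * cexp (- 2 * ic2 * tn%:C)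
    * ((varphi1 (- 2 * ic2 * t) - 1) / (- 2 * ic2 * t))
    * (`|w x| ^+ 2 * (w x)^*)
  + cexp (- 4 * ic2 * tn%:C)
    * ((varphi1 (- 4 * ic2 * t) - 1) / (- 4 * ic2 * t)) * (w x)^* ^+ 3.

Definition Omega c (l : int) tn tau w : 'rV[R]_d -> R[i] := fun x =>
  let ic2 : R[i] := 'i * (c ^+ 2)%:C in
  let t : R[i] := tau%:C in
  cexp (2 * ic2 * tn%:C)
    * ((varphi1 ((l + 2)%:~R * ic2 * t) - varphi1 (l%:~R * ic2 * t))
       / (2 * ic2 * t)) * w x ^+ 3
  + 3 * cexp (- 2 * ic2 * tn%:C)
    * ((varphi1 ((l - 2)%:~R * ic2 * t) - varphi1 (l%:~R * ic2 * t))
       / (- 2 * ic2 * t)) * (`|w x| ^+ 2 * (w x)^*)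
  + cexp (- 4 * ic2 * tn%:C)
    * ((varphi1 ((l - 4)%:~R * ic2 * t) - varphi1 (l%:~R * ic2 * t))
       / (- 4 * ic2 * t)) * (w x)^* ^+ 3.

Definition I1 c tau tn w : 'rV[R]_d -> R[i] := fun x =>
  let ic2 : R[i] := 'i * (c ^+ 2)%:C in
  let t : R[i] := tau%:C in
  let e (l : int) : R[i] := cexp (l%:~R * ic2 * tn%:C) in
  let wb y := (w y)^* in
  (* varphi_j (i tau (2 c^2 - Delta / 2)) *)
  let P (vphi : R[i] -> R[i]) := fmult (fun k : 'rV[int]_d =>
    vphi ('i * t * (2 * c ^+ 2 + freq_sq k / 2)%:C)) in
  (* varphi_j (i tau (l c^2 - A_c)) *)
  let Q (vphi : R[i] -> R[i]) (l : int) := fmult (fun k : 'rV[int]_d =>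
    vphi ('i * t * (l%:~R * c ^+ 2 - symA c k)%:C)) in
  (* Delta / 2 - A_c *)
  let D := fmult (fun k : 'rV[int]_d => (- (freq_sq k / 2) - symA c k)%:C) in
  t * e 2 * opE c tau (P varphi1 (fun y => w y ^+ 3)) x
  + 'i * t ^+ 2 * e 2
    * opE c tau (P varphi2 (fun y =>
        D (fun y' => w y' ^+ 3) y + 3 * w y ^+ 2 * opA c w y)) x
  + 3 * t * e (- 2)
    * opE c tau (Q varphi1 (- 2) (fun y => `|w y| ^+ 2 * wb y)) x
  + 3 * 'i * t ^+ 2 * e (- 2)
    * opE c tau (Q varphi2 (- 2) (fun y =>
        wb y ^+ 2 * opA c w y - 2 * `|w y| ^+ 2 * opA c wb y)) x
  + t * e (- 4) * opE c tau (Q varphi1 (- 4) (fun y => wb y ^+ 3)) x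
  - 'i * t ^+ 2 * e (- 4)
    * opE c tau (Q varphi2 (- 4) (fun y => 3 * wb y ^+ 2 * opA c wb y)) x
  - t ^+ 2 * (3 * 'i / 8) * e 2 * w x ^+ 2
    * opB c (fun y => 3 * varphi2 (2 * ic2 * t) * (`|w y| ^+ 2 * w y)
                      + Omega c 2 tn tau w y) x
  - t ^+ 2 * (3 * 'i / 8) * e (- 2) * wb x ^+ 2
    * opB c (fun y => 3 * varphi2 (- 2 * ic2 * t) * (`|w y| ^+ 2 * w y)
                      + Omega c (- 2) tn tau w y) x
  + t ^+ 2 * (6 * 'i / 8) * e (- 2) * `|w x| ^+ 2
    * opB c (fun y => 3 * varphi2 (- 2 * ic2 * t) * (`|w y| ^+ 2 * wb y)
                      + (Omega c 2 tn tau w y)^*) x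
  + t ^+ 2 * (3 * 'i / 8) * e (- 4) * wb x ^+ 2
    * opB c (fun y => 3 * varphi2 (- 4 * ic2 * t) * (`|w y| ^+ 2 * wb y)
                      + (Omega c 4 tn tau w y)^*) x.

(* e^{- i tau (3/8) |u|^2} u *)
Definition nl_phase tau u : 'rV[R]_d -> R[i] := fun x =>
  cexp (- ('i * (tau * (3 / 8))%:C * `|u x| ^+ 2)) * u x.

Definition scheme_step c tau tn u : 'rV[R]_d -> R[i] := fun x =>
  let t : R[i] := tau%:C in
  let U := opE c (tau / 2) u in
  let vt := vartheta c tn tau u in
  opE c (tau / 2) (nl_phase tau U) x
  - t * (3 * 'i / 8)
    * opB1 c (opE c (tau / 2) (fun y => `|U y| ^+ 2 * U y)) x
  + t ^+ 2 * theta c tau U x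
  - t ^+ 2 * (3 / 64)
    * opB c (fun y => 2 * `|u y| ^+ 2 * opB c vt y
                      - u y ^+ 2 * opB c (fun y' => (vt y')^*) y) x
  - 'i / 8 * opB c (I1 c tau tn u) x.

(* The arguments z0 and z1 are the initial data z(0) and z'(0) *)
Fixpoint scheme c tau (z0 z1 : 'rV[R]_d -> R) (n : nat) : 'rV[R]_d -> R[i] :=
  match n with
  | 0 => fun x => (z0 x)%:C - 'i * opV c (fun y => (z1 y)%:C) x
  | m.+1 => scheme_step c tau (m%:R * tau) (scheme c tau z0 z1 m)
  end.

Fixpoint strang tau (phi gamma : 'rV[R]_d -> R[i]) (n : nat) :
    'rV[R]_d -> R[i] :=
  match n with
  | 0 => fun x => phi x - 'i * gamma x
  | m.+1 => opS (tau / 2) (nl_phase tau (opS (tau / 2) (strang tau phi gamma m)))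
  end.

End Operators.

(* Main.v *)
Require Import Defs.
From HB Require Import structures.
From mathcomp Require Import all_boot all_order all_algebra.
From mathcomp Require Import all_classical all_reals all_analysis.
From mathcomp Require Import complex.
From mathcomp Require Import ring lra zify.

Set Implicit Arguments.
Unset Strict Implicit.
Unset Printing Implicit Defensive.

Import Order.TTheory GRing.Theory Num.Theory.
Import numFieldNormedType.Exports.

Local Open Scope classical_set_scope.
Local Open Scope complex_scope.
Local Open Scope ring_scope.

(* On every H^sigma with sigma > d/2 the product is bounded, and a torus-continuous
   function with finite norm is the uniform limit of its Fourier series, so the scheme
   becomes a composition of multilinear maps and multipliers. Write Phi_c for one step
   of the scheme and Phi_oo for one Strang step; tau c >= 1 and tau <= 1 give c >= 1
   and c^-2 <= tau / c.
   - Phi_c u is the phase step plus a residual. The residual is O(tau) in H^(r+3) when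
     u is bounded there: the derivative lost by A_c (norm c from H^(r+3) to H^(r+2)) is
     regained by varphi2(i tau (l c^2 - A_c)), of norm O(1 / (tau c)) from H^(r+2) to
     H^(r+3). Hence the scheme stays bounded in H^(r+3) on a time interval of length
     depending only on the bound of the data.
   - In H^r the residual is O(tau / c), by |c / <k>_c - 1| <= |k| / c and
     |varphi_j(ix)| <= 2 / |x|, and replacing e^(i tau A_c / 2) by
     e^(-i tau Delta / 4) costs O(tau / c), by |A_c(k) - |k|^2 / 2| <= |k|^3 / c.
   - Phi_oo is Lipschitz on bounded sets of H^r with constant 1 + O(tau), so the local
     errors add up to O(1 / c). *)

(** * Integration over the torus *)

Lemma cont_cst (T U : topologicalType) (a : U) : continuous (fun _ : T => a).
Proof. by move=> x; exact: cvg_cst. Qed.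

Section Continuity.
Context {R : realType} (T : topologicalType).
Implicit Types f g : T -> R.

Lemma contD f g : continuous f -> continuous g -> continuous (fun x => f x + g x).
Proof. by move=> cf cg x; exact: cvgD (cf x) (cg x). Qed.

Lemma contM f g : continuous f -> continuous g -> continuous (fun x => f x * g x).
Proof. by move=> cf cg x; exact: cvgM (cf x) (cg x). Qed.

Lemma contN f : continuous f -> continuous (fun x => - f x).
Proof. by move=> cf x; exact: cvgN (cf x). Qed.

Lemma contZ a f : continuous f -> continuous (fun x => a * f x).
Proof. by move=> cf; apply: contM => //; exact: cont_cst. Qed.

Lemma cont_sum (I : Type) (s : seq I) (F : I -> T -> R) :
  (forall i, continuous (F i)) -> continuous (fun x => \sum_(i <- s) F i x).
Proof.
move=> cF; elim: s => [|i s IH].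
  rewrite (_ : (fun _ => _) = fun=> 0); first exact: cont_cst.
  by apply/funext => x; rewrite big_nil.
rewrite (_ : (fun _ => _) = fun x => F i x + \sum_(j <- s) F j x).
  exact: contD.
by apply/funext => x; rewrite big_cons.
Qed.

End Continuity.

Lemma cont_pair (T U V : topologicalType) (f : T -> U) (g : T -> V) :
  continuous f -> continuous g -> continuous (fun x => (f x, g x)).
Proof. by move=> cf cg x; exact: cvg_pair (cf x) (cg x). Qed.

Lemma cont_compose (T U V : topologicalType) (f : T -> U) (h : U -> V) :
  continuous h -> continuous f -> continuous (fun x => h (f x)).
Proof. by move=> ch cf x; apply: continuous_comp; [exact: cf|exact: ch]. Qed.

Lemma cont_id (T : topologicalType) : continuous (fun x : T => x).
Proof. by move=> x; exact: cvg_id. Qed.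

Lemma cont_fst (T U : topologicalType) : continuous (@fst T U).
Proof. by move=> x; exact: cvg_fst. Qed.

Lemma cont_snd (T U : topologicalType) : continuous (@snd T U).
Proof. by move=> x; exact: cvg_snd. Qed.

Section ConsRow.
Context {K : pzRingType}.

Definition consr d (t : K) (y : 'rV[K]_d) : 'rV[K]_d.+1 :=
  row_mx (t%:M : 'rV[K]_1) y.

Lemma consr0 d (t : K) (y : 'rV[K]_d) i : consr t y i ord0 = t.
Proof.
rewrite (_ : ord0 = lshift d (ord0 : 'I_1) :> 'I_d.+1); last exact: val_inj.
transitivity ((t%:M : 'rV[K]_1) i ord0); first exact: row_mxEl.
by rewrite !mxE !ord1 mulr1n.
Qed.

Lemma consrS d (t : K) (y : 'rV[K]_d) i k : consr t y i (lift ord0 k) = y i k.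
Proof.
rewrite (_ : lift ord0 k = rshift 1 k :> 'I_d.+1); last exact: val_inj.
exact: row_mxEr.
Qed.

Lemma consr_inj d (t t' : K) (y y' : 'rV[K]_d) :
  consr t y = consr t' y' -> t = t' /\ y = y'.
Proof.
move=> e; split; first by rewrite -(consr0 t y 0) e consr0.
by apply/rowP => i; rewrite -(consrS t) e consrS.
Qed.

Lemma consr_ind d (P : 'rV[K]_d.+1 -> Prop) :
  (forall t y, P (consr t y)) -> forall x, P x.
Proof.
move=> h x.
rewrite (_ : x = consr (x 0 ord0) (\row_i x 0 (lift ord0 i))); first exact: h.
apply/rowP => j; case: (unliftP ord0 j) => [k ->|->].
  by rewrite consrS mxE.
by rewrite consr0.
Qed.

End ConsRow.

Section TorusIntegral.
Context {R : realType}.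
Implicit Types (d : nat) (f g : R -> R).


Lemma integrable_cont f : continuous f ->
  lebesgue_measure.-integrable `[0, 2 * pi] (EFin \o f).
Proof.
move=> cf; apply: continuous_compact_integrable; first exact: segment_compact.
exact: continuous_subspaceT.
Qed.

Definition itv_int f : R := \int[lebesgue_measure]_(t in `[0, 2 * pi]) f t.

Lemma itv_intD f g : continuous f -> continuous g ->
  itv_int (fun t => f t + g t) = itv_int f + itv_int g.
Proof. by move=> cf cg; apply: RintegralD => //; exact: integrable_cont. Qed.

Lemma itv_intZ a f : continuous f -> itv_int (fun t => a * f t) = a * itv_int f.
Proof. by move=> cf; apply: RintegralZl => //; exact: integrable_cont. Qed.

Lemma le_itv_int f g : continuous f -> continuous g ->
  (forall t, t \in `[0, 2 * pi] -> f t <= g t) -> itv_int f <= itv_int g.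
Proof.
move=> cf cg fg; apply: le_Rintegral => //; try exact: integrable_cont.
Qed.

Lemma itv_int_cst a : itv_int (fun=> a) = 2 * pi * a.
Proof.
transitivity (itv_int (fun t => a * 1)); first by congr itv_int; apply/funext => t; rewrite mulr1.
rewrite itv_intZ; last exact: cst_continuous.
rewrite mulrC; congr (_ * _); rewrite /itv_int.
rewrite Rintegral_cst// mul1r.
have := @lebesgue_measure_itv R `[0, 2 * pi].
rewrite /= lte_fin mulr_gt0 ?pi_gt0// oppr0 adde0 => mE.
transitivity (fine ((2 * pi)%:E : \bar R)) => //; congr fine; exact: mE.
Qed.

Lemma continuous_itv_int (T : topologicalType) (h : T * R -> R) :
  continuous h -> continuous (fun t => itv_int (fun s => h (t, s))).
Proof.
move=> ch t0.
have chs t : continuous (fun s => h (t, s)).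
  by apply: cont_compose ch _; apply: cont_pair; [exact: cont_cst|exact: cont_id].
apply/cvgrPdist_le => e e0.
have e'0 : 0 < e / (2 * pi) by rewrite divr_gt0 ?mulr_gt0 ?pi_gt0.
have : \forall t \near t0, `[0, 2 * pi] `<=`
    (fun s => `|h (t0, s) - h (t, s)| <= e / (2 * pi)).
  have /compact_near_coveringP := @segment_compact R 0 (2 * pi).
  apply => s _.
  have /cvgrPdist_lt h1 := ch (t0, s).
  have e20 : 0 < e / (2 * pi) / 2 by rewrite divr_gt0.
  have h2 := h1 _ e20.
  have h3 : \forall s' \near s, `|h (t0, s) - h (t0, s')| < e / (2 * pi) / 2.
    by have /cvgrPdist_lt := chs t0 s; apply.
  case: h2 => -[A B] /= [A1 B1] AB.
  exists (B `&` [set s' | `|h (t0, s) - h (t0, s')| < e / (2 * pi) / 2], A).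
    by split => //=; exact: filterI.
  move=> [s' t] /= [[Bs h3s] At].
  have := AB (t, s') (conj At Bs) => /= h4.
  rewrite -(subrK (h (t0, s)) (h (t0, s'))) -addrA.
  apply: (le_trans (ler_normD _ _)).
  rewrite distrC (splitr (e / (2 * pi))) lerD// ltW//.
apply: filterS => t ht.
rewrite [X in X <= _](_ : _ = `|itv_int (fun s => h (t0, s) + (-1) * h (t, s))|).
  have cF : continuous (fun s => h (t0, s) + (-1) * h (t, s)).
    by apply: contD => //; exact: contZ.
  apply: (le_trans (le_normr_Rintegral _ (integrable_cont cF))) => //.
  rewrite -[leRHS](_ : itv_int (fun=> e / (2 * pi)) = _).
    apply: le_itv_int.
    - by apply: cont_compose cF; exact: norm_continuous.
    - exact: cont_cst.
    - by move=> s sI; rewrite mulN1r; exact: ht.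
  by rewrite itv_int_cst mulrC divfK// gt_eqF// mulr_gt0// pi_gt0.
rewrite itv_intD; [|exact: chs|].
  by rewrite itv_intZ; [rewrite mulN1r|exact: chs].
exact: contZ.
Qed.

Lemma continuous_consr d : continuous (fun p : R * 'rV[R]_d => consr p.1 p.2).
Proof.
move=> [t y]; apply/cvg_ballP => e e0.
exists (ball t e, ball y e); first by split; exact: nbhsx_ballx.
move=> [t' y'] /= [b1 [_ b2]]; split=> // i j.
case: (unliftP ord0 j) => [k ->|->].
  by rewrite !consrS; exact: b2.
by rewrite !consr0.
Qed.

Lemma continuous_torus_int d (T : topologicalType) (h : T * 'rV[R]_d -> R) :
  continuous h -> continuous (fun t => torus_int (fun y => h (t, y))).
Proof.
elim: d T h => [|d IH] T h ch /=.
  by apply: cont_compose ch _; apply: cont_pair; [exact: cont_id|exact: cont_cst].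
apply: (@continuous_itv_int T (fun p => torus_int (fun y => h (p.1, consr p.2 y)))).
apply: (IH (T * R)%type (fun q => h (q.1.1, consr q.1.2 q.2))).
apply: cont_compose ch _; apply: cont_pair.
  exact: cont_compose (@cont_fst _ _) (@cont_fst _ _).
apply: (@cont_compose _ _ _ (fun q : (T * R) * 'rV[R]_d => (q.1.2, q.2))
  (fun p : R * 'rV[R]_d => consr p.1 p.2)); first exact: continuous_consr.
apply: cont_pair; last exact: cont_snd.
exact: cont_compose (@cont_snd _ _) (@cont_fst _ _).
Qed.

End TorusIntegral.

Section TorusIntegralTheory.
Context {R : realType}.
Implicit Types (d : nat).

Lemma torus_intS d (f : 'rV[R]_d.+1 -> R) :
  torus_int f = itv_int (fun t => torus_int (fun y => f (consr t y))).
Proof. by []. Qed.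

Lemma cont_slice d (f : 'rV[R]_d.+1 -> R) (t : R) : continuous f ->
  continuous (fun y : 'rV[R]_d => f (consr t y)).
Proof.
move=> cf; apply: (@cont_compose _ _ _ (fun y : 'rV[R]_d => (t, y))
  (fun p : R * 'rV[R]_d => f (consr p.1 p.2))).
  by apply: cont_compose cf _; exact: continuous_consr.
by apply: cont_pair; [exact: cont_cst|exact: cont_id].
Qed.

Lemma cont_torus_int_slice d (f : 'rV[R]_d.+1 -> R) : continuous f ->
  continuous (fun t : R => torus_int (fun y => f (consr t y))).
Proof.
move=> cf; apply: (@continuous_torus_int _ d R (fun p => f (consr p.1 p.2))).
by apply: cont_compose cf _; exact: continuous_consr.
Qed.

Lemma torus_intD d (f g : 'rV[R]_d -> R) : continuous f -> continuous g ->
  torus_int (fun x => f x + g x) = torus_int f + torus_int g.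
Proof.
elim: d f g => [|d IH] f g cf cg //.
rewrite !torus_intS -itv_intD; try exact: cont_torus_int_slice.
by congr itv_int; apply/funext => t; rewrite IH//; exact: cont_slice.
Qed.

Lemma torus_intZ d a (f : 'rV[R]_d -> R) : continuous f ->
  torus_int (fun x => a * f x) = a * torus_int f.
Proof.
elim: d f => [|d IH] f cf //.
rewrite !torus_intS -itv_intZ; last exact: cont_torus_int_slice.
by congr itv_int; apply/funext => t; rewrite IH//; exact: cont_slice.
Qed.

Lemma le_torus_int d (f g : 'rV[R]_d -> R) : continuous f -> continuous g ->
  (forall x, f x <= g x) -> torus_int f <= torus_int g.
Proof.
elim: d f g => [|d IH] f g cf cg fg; first exact: fg.
rewrite !torus_intS; apply: le_itv_int; try exact: cont_torus_int_slice.
by move=> t _; apply: IH => //; exact: cont_slice.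
Qed.

Lemma torus_int_cst d a : torus_int (fun _ : 'rV[R]_d => a) = (2 * pi) ^+ d * a.
Proof.
elim: d => [|d IH]; first by rewrite expr0 mul1r.
rewrite torus_intS (_ : (fun _ => _) = fun=> (2 * pi) ^+ d * a).
  by rewrite itv_int_cst exprS mulrA.
by apply/funext.
Qed.

Lemma torus_int_bound d (f : 'rV[R]_d -> R) M : continuous f ->
  (forall x, `|f x| <= M) -> `|torus_int f| <= (2 * pi) ^+ d * M.
Proof.
move=> cf fM; rewrite ler_norml -mulrN -!torus_int_cst.
have {}fM x : - M <= f x <= M by rewrite -ler_norml.
by rewrite !le_torus_int//; try exact: cont_cst; move=> x; case/andP: (fM x).
Qed.

Lemma freq_dot_consr d (k : 'rV[int]_d) m t (y : 'rV[R]_d) :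
  freq_dot (consr m k) (consr t y) = m%:~R * t + freq_dot k y.
Proof.
rewrite /freq_dot big_ord_recl !consr0; congr (_ + _).
by apply: eq_bigr => i _; rewrite !consrS.
Qed.

Lemma continuous_coord d i : continuous (fun x : 'rV[R]_d => x 0 i).
Proof. exact: coord_continuous. Qed.

Lemma continuous_freq_dot d (k : 'rV[int]_d) :
  continuous (fun x : 'rV[R]_d => freq_dot k x).
Proof. by apply: cont_sum => i; apply: contZ; exact: continuous_coord. Qed.

Lemma sinD2piz (m : int) (a : R) : sin (a + m%:~R * (2 * pi)) = sin a.
Proof.
have h n b : sin (b + n%:R * (2 * pi)) = sin b :> R.
  by rewrite mulr_natl (mulr_natl pi) (periodicn (@sinD2pi R)).
case: m => n; first exact: h.
by rewrite NegzE mulrNz mulNr -[LHS](h n.+1) subrK.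
Qed.

Lemma itv_int_derive (f F : R -> R) : continuous f ->
  (forall t : R, is_derive t 1 F (f t)) -> itv_int f = F (2 * pi) - F 0.
Proof.
move=> cf dF.
have cF : continuous F.
  move=> t; apply: differentiable_continuous; apply/derivable1_diffP.
  exact: (@ex_derive _ _ _ _ _ _ _ (dF t)).
have := @continuous_FTC2 R f F 0 (2 * pi).
rewrite mulr_gt0 ?pi_gt0// => /(_ isT (continuous_subspaceT cf)).
rewrite /itv_int /Rintegral => -> //.
- split.
  + by move=> t _; exact: (@ex_derive _ _ _ _ _ _ _ (dF t)).
  + by apply: cvg_at_right_filter; exact: cF.
  + by apply: cvg_at_left_filter; exact: cF.
- by move=> t _; rewrite derive1E; exact: (@derive_val _ _ _ _ _ _ _ (dF t)).
Qed.

Lemma continuous_cos_affine (a m : R) : continuous (fun t : R => cos (a + m * t)).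
Proof.
apply: cont_compose; first exact: continuous_cos.
by apply: contD; [exact: cont_cst|apply: contZ; exact: cont_id].
Qed.

Lemma itv_int_cos (m : int) (a : R) : m != 0 ->
  itv_int (fun t => cos (a + m%:~R * t)) = 0.
Proof.
move=> m0; have mR : m%:~R != 0 :> R by rewrite intr_eq0.
have dF (t : R) : is_derive t 1 (fun t : R => m%:~R^-1 * sin (a + m%:~R * t))
    (cos (a + m%:~R * t)).
  apply: is_derive_eq.
  by rewrite add0r mul1r /GRing.scale /= mulr1 mulrCA mulVf ?mulr1.
rewrite (itv_int_derive (@continuous_cos_affine _ _) dF).
by rewrite mulr0 addr0 sinD2piz subrr.
Qed.

Lemma consr00 d : consr 0 0 = 0 :> 'rV[int]_d.+1.
Proof.
by apply/rowP => j; case: (unliftP ord0 j) => [k ->|->]; rewrite ?consrS ?consr0 !mxE.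
Qed.

Lemma torus_int_cos d (k : 'rV[int]_d) (a : R) :
  torus_int (fun x => cos (a + freq_dot k x)) =
  if k == 0 then (2 * pi) ^+ d * cos a else 0.
Proof.
elim: d k a => [|d IH] k a.
  rewrite /= /freq_dot big_ord0 addr0 expr0 mul1r.
  by rewrite (_ : k = 0) ?eqxx//; apply/rowP => -[].
move: k; apply: consr_ind => m k; rewrite torus_intS.
under eq_fun do under eq_fun do rewrite freq_dot_consr addrA.
under eq_fun do rewrite IH.
have -> : (consr m k == 0) = (m == 0) && (k == 0).
  rewrite -consr00; apply/eqP/andP => [/consr_inj[-> ->]//|[/eqP-> /eqP->]//].
have [_|_] := eqVneq k 0; last by rewrite andbF itv_int_cst mulr0.
rewrite andbT itv_intZ; last exact: continuous_cos_affine.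
have [->|m0] := eqVneq m 0; last by rewrite itv_int_cos ?mulr0.
under eq_fun do rewrite mul0r addr0.
by rewrite itv_int_cst mulrCA mulrA exprS.
Qed.

End TorusIntegralTheory.

(** * Uniqueness of Fourier coefficients *)

Section Uniqueness.
Context {R : realType}.
Implicit Types (d : nat) (g : R -> R).

Lemma cos_le_far (delta s : R) : 0 <= delta -> delta <= s -> s <= 2 * pi - delta ->
  cos s <= cos delta.
Proof.
move=> d0 ds sd; have [spi|spi] := leP s pi.
  have dpi : delta <= pi by exact: le_trans ds spi.
  have := @ltr_cos R s delta; rewrite !in_itv /= => h.
  rewrite leNgt h ?d0 ?dpi ?spi ?(le_trans d0 ds)//; by rewrite -leNgt.
have -> : cos s = cos (2 * pi - s).
  by rewrite -(cosN s) -(cosD2pi (- s)) mulr_natl addrC.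
have d2 : 2 * pi - s <= pi by lra.
have dpi : delta <= pi by lra.
have := @ltr_cos R (2 * pi - s) delta; rewrite !in_itv /= => h.
rewrite leNgt h ?d0 ?dpi ?d2 ?andbT ?subr_ge0//.
- by rewrite -leNgt; lra.
- by lra.
Qed.

Definition hcos (t0 t : R) : R := (1 + cos (t - t0)) / 2.

Lemma continuous_hcosX t0 n : continuous (fun t => hcos t0 t ^+ n).
Proof.
elim: n => [|n IH].
  rewrite (_ : (fun _ => _) = fun=> 1); first exact: cont_cst.
  by apply/funext => t; rewrite expr0.
rewrite (_ : (fun _ => _) = fun t => hcos t0 t * hcos t0 t ^+ n); last first.
  by apply/funext => t; rewrite exprS.
apply: contM => //; rewrite /hcos.
apply: contM; last exact: cont_cst.
apply: contD; first exact: cont_cst.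
apply: cont_compose; first exact: continuous_cos.
by apply: contD; [exact: cont_id|exact: cont_cst].
Qed.

(* Integrate the derivative of [sin (t - t0) * hcos t0 t ^+ n]. *)
Lemma itv_int_hcosS t0 n :
  (2 * n + 2)%:R * itv_int (fun t => hcos t0 t ^+ n.+1) =
  (2 * n + 1)%:R * itv_int (fun t => hcos t0 t ^+ n).
Proof.
apply/eqP; rewrite -subr_eq0 -mulNr -!itv_intZ; try exact: continuous_hcosX.
rewrite -itv_intD; try by apply: contZ; exact: continuous_hcosX.
have dF (t : R) : is_derive t 1 (fun t : R => sin (t - t0) * (hcos t0 t) ^+ n)
    ((2 * n + 2)%:R * hcos t0 t ^+ n.+1 + - (2 * n + 1)%:R * hcos t0 t ^+ n).
  have d1 : is_derive t 1 (hcos t0) (- sin (t - t0) / 2).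
    rewrite /hcos; apply: is_derive_eq.
    by rewrite /GRing.scale /=; ring.
  have d2 := is_deriveX n d1.
  have hX u : (hcos t0 ^+ n) u = hcos t0 u ^+ n.
    by elim: n {d2} => [|m IH]; rewrite ?expr0// !exprS -IH.
  rewrite (_ : (fun _ => _) = (fun t => sin (t - t0)) * (hcos t0) ^+ n); last first.
    by apply/funext => u; rewrite -hX.
  apply: is_derive_eq.
  rewrite hX /GRing.scale /=.
  have s2 := sin2cos2 (t - t0); have hE : hcos t0 t = (1 + cos (t - t0)) / 2 by [].
  have {hE} cE : cos (t - t0) = 2 * hcos t0 t - 1 by rewrite hE; field.
  rewrite cE in s2 *; move: s2; move: (hcos t0 t) (sin _) => h s s2 {d1 d2 hX cE}.
  case: n => [|n]; first by rewrite !expr0 expr1 /=; lra.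
  rewrite succnK.
  transitivity (- (n.+1%:R * h ^+ n) / 2 * s ^+ 2 + h ^+ n.+1 * (2 * h - 1)).
    by ring.
  by rewrite s2 !exprS; field.
rewrite (itv_int_derive _ dF).
  rewrite /hcos.
  have h1 : sin (2 * pi - t0) = sin (0 - t0) by rewrite sub0r addrC mulr_natl sinD2pi.
  have h2 : cos (2 * pi - t0) = cos (0 - t0) by rewrite sub0r addrC mulr_natl cosD2pi.
  by rewrite h1 h2 subrr.
by apply: contD; apply: contZ; exact: continuous_hcosX.
Qed.

Lemma itv_int_hcos_gt0 t0 n : 0 < itv_int (fun t => hcos t0 t ^+ n).
Proof.
elim: n => [|n IH].
  under eq_fun do rewrite expr0.
  by rewrite itv_int_cst mulr1 mulr_gt0 ?pi_gt0.
have n0 : 0 < (2 * n + 2)%:R :> R by rewrite ltr0n addn2.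
by rewrite -(pmulr_rgt0 _ n0) itv_int_hcosS mulr_gt0// ltr0n addn1.
Qed.

Lemma itv_int_mul_hcos g t0 :
  continuous g ->
  (forall (m : int) a, itv_int (fun t => g t * cos (a + m%:~R * t)) = 0) ->
  forall n, itv_int (fun t => g t * hcos t0 t ^+ n) = 0.
Proof.
move=> cg g0 n.
suff /(_ 0 0) : forall (m : int) a,
    itv_int (fun t => g t * hcos t0 t ^+ n * cos (a + m%:~R * t)) = 0.
  under eq_fun do rewrite mul0r addr0 cos0 mulr1.
  by [].
elim: n => [|n IH] m a.
  by under eq_fun do rewrite expr0 mulr1.
have cgn b (k : int) : continuous (fun t => g t * hcos t0 t ^+ n * cos (b + k%:~R * t)).
  by apply: contM; [apply: contM => //; exact: continuous_hcosX|exact: continuous_cos_affine].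
rewrite (_ : (fun _ => _) = fun t =>
   2^-1 * (g t * hcos t0 t ^+ n * cos (a + m%:~R * t)) +
   (4^-1 * (g t * hcos t0 t ^+ n * cos ((a - t0) + (m + 1)%:~R * t)) +
    4^-1 * (g t * hcos t0 t ^+ n * cos ((a + t0) + (m - 1)%:~R * t)))).
  rewrite !itv_intD ?itv_intZ ?IH ?mulr0 ?addr0//; try by apply: contZ.
  by apply: contD; exact: contZ.
apply/funext => t.
have -> : a - t0 + (m + 1)%:~R * t = (a + m%:~R * t) + (t - t0).
  by rewrite rmorphD /=; ring.
have -> : a + t0 + (m - 1)%:~R * t = (a + m%:~R * t) - (t - t0).
  by rewrite rmorphB /=; ring.
by rewrite exprS [hcos t0 t]/hcos; move: (t - t0) (a + _) => u b; rewrite cosB cosD; field.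
Qed.

(* If [g t0 > 0] then [g >= eta - C (1 - cos (. - t0))] on the period. Integrating
   against [hcos t0 ^+ n] gives [eta kap n <= 2 C (kap n - kap n.+1)], which contradicts
   [kap n.+1 / kap n --> 1]. *)
Lemma le0_of_int_cos0 g (t0 : R) :
  continuous g -> 0 < t0 < 2 * pi ->
  (forall (m : int) a, itv_int (fun t => g t * cos (a + m%:~R * t)) = 0) ->
  g t0 <= 0.
Proof.
move=> cg /andP[t00 t02] g0; rewrite leNgt; apply/negP => gt0.
set eta := g t0 / 2.
have eta0 : 0 < eta by rewrite divr_gt0.
have pi2 : 0 <= 2 * pi :> R by rewrite mulr_ge0 ?pi_ge0.
have [xm _ gB] : exists2 c, c \in `[0, 2 * pi]%R &
    forall t, t \in `[0, 2 * pi]%R -> - g t <= - g c.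
  apply: (@EVT_max _ (fun t => - g t)) => //.
  by apply: continuous_subspaceT; exact: contN.
pose B := Num.max 0 (- g xm).
have B0 : 0 <= B by rewrite le_max lexx.
have {}gB t : t \in `[0, 2 * pi]%R -> - B <= g t.
  by move=> /gB h; rewrite lerNl; rewrite (le_trans h)// le_max lexx orbT.
have [delta [d0 dt0 dt2 dpi near]] : exists delta, [/\ 0 < delta, delta <= t0,
    delta <= 2 * pi - t0, delta <= pi &
    forall t, `|t - t0| < delta -> eta <= g t].
  have /cvgrPdist_le /(_ _ eta0) := cg t0.
  move=> /nbhs_ballP[e /= e0 he].
  exists (Num.min e (Num.min t0 (Num.min (2 * pi - t0) pi))); split.
  - by rewrite !lt_min e0 t00 subr_gt0 t02 pi_gt0.
  - by rewrite !ge_min lexx orbT.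
  - by rewrite !ge_min lexx !orbT.
  - by rewrite !ge_min lexx !orbT.
  - move=> t; rewrite lt_min => /andP[target _].
    have := he t; rewrite /ball /= distrC target => /(_ isT).
    rewrite ler_norml => /andP[_]; rewrite /eta; lra.
have cd1 : cos delta < 1.
  have := @ltr_cos R 0 delta; rewrite !in_itv /= lexx pi_ge0 ltW//= dpi => /(_ isT isT).
  by rewrite cos0 d0.
pose C := (B + eta) / (1 - cos delta).
have C0 : 0 < C by rewrite divr_gt0 ?subr_gt0// ltr_wpDl.
have gC t : t \in `[0, 2 * pi]%R -> eta - C * (1 - cos (t - t0)) <= g t.
  move=> tI; have := cos_le1 (t - t0) => c1.
  have [td|td] := ltP `|t - t0| delta.
    apply: (le_trans _ (near _ td)); rewrite lerBlDr lerDl mulr_ge0 ?subr_ge0 ?(ltW C0)//.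
  apply: le_trans (gB _ tI); rewrite lerBlDr addrC -lerBlDr opprK addrC.
  rewrite -(divfK (lt0r_neq0 (_ : 0 < 1 - cos delta)) (B + eta)) ?subr_gt0// -/C.
  rewrite ler_pM2l// lerD2l lerN2 -cos_norm; apply: cos_le_far => //; first exact: ltW.
  move: tI; rewrite in_itv /= => /andP[t0' t2'].
  by rewrite ler_norml; apply/andP; split; lra.
pose kap n := itv_int (fun t => hcos t0 t ^+ n).
have kapP n : eta * kap n - 2 * C * (kap n - kap n.+1) <= 0.
  rewrite -(itv_int_mul_hcos t0 cg g0 n).
  have cX k : continuous (fun t => hcos t0 t ^+ k) by exact: continuous_hcosX.
  have -> : eta * kap n - 2 * C * (kap n - kap n.+1) =
      itv_int (fun t => (eta - 2 * C) * hcos t0 t ^+ n + (2 * C) * hcos t0 t ^+ n.+1).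
    rewrite itv_intD ?itv_intZ//; try by apply: contZ; exact: cX.
    by rewrite /kap; ring.
  apply: le_itv_int.
  - by apply: contD; apply: contZ; exact: cX.
  - by apply: contM => //; exact: cX.
  move=> t tI.
  have -> : (eta - 2 * C) * hcos t0 t ^+ n + 2 * C * hcos t0 t ^+ n.+1 =
     (eta - C * (1 - cos (t - t0))) * hcos t0 t ^+ n.
    by rewrite exprS [X in 2 * C * (X * _)]/hcos; field.
  apply: ler_wpM2r; last exact: gC.
  by apply: exprn_ge0; rewrite /hcos divr_ge0// -lerBlDl sub0r cos_geN1.
have etaC n : eta * (n.+1%:R) <= C.
  have k0 : 0 < kap n by exact: itv_int_hcos_gt0.
  have := kapP n; have := itv_int_hcosS t0 n; rewrite -/(kap n) -/(kap n.+1).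
  have -> : (2 * n + 2)%:R = 2 * n.+1%:R :> R by rewrite -natrM mulnS addnC.
  have -> : (2 * n + 1)%:R = 2 * n.+1%:R - 1 :> R by ring.
  move=> h1 h2; rewrite -(ler_pM2r k0).
  have n0 : 0 < n.+1%:R :> R by rewrite ltr0n.
  have : n.+1%:R * (eta * kap n - 2 * C * (kap n - kap n.+1)) <= 0.
    by rewrite pmulr_rle0.
  have -> : n.+1%:R * (eta * kap n - 2 * C * (kap n - kap n.+1)) =
      eta * n.+1%:R * kap n - 2 * C * n.+1%:R * kap n + C * (2 * n.+1%:R * kap n.+1) by ring.
  by rewrite h1; lra.
have := etaC (Num.truncn (C / eta)).
rewrite leNgt -ltr_pdivrMl// mulrC; case/negP.
rewrite truncnS_gt//.
Qed.

Lemma periodicz g (T : R) : periodic g T -> forall (m : int) a, g (a + m%:~R * T) = g a.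
Proof.
move=> gT m a; case: m => n; first by rewrite mulr_natl (periodicn gT).
rewrite NegzE mulrNz mulNr -[LHS](periodicn gT n.+1) -mulr_natl subrK//.
Qed.

Lemma eq0_of_int_cos0 g :
  continuous g -> periodic g (2 * pi) ->
  (forall (m : int) a, itv_int (fun t => g t * cos (a + m%:~R * t)) = 0) ->
  forall t, g t = 0.
Proof.
move=> cg pg g0.
have pi2 : 0 < 2 * pi :> R by rewrite mulr_gt0 ?pi_gt0.
have h1 t : 0 < t < 2 * pi -> g t = 0.
  move=> tI; apply/eqP; rewrite eq_le le0_of_int_cos0//=.
  rewrite -oppr_le0; apply: (@le0_of_int_cos0 (fun t => - g t)) => //.
    exact: contN.
  move=> m a; have := g0 m a => /(congr1 (fun x => - 1 * x)).
  rewrite -itv_intZ; last by apply: contM => //; exact: continuous_cos_affine.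
  by rewrite mulr0 => <-; congr itv_int; apply/funext => u; ring.
have h0 : g 0 = 0.
  apply/eqP; apply: contraT => g00.
  have /nbhs_ballP[e /= e0 he] : \forall t \near (0 : R), g t != 0.
    exact: (@cvgr_neq0 _ _ _ (nbhs (0 : R)) _ g (g 0) (cg 0) g00).
  have m0 : 0 < Num.min e pi by rewrite lt_min e0 pi_gt0.
  have := he (Num.min e pi / 2); rewrite /ball /= sub0r normrN gtr0_norm ?divr_gt0//.
  have me : Num.min e pi <= e by rewrite ge_min lexx.
  have mpi : Num.min e pi <= pi by rewrite ge_min lexx orbT.
  have pp := @pi_gt0 R.
  rewrite h1 ?eqxx; first by move=> /(_ _)/negP h; exfalso; apply: h => //; lra.
  by apply/andP; split; lra.
move=> t; rewrite -[t](subrK ((Num.floor (t / (2 * pi)))%:~R * (2 * pi))) periodicz//.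
set u := t - _.
have := real_floor_itv (num_real (t / (2 * pi))).
rewrite ler_pdivlMr// ltr_pdivrMr// rmorphD /= => /andP[f1 f2].
have : 0 <= u < 2 * pi by rewrite /u subr_ge0 f1 /=; lra.
rewrite le_eqVlt => /andP[/orP[/eqP <-|u0] u2]; first exact: h0.
by apply: h1; rewrite u0 u2.
Qed.

Lemma consr_shiftS d (t a : R) (y : 'rV[R]_d) i :
  consr t (y + a *: delta_mx 0 i) = consr t y + a *: delta_mx 0 (lift ord0 i).
Proof.
apply/rowP => j; rewrite [RHS]mxE [X in _ = _ + X]mxE [X in _ = _ + _ * X]mxE.
case: (unliftP ord0 j) => [k ->|->]; rewrite ?consrS ?consr0.
  by rewrite !mxE (inj_eq (@lift_inj _ _)).
by rewrite mulr0 addr0.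
Qed.

Lemma consr_shift0 d (t a : R) (y : 'rV[R]_d) :
  consr (t + a) y = consr t y + a *: delta_mx 0 ord0.
Proof.
apply/rowP => j; rewrite [RHS]mxE [X in _ = _ + X]mxE [X in _ = _ + _ * X]mxE.
case: (unliftP ord0 j) => [k ->|->]; rewrite ?consrS ?consr0 /=.
  by rewrite mulr0 addr0.
by rewrite mulr1.
Qed.

Lemma torus_real_unique d (f : 'rV[R]_d -> R) :
  continuous f -> (forall x i, f (x + (2 * pi) *: delta_mx 0 i) = f x) ->
  (forall (k : 'rV[int]_d) a, torus_int (fun x => f x * cos (a + freq_dot k x)) = 0) ->
  forall x, f x = 0.
Proof.
elim: d f => [|d IH] f cf pf f0.
  move=> x; have := f0 0 0; rewrite /= /freq_dot big_ord0 addr0 cos0 mulr1.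
  by rewrite (_ : x = 0)//; apply/rowP => -[].
apply: consr_ind => t y.
have ccos k (a : R) : continuous (fun y : 'rV[R]_d => cos (a + freq_dot k y)).
  apply: cont_compose; first exact: continuous_cos.
  by apply: contD; [exact: cont_cst|exact: continuous_freq_dot].
apply: (IH (fun y => f (consr t y))) => [|{}y i|k a].
- exact: cont_slice.
- by rewrite consr_shiftS pf.
pose G t := torus_int (fun y => f (consr t y) * cos (a + freq_dot k y)).
rewrite -/(G t).
have cF : continuous (fun x : 'rV[R]_d.+1 => f x * cos (a + freq_dot (consr 0 k) x)).
  apply: contM => //; apply: cont_compose; first exact: continuous_cos.
  by apply: contD; [exact: cont_cst|exact: continuous_freq_dot].
apply: eq0_of_int_cos0.
- suff -> : G = fun t => torus_int (fun y =>
      f (consr t y) * cos (a + freq_dot (consr 0 k) (consr t y))).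
    exact: cont_torus_int_slice cF.
  apply/funext => {}t; congr torus_int; apply/funext => {}y.
  by rewrite freq_dot_consr mul0r add0r.
- by move=> {}t; congr torus_int; apply/funext => {}y; rewrite consr_shift0 pf.
move=> m b.
transitivity (2^-1 * torus_int (fun x => f x * cos ((a + b) + freq_dot (consr m k) x)) +
   2^-1 * torus_int (fun x => f x * cos ((b - a) + freq_dot (consr m (- k)) x))); last first.
  by rewrite !f0 !mulr0 addr0.
have cc q b' : continuous (fun x : 'rV[R]_d.+1 => f x * cos (b' + freq_dot q x)).
  apply: contM => //; apply: cont_compose; first exact: continuous_cos.
  by apply: contD; [exact: cont_cst|exact: continuous_freq_dot].
rewrite -!torus_intZ// -torus_intD; try exact: contZ.
rewrite torus_intS; congr itv_int; apply/funext => {}t.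
rewrite mulrC /G -torus_intZ; last first.
  by apply: contM; [exact: cont_slice|exact: ccos].
congr torus_int; apply/funext => {}y.
rewrite !freq_dot_consr.
have -> : freq_dot (- k) y = - freq_dot k y.
  by rewrite /freq_dot -sumrN; apply: eq_bigr => i _; rewrite !mxE rmorphN mulNr.
have -> : a + b + (m%:~R * t + freq_dot k y) = (b + m%:~R * t) + (a + freq_dot k y) by ring.
have -> : b - a + (m%:~R * t - freq_dot k y) = (b + m%:~R * t) - (a + freq_dot k y) by ring.
by move: (b + _) (a + _) => u v; rewrite cosB cosD; field.
Qed.

End Uniqueness.

(** * Fourier series *)

Section ComplexNorm.
Context {R : realType}.
Implicit Types z w : R[i].

Definition cnorm z : R := complex.Re `|z|.

Lemma cnormE z : `|z| = (cnorm z)%:C.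
Proof. by rewrite /cnorm normc_def. Qed.

Lemma cnorm_sqr z : cnorm z ^+ 2 = complex.Re z ^+ 2 + complex.Im z ^+ 2.
Proof. by rewrite /cnorm normc_def /= sqr_sqrtr// addr_ge0// sqr_ge0. Qed.

Lemma cnorm_ge0 z : 0 <= cnorm z.
Proof. by rewrite /cnorm normc_def /= sqrtr_ge0. Qed.

Lemma cnormM z w : cnorm (z * w) = cnorm z * cnorm w.
Proof. by apply: (@complexI R); rewrite rmorphM /= -!cnormE normrM. Qed.

Lemma cnorm_real (a : R) : cnorm a%:C = `|a|.
Proof. by rewrite /cnorm normc_def /= expr0n addr0 sqrtr_sqr. Qed.

Lemma cnorm0 : cnorm 0 = 0.
Proof. by rewrite /cnorm normr0. Qed.

Lemma cnorm1 : cnorm 1 = 1.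
Proof. by rewrite /cnorm normr1. Qed.

Lemma cnormN z : cnorm (- z) = cnorm z.
Proof. by rewrite /cnorm normrN. Qed.

Lemma cnormi : cnorm 'i = 1 :> R.
Proof. by rewrite /cnorm normc_def /= expr0n expr1n add0r sqrtr1. Qed.

Lemma cnorm_eq0 z : cnorm z = 0 -> z = 0.
Proof. by move=> z0; apply/eqP; rewrite -normr_eq0 cnormE z0. Qed.

Lemma le_cnormD z w : cnorm (z + w) <= cnorm z + cnorm w.
Proof. by rewrite -lecR rmorphD /= -!cnormE ler_normD. Qed.

Lemma le_cnormB z w : cnorm (z - w) <= cnorm z + cnorm w.
Proof. by rewrite -[cnorm w]cnormN le_cnormD. Qed.

Lemma cnorm_dist z w : cnorm (z - w) = cnorm (w - z).
Proof. by rewrite -cnormN opprB. Qed.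

Lemma le_dist_cnorm z w : `|cnorm z - cnorm w| <= cnorm (z - w).
Proof.
have h x y : cnorm x <= cnorm (x - y) + cnorm y.
  by apply: le_trans (le_cnormD _ _); rewrite subrK.
rewrite ler_norml lerBlDr h andbT lerBrDr addrC -lerBrDr opprK addrC cnorm_dist.
exact: h.
Qed.

Lemma cnormV z : cnorm z^-1 = (cnorm z)^-1.
Proof.
apply: (@complexI R); rewrite -cnormE normfV cnormE.
by rewrite fmorphV.
Qed.

Lemma cnormX z n : cnorm (z ^+ n) = cnorm z ^+ n.
Proof. by elim: n => [|n IH]; rewrite ?expr0 ?cnorm1// !exprS cnormM IH. Qed.

Lemma cnormJ z : cnorm z^* = cnorm z.
Proof. by rewrite /cnorm normcJ. Qed.

Lemma cnorm_Re z : `|complex.Re z| <= cnorm z.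
Proof.
rewrite -(ler_pXn2r (_ : 0 < 2)%N) ?nnegrE ?cnorm_ge0// cnorm_sqr real_normK ?num_real//.
by rewrite lerDl sqr_ge0.
Qed.

Lemma cnorm_Im z : `|complex.Im z| <= cnorm z.
Proof.
rewrite -(ler_pXn2r (_ : 0 < 2)%N) ?nnegrE ?cnorm_ge0// cnorm_sqr real_normK ?num_real//.
by rewrite lerDr sqr_ge0.
Qed.

Lemma cnorm_le z : cnorm z <= `|complex.Re z| + `|complex.Im z|.
Proof.
rewrite -(ler_pXn2r (_ : 0 < 2)%N) ?nnegrE ?cnorm_ge0 ?addr_ge0// cnorm_sqr.
by rewrite sqrrD !real_normK ?num_real// -addrA lerD2l lerDr mulrn_wge0// mulr_ge0.
Qed.

Lemma cnorm_sum (I : Type) (s : seq I) (F : I -> R[i]) :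
  cnorm (\sum_(i <- s) F i) <= \sum_(i <- s) cnorm (F i).
Proof.
elim/big_ind2: _ => //; first by rewrite cnorm0.
by move=> x1 x2 y1 y2 h1 h2; apply: le_trans (le_cnormD _ _) _; exact: lerD.
Qed.

Lemma Re_normX2 z : complex.Re (`|z| ^+ 2) = cnorm z ^+ 2.
Proof. by rewrite cnormE -rmorphXn. Qed.

Lemma cReD z w : complex.Re (z + w) = complex.Re z + complex.Re w.
Proof. by case: z; case: w. Qed.
Lemma cImD z w : complex.Im (z + w) = complex.Im z + complex.Im w.
Proof. by case: z; case: w. Qed.
Lemma cReM z w : complex.Re (z * w) =
  complex.Re z * complex.Re w - complex.Im z * complex.Im w.
Proof. by case: z; case: w. Qed.
Lemma cImM z w : complex.Im (z * w) =
  complex.Re z * complex.Im w + complex.Im z * complex.Re w.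
Proof. by case: z; case: w => a b c e /=; rewrite mulrC. Qed.

Lemma complex_eq z w : complex.Re z = complex.Re w -> complex.Im z = complex.Im w -> z = w.
Proof. by case: z; case: w => a b c e /= -> ->. Qed.

Lemma cexpI (a : R) : cexp ('i * a%:C) = cos a +i* sin a.
Proof.
have -> : 'i * a%:C = 0 +i* a by apply: complex_eq; rewrite ?cReM ?cImM /=; ring.
by rewrite /cexp /= expR0 mul1r.
Qed.

Lemma cnorm_cexpI (a : R) : cnorm (cexp ('i * a%:C)) = 1.
Proof. by rewrite cexpI /cnorm normc_def /= cos2Dsin2 sqrtr1. Qed.

Lemma cexpID (a b : R) : cexp ('i * (a + b)%:C) = cexp ('i * a%:C) * cexp ('i * b%:C).
Proof.
rewrite !cexpI cosD sinD; apply: complex_eq; rewrite ?cReM ?cImM //=.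
by rewrite addrC.
Qed.

Lemma conjC_real (a : R) : (a%:C)^* = a%:C.
Proof. exact: conjc_real. Qed.

Lemma conjcM z w : (z * w)^* = z^* * w^*.
Proof. exact: rmorphM. Qed.

End ComplexNorm.

Section FourierBasics.
Context {R : realType} {d : nat}.
Implicit Types (u v : 'rV[R]_d -> R[i]) (k l : 'rV[int]_d).

Definition ccont u := continuous (fun x => complex.Re (u x)) /\
  continuous (fun x => complex.Im (u x)).

Lemma ccontD u v : ccont u -> ccont v -> ccont (fun x => u x + v x).
Proof.
move=> [u1 u2] [v1 v2]; split.
  by under eq_fun do rewrite cReD; exact: contD.
by under eq_fun do rewrite cImD; exact: contD.
Qed.

Lemma ccontM u v : ccont u -> ccont v -> ccont (fun x => u x * v x).
Proof.
move=> [u1 u2] [v1 v2]; split.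
  by under eq_fun do rewrite cReM; apply: contD; [|apply: contN]; exact: contM.
by under eq_fun do rewrite cImM; apply: contD; exact: contM.
Qed.

Lemma ccont_cst a : ccont (fun _ => a).
Proof. by split; exact: cont_cst. Qed.

Lemma ccontJ u : ccont u -> ccont (fun x => (u x)^*).
Proof.
move=> [u1 u2]; split.
  by rewrite (_ : (fun _ => _) = fun x => complex.Re (u x))//; apply/funext => x; case: (u x).
rewrite (_ : (fun _ => _) = fun x => - complex.Im (u x)); first exact: contN.
by apply/funext => x; case: (u x).
Qed.

Definition ek k (x : 'rV[R]_d) : R[i] := cexp ('i * (freq_dot k x)%:C).

Lemma ccont_ek k : ccont (ek k).
Proof.
split; rewrite /ek; under eq_fun do rewrite cexpI.
  by apply: (cont_compose (@continuous_cos _)); exact: continuous_freq_dot.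
by apply: (cont_compose (@continuous_sin _)); exact: continuous_freq_dot.
Qed.

Lemma cnorm_ek k x : cnorm (ek k x) = 1.
Proof. exact: cnorm_cexpI. Qed.

Lemma freq_dotD k l x : freq_dot (k + l) x = freq_dot k x + freq_dot l x :> R.
Proof.
by rewrite /freq_dot -big_split; apply: eq_bigr => i _; rewrite mxE rmorphD mulrDl.
Qed.

Lemma freq_dotN k x : freq_dot (- k) x = - freq_dot k x :> R.
Proof.
by rewrite /freq_dot -sumrN; apply: eq_bigr => i _; rewrite mxE rmorphN mulNr.
Qed.

Lemma ekD k l x : ek (k + l) x = ek k x * ek l x.
Proof. by rewrite /ek freq_dotD cexpID. Qed.

Lemma ekJ k x : (ek k x)^* = ek (- k) x.
Proof. by rewrite /ek freq_dotN !cexpI cosN sinN. Qed.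

Lemma ekN k x : cexp (- ('i * (freq_dot k x)%:C)) = ek (- k) x.
Proof. by rewrite /ek freq_dotN -mulrN rmorphN. Qed.

Definition cint u : R[i] :=
  torus_int (fun x => complex.Re (u x)) +i* torus_int (fun x => complex.Im (u x)).

Lemma cintD u v : ccont u -> ccont v -> cint (fun x => u x + v x) = cint u + cint v.
Proof.
move=> [u1 u2] [v1 v2]; rewrite /cint.
under eq_fun do rewrite cReD.
under [X in _ +i* torus_int X]eq_fun do rewrite cImD.
by rewrite !torus_intD.
Qed.

Lemma cintZ a u : ccont u -> cint (fun x => a * u x) = a * cint u.
Proof.
move=> [u1 u2]; rewrite /cint.
under eq_fun do rewrite cReM -mulNr.
under [X in _ +i* torus_int X]eq_fun do rewrite cImM.
rewrite !torus_intD ?torus_intZ//; try exact: contZ.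
by apply: complex_eq; rewrite ?cReM ?cImM /= ?mulNr.
Qed.

Lemma cintJ u : ccont u -> cint (fun x => (u x)^*) = (cint u)^*.
Proof.
move=> [u1 u2]; rewrite /cint; congr (_ +i* _).
  by congr torus_int; apply/funext => x; case: (u x).
rewrite -mulN1r -torus_intZ//; congr torus_int; apply/funext => x.
by case: (u x) => a b /=; rewrite mulN1r.
Qed.

Lemma cnorm_cint u M : ccont u -> (forall x, cnorm (u x) <= M) ->
  cnorm (cint u) <= 2 * ((2 * pi) ^+ d * M).
Proof.
move=> [u1 u2] uM; apply: le_trans (cnorm_le _) _.
rewrite mulr_natl mulr2n; apply: lerD; apply: torus_int_bound => // x.
  exact: le_trans (cnorm_Re _) (uM x).
exact: le_trans (cnorm_Im _) (uM x).
Qed.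

Lemma cint_ek k : cint (ek k) = if k == 0 then ((2 * pi) ^+ d)%:C else 0.
Proof.
rewrite /cint /ek; under eq_fun do rewrite cexpI /= -[freq_dot _ _]add0r.
under [X in _ +i* torus_int X]eq_fun do rewrite cexpI /= -cosBpihalf addrC.
rewrite !torus_int_cos cos0 mulr1 cosN cos_pihalf mulr0.
by case: ifP.
Qed.

Lemma fourierE u k : fourier u k = ((2 * pi) ^- d)%:C * cint (fun x => u x * ek (- k) x).
Proof.
rewrite /fourier /cint.
under eq_fun do rewrite ekN.
by under [X in _ +i* torus_int X]eq_fun do rewrite ekN.
Qed.

Let ccu u k : ccont u -> ccont (fun x => u x * ek k x).
Proof. by move=> cu; apply: ccontM; [exact: cu|exact: ccont_ek]. Qed.

Lemma fourierD u v k : ccont u -> ccont v ->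
  fourier (fun x => u x + v x) k = fourier u k + fourier v k.
Proof.
move=> cu cv; rewrite !fourierE -mulrDr -cintD; try exact: ccu.
by congr (_ * cint _); apply/funext => x; rewrite mulrDl.
Qed.

Lemma fourierZ a u k : ccont u -> fourier (fun x => a * u x) k = a * fourier u k.
Proof.
move=> cu; rewrite !fourierE mulrCA -(cintZ a); last exact: ccu.
by congr (_ * cint _); apply/funext => x; rewrite mulrA.
Qed.

Lemma ccontZ a u : ccont u -> ccont (fun x => a * u x).
Proof. by move=> cu; apply: ccontM; [exact: ccont_cst|exact: cu]. Qed.

Lemma ccontN u : ccont u -> ccont (fun x => - u x).
Proof.
move=> cu; rewrite (_ : (fun _ => _) = fun x => -1 * u x); first exact: ccontZ.
by apply/funext => x; rewrite mulN1r.
Qed.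

Lemma ccontB u v : ccont u -> ccont v -> ccont (fun x => u x - v x).
Proof. by move=> cu cv; apply: ccontD cu _; exact: ccontN. Qed.

Lemma fourierN u k : ccont u -> fourier (fun x => - u x) k = - fourier u k.
Proof.
move=> cu; rewrite -mulN1r -fourierZ//; congr fourier.
by apply/funext => x; rewrite mulN1r.
Qed.

Lemma fourierB u v k : ccont u -> ccont v ->
  fourier (fun x => u x - v x) k = fourier u k - fourier v k.
Proof. by move=> cu cv; rewrite fourierD ?fourierN//; exact: ccontN. Qed.

Lemma fourierJ u k : ccont u -> fourier (fun x => (u x)^*) k = (fourier u (- k))^*.
Proof.
move=> cu; rewrite !fourierE conjcM conjC_real opprK -cintJ; last exact: ccu.
congr (_ * cint _); apply/funext => x.
by rewrite conjcM ekJ.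
Qed.

Lemma fourier_mul_ek u k l : fourier (fun x => u x * ek l x) k = fourier u (k - l).
Proof.
rewrite !fourierE; congr (_ * cint _); apply/funext => x.
by rewrite opprB ekD mulrA.
Qed.

Lemma fourier_ek k l : fourier (ek l) k = (k == l)%:R.
Proof.
rewrite fourierE; under eq_fun do rewrite -ekD.
rewrite cint_ek subr_eq0 (eq_sym k).
case: eqVneq => // _; rewrite ?mulr0// -rmorphM/= mulVf//.
by rewrite expf_eq0 mulf_eq0 pnatr_eq0 /= gt_eqF ?pi_gt0// andbF.
Qed.

Lemma cnorm_fourier u k M : ccont u -> (forall x, cnorm (u x) <= M) ->
  cnorm (fourier u k) <= 2 * M.
Proof.
move=> cu uM; rewrite fourierE cnormM cnorm_real.
have p0 : 0 < (2 * pi) ^+ d :> R by rewrite exprn_gt0// mulr_gt0 ?pi_gt0.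
rewrite gtr0_norm ?invr_gt0// ler_pdivrMl// mulrCA.
apply: cnorm_cint; first exact: ccu.
by move=> x; rewrite cnormM cnorm_ek mulr1.
Qed.

Lemma fourier_sum (I : Type) (s : seq I) (F : I -> 'rV[R]_d -> R[i]) k :
  (forall i, ccont (F i)) ->
  ccont (fun x => \sum_(i <- s) F i x) /\
  fourier (fun x => \sum_(i <- s) F i x) k = \sum_(i <- s) fourier (F i) k.
Proof.
move=> cF; elim: s => [|i s [c IH]].
  under eq_fun do rewrite big_nil; rewrite big_nil; split; first exact: ccont_cst.
  by rewrite -[RHS](mul0r (fourier (fun=> 0) k)) -fourierZ ?mul0r//; exact: ccont_cst.
under eq_fun do rewrite big_cons.
split; first exact: ccontD.
by rewrite fourierD// IH big_cons.
Qed.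

Lemma tc_ccont u : torus_continuous u -> ccont u.
Proof. by case. Qed.

Lemma tcD u v : torus_continuous u -> torus_continuous v ->
  torus_continuous (fun x => u x + v x).
Proof.
move=> [u1 u2 u3] [v1 v2 v3]; have [] := ccontD (conj u1 u2) (conj v1 v2).
by split => // x i; rewrite u3 v3.
Qed.

Lemma tcM u v : torus_continuous u -> torus_continuous v ->
  torus_continuous (fun x => u x * v x).
Proof.
move=> [u1 u2 u3] [v1 v2 v3]; have [] := ccontM (conj u1 u2) (conj v1 v2).
by split => // x i; rewrite u3 v3.
Qed.

Lemma tc_cst a : torus_continuous (fun _ : 'rV[R]_d => a).
Proof. by have [] := ccont_cst a; split. Qed.

Lemma tcJ u : torus_continuous u -> torus_continuous (fun x => (u x)^*).
Proof.
move=> [u1 u2 u3]; have [] := ccontJ (conj u1 u2).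
by split => // x i; rewrite u3.
Qed.

Lemma tcZ a u : torus_continuous u -> torus_continuous (fun x => a * u x).
Proof. by move=> cu; apply: tcM; [exact: tc_cst|exact: cu]. Qed.

Lemma tcN u : torus_continuous u -> torus_continuous (fun x => - u x).
Proof.
move=> cu; rewrite (_ : (fun _ => _) = fun x => -1 * u x); first exact: tcZ.
by apply/funext => x; rewrite mulN1r.
Qed.

Lemma tcB u v : torus_continuous u -> torus_continuous v ->
  torus_continuous (fun x => u x - v x).
Proof. by move=> cu cv; apply: tcD cu _; exact: tcN. Qed.

Lemma tc_ek k : torus_continuous (ek k).
Proof.
have [c1 c2] := ccont_ek k; split => // x i.
rewrite /ek !cexpI.
have -> : freq_dot k (x + (2 * pi) *: delta_mx 0 i) = freq_dot k x + (k 0 i)%:~R * (2 * pi).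
  rewrite /freq_dot (bigD1 i)//= [in RHS](bigD1 i)//= !mxE !eqxx /= mulr1 mulrDr addrAC.
  congr (_ + _ + _); apply: eq_bigr => j ji.
  by rewrite !mxE (negbTE ji) andbF mulr0 addr0.
by rewrite sinD2piz periodicz// => y; rewrite mulr_natl cosD2pi.
Qed.

Lemma tc_sum (I : Type) (s : seq I) (F : I -> 'rV[R]_d -> R[i]) :
  (forall i, torus_continuous (F i)) -> torus_continuous (fun x => \sum_(i <- s) F i x).
Proof.
move=> cF; elim: s => [|i s IH].
  under eq_fun do rewrite big_nil; exact: tc_cst.
under eq_fun do rewrite big_cons; exact: tcD.
Qed.

Lemma fourier_unique u : torus_continuous u -> (forall k, fourier u k = 0) ->
  forall x, u x = 0.
Proof.
move=> [c1 c2 pu] u0.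
have cu : ccont u by split.
have int0 k : cint (fun x => u x * ek k x) = 0.
  have := u0 (- k); rewrite fourierE opprK => /eqP; rewrite mulf_eq0 => /orP[|/eqP//].
  rewrite eq_complex /= eqxx andbT invr_eq0 expf_eq0 mulf_eq0 pnatr_eq0 /= gt_eqF ?pi_gt0//.
  by rewrite andbF.
have E k (a : R) x : cexp ('i * a%:C) * (u x * ek k x) =
   u x * (cos (a + freq_dot k x) +i* sin (a + freq_dot k x)).
  by rewrite mulrCA /ek -cexpID cexpI.
have int1 k (a : R) : cint (fun x => u x * (cos (a + freq_dot k x))%:C) = 0.
  have -> : (fun x => u x * (cos (a + freq_dot k x))%:C) =
     fun x => 2^-1 * (cexp ('i * a%:C) * (u x * ek k x)) +
              2^-1 * (cexp ('i * (- a)%:C) * (u x * ek (- k) x)).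
    apply/funext => x; rewrite !E freq_dotN -opprD cosN sinN.
    move: (u x) (cos _) (sin _) => z b e.
    have -> : b%:C = 2^-1 * ((b +i* e) + (b -i* e)) :> R[i].
      apply: (@mulfI R[i] 2); rewrite ?pnatr_eq0// mulVKf ?pnatr_eq0//.
      by apply: complex_eq; rewrite /= ?cReM ?cImM ?cReD ?cImD /=; ring.
    ring.
  by rewrite cintD ?cintZ ?int0 ?mulr0 ?addr0//; repeat apply: ccontZ; exact: ccu.
have h1 x : complex.Re (u x) = 0.
  apply: (@torus_real_unique _ _ (fun x => complex.Re (u x))) => // [y i|k a].
    by rewrite pu.
  have := int1 k a => /(congr1 (@complex.Re R)) /= <-.
  by congr torus_int; apply/funext => y; rewrite cReM /= mulr0 subr0.
have h2 x : complex.Im (u x) = 0.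
  apply: (@torus_real_unique _ _ (fun x => complex.Im (u x))) => // [y i|k a].
    by rewrite pu.
  have := int1 k a => /(congr1 (@complex.Im R)) /= <-.
  by congr torus_int; apply/funext => y; rewrite cImM /= mulr0 add0r.
by move=> x; apply: complex_eq; rewrite ?h1 ?h2.
Qed.

Lemma fourier_inj u v : torus_continuous u -> torus_continuous v ->
  (forall k, fourier u k = fourier v k) -> u = v.
Proof.
move=> cu cv uv; apply/funext => x; apply/eqP; rewrite -subr_eq0; apply/eqP.
apply: (fourier_unique (tcB cu cv)) => k.
by rewrite fourierB ?uv ?subrr//; exact: tc_ccont.
Qed.

End FourierBasics.

Lemma big_subset (V : zmodType) (I : eqType) (s t : seq I) (F : I -> V) :
  uniq s -> uniq t -> {subset s <= t} ->
  \sum_(k <- t) F k = \sum_(k <- s) F k + \sum_(k <- [seq x <- t | x \notin s]) F k.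
Proof.
move=> us ut st; rewrite (bigID (mem s)) /= big_filter; congr (_ + _).
rewrite -big_filter; apply: perm_big; apply: uniq_perm => //; first exact: filter_uniq.
by move=> x; rewrite mem_filter /=; case: (boolP (x \in s)) => // /st ->.
Qed.

Section Cubes.
Context {d : nat}.
Implicit Types (k : 'rV[int]_d) (s : seq 'rV[int]_d).

Definition cube_pt N (j : 'rV['I_(N.*2).+1]_d) : 'rV[int]_d :=
  map_mx (fun m : 'I_(N.*2).+1 => m%:Z - N%:Z) j.

Definition cube N : seq 'rV[int]_d := [seq cube_pt j | j <- index_enum 'rV['I_(N.*2).+1]_d].

Lemma cube_uniq N : uniq (cube N).
Proof.
rewrite map_inj_uniq ?index_enum_uniq// => i j /rowP e; apply/rowP => l.
by have := e l; rewrite !mxE => /addIr [] /val_inj.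
Qed.

Lemma mem_cube N k : (k \in cube N) = [forall i, (`|k 0%R i| <= N)%N].
Proof.
apply/mapP/forallP => [[j _ ->] i|h].
  rewrite mxE; have := ltn_ord (j 0 i); set m := nat_of_ord _ => mN.
  by lia.
exists (\row_i inord (`|(k 0 i + N%:Z)%R|)%N); first exact: mem_index_enum.
apply/rowP => i; rewrite !mxE inordK; have := h i; move: (k 0 i) => z; lia.
Qed.

Lemma cubeS N M : (N <= M)%N -> {subset cube N <= cube M}.
Proof.
move=> NM k; rewrite !mem_cube => /forallP h; apply/forallP => i.
exact: leq_trans (h i) NM.
Qed.

Lemma sub_cube s : exists N, {subset s <= cube N}.
Proof.
elim: s => [|k s [N sN]]; first by exists 0.
exists (maxn N (\max_i `|k 0%R i|)%N) => x; rewrite inE => /orP[/eqP->|/sN].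
  rewrite mem_cube; apply/forallP => i; rewrite leq_max; apply/orP; right.
  exact: (@bigop.leq_bigmax _ (fun j => `|k 0%R j|%N) i).
by apply: cubeS; rewrite leq_maxl.
Qed.

End Cubes.

Section Summable.
Context {R : realType} {d : nat}.
Implicit Types (k : 'rV[int]_d) (s : seq 'rV[int]_d) (f : 'rV[int]_d -> R)
  (a : 'rV[int]_d -> R[i]).

Definition sum_le f B := forall s, uniq s -> \sum_(k <- s) f k <= B.

Lemma sum_le_tail f B : (forall k, 0 <= f k) -> sum_le f B -> forall e, 0 < e ->
  exists N, forall s, uniq s -> (forall k, k \in s -> k \notin cube N) ->
    \sum_(k <- s) f k <= e.
Proof.
move=> f0 fB e e0.
set A := [set x | exists2 s, uniq s & x = \sum_(k <- s) f k].
have A0 : A !=set0 by exists 0, [::] => //; rewrite big_nil.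
have AB : has_ubound A by exists B => x [s us ->]; exact: fB.
have [x [s us ->] hs] := sup_adherent e0 (conj A0 AB).
have [N sN] := sub_cube s; exists N => t ut tN.
have h1 : \sum_(k <- s) f k <= \sum_(k <- cube N) f k.
  rewrite (big_subset f us (cube_uniq N) sN) lerDl; apply: sumr_ge0 => k _; exact: f0.
have h2 : \sum_(k <- cube N ++ t) f k <= sup A.
  apply: ub_le_sup => //; exists (cube N ++ t) => //.
  rewrite cat_uniq cube_uniq ut andbT /=; apply/hasPn => k; exact: tN.
rewrite big_cat /= in h2; lra.
Qed.

Definition fseries a (x : 'rV[R]_d) : R[i] :=
  limn (fun N => complex.Re (fourier_psum a N x)) +i*
  limn (fun N => complex.Im (fourier_psum a N x)).

Lemma fourier_psumE a N x : fourier_psum a N x = \sum_(k <- cube N) a k * ek k x.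
Proof. by rewrite /cube big_map. Qed.

Definition unif_cvg (u_ : nat -> 'rV[R]_d -> R[i]) u := forall e, 0 < e ->
  exists N, forall M, (N <= M)%N -> forall x, cnorm (u_ M x - u x) <= e.

Lemma cauchy_limn (x : nat -> R) :
  (forall e, 0 < e -> exists N, forall M M', (N <= M)%N -> (N <= M')%N -> `|x M - x M'| <= e) ->
  cvgn x.
Proof.
move=> h; apply: cauchy_cvg; apply: cauchy_exP => e e0.
have [N hN] := h (e / 2) (divr_gt0 e0 (ltr0n _ 2)).
exists (x N); exists N => // M /= NM; rewrite /ball /=.
by apply: le_lt_trans (hN _ _ (leqnn N) NM) _; rewrite ltr_pdivrMr// ltr_pMr// ltr1n.
Qed.

Lemma limn_dist (x : nat -> R) y e N : cvgn x ->
  (forall M, (N <= M)%N -> `|y - x M| <= e) -> `|y - limn x| <= e.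
Proof.
move=> cx h.
have : (fun n => `|y - x n|) @ \oo --> `|y - limn x|.
  by apply: cvg_norm; apply: cvgB => //; exact: cvg_cst.
move=> c; rewrite -(cvg_lim _ c)//; apply: limr_le; first by apply/cvg_ex; eexists; exact: c.
by exists N.
Qed.

Lemma fseries_unif a B : sum_le (fun k => cnorm (a k)) B ->
  unif_cvg (fourier_psum a) (fseries a).
Proof.
move=> aB e e0.
have tail e' : 0 < e' -> exists N, forall M M' x, (N <= M)%N -> (N <= M')%N ->
    cnorm (fourier_psum a M x - fourier_psum a M' x) <= e'.
  move=> e'0; have e20 : 0 < e' / 2 by rewrite divr_gt0.
  have [N hN] := sum_le_tail (fun k => cnorm_ge0 (a k)) aB e20; exists N.
  have h M x : (N <= M)%N ->
      cnorm (fourier_psum a M x - fourier_psum a N x) <= e' / 2.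
    move=> NM; rewrite !fourier_psumE.
    rewrite (big_subset _ (cube_uniq N) (cube_uniq M) (cubeS NM)) addrAC subrr add0r.
    apply: le_trans (cnorm_sum _ _) _.
    under eq_bigr do rewrite cnormM cnorm_ek mulr1.
    apply: hN; first by rewrite filter_uniq// cube_uniq.
    by move=> k; rewrite mem_filter => /andP[].
  move=> M M' x NM NM'; rewrite (splitr e').
  rewrite -[X in cnorm X](subrKA (fourier_psum a N x)).
  by apply: le_trans (le_cnormD _ _) _; rewrite lerD ?h// cnorm_dist h.
have cR x : cvgn (fun N => complex.Re (fourier_psum a N x)).
  apply: cauchy_limn => e' /tail[N hN]; exists N => M M' NM NM'.
  by apply: le_trans (hN M M' x NM NM'); apply: le_trans (cnorm_Re _); rewrite cReD; case: (fourier_psum a M' x).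
have cI x : cvgn (fun N => complex.Im (fourier_psum a N x)).
  apply: cauchy_limn => e' /tail[N hN]; exists N => M M' NM NM'.
  by apply: le_trans (hN M M' x NM NM'); apply: le_trans (cnorm_Im _); rewrite cImD; case: (fourier_psum a M' x).
have e20 : 0 < e / 2 by rewrite divr_gt0.
have [N hN] := tail _ e20; exists N => M NM x.
apply: le_trans (cnorm_le _) _; rewrite (splitr e); apply: lerD.
  rewrite (_ : complex.Re _ = complex.Re (fourier_psum a M x) - limn (fun N => complex.Re (fourier_psum a N x))).
    apply: (@limn_dist _ _ _ N) => // M' NM'; apply: le_trans (hN M M' x NM NM').
    by apply: le_trans (cnorm_Re _); rewrite cReD; case: (fourier_psum a M' x).
  by rewrite cReD.
rewrite (_ : complex.Im _ = complex.Im (fourier_psum a M x) - limn (fun N => complex.Im (fourier_psum a N x))).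
  apply: (@limn_dist _ _ _ N) => // M' NM'; apply: le_trans (hN M M' x NM NM').
  by apply: le_trans (cnorm_Im _); rewrite cImD; case: (fourier_psum a M' x).
by rewrite cImD.
Qed.

Lemma unif_cvg_cont (f_ : nat -> 'rV[R]_d -> R) (f : 'rV[R]_d -> R) :
  (forall N, continuous (f_ N)) ->
  (forall e, 0 < e -> exists N, forall x, `|f_ N x - f x| <= e) -> continuous f.
Proof.
move=> cf h x; apply/(@cvgrPdist_le _ _ _ (nbhs x)) => e e0.
have e30 : 0 < e / 3 by rewrite divr_gt0.
have [N hN] := h _ e30.
have /(@cvgrPdist_le _ _ _ (nbhs x)) /(_ _ e30) := cf N x; apply: filterS => y hy.
have -> : f x - f y = (f x - f_ N x) + (f_ N x - f_ N y) + (f_ N y - f y) by ring.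
have -> : e = e / 3 + e / 3 + e / 3 by field.
apply: le_trans (ler_normD _ _) _; apply: lerD => //.
apply: le_trans (ler_normD _ _) _; apply: lerD => //.
by rewrite distrC.
Qed.

Lemma unif_cvg_ccont u_ u : unif_cvg u_ u -> (forall N, ccont (u_ N)) -> ccont u.
Proof.
move=> h cu; split.
  apply: (@unif_cvg_cont (fun N x => complex.Re (u_ N x))) => [N|e /h[N hN]].
    exact: (cu N).1.
  exists N => x; apply: le_trans (hN N (leqnn _) x); apply: le_trans (cnorm_Re _).
  by rewrite cReD; case: (u x).
apply: (@unif_cvg_cont (fun N x => complex.Im (u_ N x))) => [N|e /h[N hN]].
  exact: (cu N).2.
exists N => x; apply: le_trans (hN N (leqnn _) x); apply: le_trans (cnorm_Im _).
by rewrite cImD; case: (u x).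
Qed.

Lemma cnorm_small z : (forall e : R, 0 < e -> cnorm z <= e) -> z = 0.
Proof.
move=> h; apply: cnorm_eq0; apply/eqP; rewrite eq_le cnorm_ge0 andbT.
by apply/ler_addgt0Pl => e /h; rewrite addr0.
Qed.

Lemma unif_cvg_tc u_ u : unif_cvg u_ u -> (forall N, torus_continuous (u_ N)) ->
  torus_continuous u.
Proof.
move=> h cu.
have [c1 c2] := unif_cvg_ccont h (fun N => tc_ccont (cu N)).
split => // x i; apply/eqP; rewrite -subr_eq0; apply/eqP; apply: cnorm_small => e e0.
have e20 : 0 < e / 2 by rewrite divr_gt0.
have [N hN] := h _ e20; have [_ _ p] := cu N.
rewrite (splitr e) -[X in cnorm X](subrKA (u_ N x)).
apply: le_trans (le_cnormD _ _) _; apply: lerD; last exact: hN.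
by rewrite -(p x i) cnorm_dist; exact: hN.
Qed.

Lemma unif_cvg_fourier u_ u : unif_cvg u_ u -> (forall N, ccont (u_ N)) ->
  forall e, 0 < e -> exists N, forall M, (N <= M)%N ->
    forall k, cnorm (fourier (u_ M) k - fourier u k) <= e.
Proof.
move=> h cu e e0; have cu' := unif_cvg_ccont h cu.
have e20 : 0 < e / 2 by rewrite divr_gt0.
have [N hN] := h _ e20; exists N => M NM k.
rewrite -fourierB// (le_trans (cnorm_fourier _ _ (hN M NM)))//.
  exact: ccontB.
by rewrite mulrC divfK.
Qed.

Lemma tc_fourier_psum a N : torus_continuous (fourier_psum a N).
Proof.
rewrite (_ : fourier_psum a N = fun x => \sum_(k <- cube N) a k * ek k x).
  by apply: tc_sum => k; apply: tcZ; exact: tc_ek.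
by apply/funext => x; rewrite fourier_psumE.
Qed.

Lemma fourier_fourier_psum a N k :
  fourier (fourier_psum a N) k = if k \in cube N then a k else 0.
Proof.
rewrite (_ : fourier_psum a N = fun x => \sum_(k <- cube N) a k * ek k x); last first.
  by apply/funext => x; rewrite fourier_psumE.
have c l : ccont (fun x => a l * ek l x) by apply: ccontZ; exact: ccont_ek.
rewrite (fourier_sum _ _ c).2.
rewrite (eq_bigr (fun l => a l * (k == l)%:R)); last first.
  by move=> l _; rewrite fourierZ ?fourier_ek//; exact: ccont_ek.
case: ifPn => kN.
  rewrite (bigD1_seq k) ?cube_uniq//= eqxx mulr1 big1 ?addr0// => l lk.
  by rewrite eq_sym (negbTE lk) mulr0.
rewrite big_seq big1// => l lN; case: eqVneq => [kl|_]; rewrite ?mulr0//.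
by rewrite kl lN in kN.
Qed.

Lemma tc_fseries a B : sum_le (fun k => cnorm (a k)) B -> torus_continuous (fseries a).
Proof. by move=> /fseries_unif h; apply: unif_cvg_tc h _ => N; exact: tc_fourier_psum. Qed.

Lemma fourier_fseries a B k : sum_le (fun k => cnorm (a k)) B ->
  fourier (fseries a) k = a k.
Proof.
move=> /fseries_unif h; apply/esym/eqP; rewrite -subr_eq0; apply/eqP.
apply: cnorm_small => e e0.
have [N hN] := unif_cvg_fourier h (fun N => tc_ccont (tc_fourier_psum a N)) e0.
have [M kM] := sub_cube [:: k].
have := hN (maxn N M) (leq_maxl _ _) k; rewrite fourier_fourier_psum.
by rewrite (cubeS (leq_maxr N M) (kM k (mem_head _ _))).
Qed.

Lemma fseries_fourier u B : torus_continuous u ->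
  sum_le (fun k => cnorm (fourier u k)) B -> fseries (fourier u) = u.
Proof.
move=> cu uB; apply: fourier_inj => //; first exact: tc_fseries uB.
by move=> k; rewrite (fourier_fseries _ uB).
Qed.

End Summable.

(** * Sobolev spaces *)

Section CauchySchwarz.
Context {R : realType} (I : Type).

Lemma cauchy_schwarz_sum (s : seq I) (x y : I -> R) :
  (\sum_(i <- s) x i * y i) ^+ 2 <= (\sum_(i <- s) x i ^+ 2) * (\sum_(i <- s) y i ^+ 2).
Proof.
elim: s => [|i s IH]; first by rewrite !big_nil expr0n mul0r.
rewrite !big_cons.
have X0 : 0 <= \sum_(j <- s) x j ^+ 2 by apply: sumr_ge0 => j _; exact: sqr_ge0.
have Y0 : 0 <= \sum_(j <- s) y j ^+ 2 by apply: sumr_ge0 => j _; exact: sqr_ge0.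
move: X0 Y0 IH; set A := \sum_(j <- s) x j * y j; set X := \sum_(j <- s) _; set Y := \sum_(j <- s) _.
move: (x i) (y i) => a b X0 Y0 IH.
suff : 2 * A * (a * b) <= X * b ^+ 2 + Y * a ^+ 2 by nra.
have h0 : 0 <= X * b ^+ 2 + Y * a ^+ 2 by rewrite addr_ge0// mulr_ge0// sqr_ge0.
apply: le_trans (ler_norm _) _.
rewrite -(ler_pXn2r (_ : 0 < 2)%N) ?nnegrE// real_normK ?num_real//.
have : 0 <= (X * b ^+ 2 - Y * a ^+ 2) ^+ 2 by exact: sqr_ge0.
have : A ^+ 2 * (a * b) ^+ 2 <= X * Y * (a * b) ^+ 2 by rewrite ler_wpM2r// sqr_ge0.
nra.
Qed.

Lemma cauchy_schwarz_weight (s : seq I) (p q y : I -> R) :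
  (forall i, 0 < p i) -> (forall i, q i = (p i)^-1) -> (forall i, 0 <= y i) ->
  (\sum_(i <- s) y i) ^+ 2 <= (\sum_(i <- s) q i) * (\sum_(i <- s) p i * y i ^+ 2).
Proof.
move=> p0 qE y0.
have := cauchy_schwarz_sum s (fun i => Num.sqrt (q i)) (fun i => Num.sqrt (p i) * y i).
have q0 i : 0 <= q i by rewrite qE invr_ge0 ltW.
under eq_bigr => i _.
  rewrite mulrA -sqrtrM// qE mulVf ?gt_eqF// sqrtr1 mul1r.
  over.
under [X in _ <= X * _ -> _]eq_bigr do rewrite sqr_sqrtr//.
by under [X in _ <= _ * X -> _]eq_bigr do rewrite exprMn sqr_sqrtr ?(ltW (p0 _))//.
Qed.

End CauchySchwarz.

Section Weights.
Context {R : realType} {d : nat}.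
Implicit Types (k l : 'rV[int]_d) (s : seq 'rV[int]_d) (sg : R).

Definition jb k : R := 1 + freq_sq k.

Lemma freq_sq_ge0 k : 0 <= freq_sq k :> R.
Proof. by apply: sumr_ge0 => i _; exact: sqr_ge0. Qed.

Lemma jb_ge1 k : 1 <= jb k.
Proof. by rewrite lerDl freq_sq_ge0. Qed.

Lemma jb_gt0 k : 0 < jb k.
Proof. exact: lt_le_trans (jb_ge1 k). Qed.

Definition weight sg k : R := jb k `^ sg.

Lemma weight_gt0 sg k : 0 < weight sg k.
Proof. by rewrite powR_gt0// jb_gt0. Qed.

Lemma weightN sg k : weight (- sg) k = (weight sg k)^-1.
Proof. by rewrite /weight powRN. Qed.

Lemma weightD sg (n : nat) k : weight (sg + n%:R) k = weight sg k * jb k ^+ n.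
Proof.
rewrite /weight powRD ?powR_mulrn ?(ltW (jb_gt0 _))//.
by apply/implyP => _; rewrite gt_eqF// jb_gt0.
Qed.

Lemma freq_sq_coord k i : ((k 0 i)%:~R) ^+ 2 <= freq_sq k :> R.
Proof.
by rewrite /freq_sq (bigD1 i)//= lerDl; apply: sumr_ge0 => j _; exact: sqr_ge0.
Qed.

Lemma size_cube N : size (@cube d N) = ((N.*2).+1 ^ d)%N.
Proof. rewrite /cube size_map -(card_uniqP (index_enum_uniq _)).
rewrite (@eq_card _ _ predT); first by rewrite card_mx card_ord mul1n.
by move=> x; rewrite mem_index_enum. Qed.

(* The dyadic shell [2^J < max_i |k_i| <= 2^(J+1)] has at most [(5 * 2^J)^d] points. *)
Lemma weight_summable sg : d%:R / 2 < sg -> exists2 Z, 0 < Z & sum_le (weight (- sg)) Z.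
Proof.
move=> hs; set q : R := 2 `^ (d%:R - 2 * sg).
have q0 : 0 < q by rewrite powR_gt0.
have q1 : q < 1.
  rewrite /q (_ : d%:R - 2 * sg = - (2 * sg - d%:R)); last by ring.
  rewrite powRN invf_lt1 ?powR_gt0//.
  have e0 : 0 < 2 * sg - d%:R by lra.
  have := @gt0_ltr_powR R _ e0 1 2; rewrite powR1 !nnegrE ler0n ler01 ltr1n.
  exact.
have sg0 : 0 < sg by apply: le_lt_trans hs; rewrite divr_ge0.
pose S J : R := \sum_(k <- cube (2 ^ J)) weight (- sg) k.
have stepS J : S J.+1 <= S J + 5 ^+ d * q ^+ J.
  have sub : {subset @cube d (2 ^ J) <= cube (2 ^ J.+1)}.
    by apply: cubeS; rewrite leq_exp2l.
  rewrite /S (big_subset _ (cube_uniq _) (cube_uniq _) sub) lerD2l.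
  set t := [seq x <- _ | _].
  apply: (@le_trans _ _ (\sum_(k <- t) (((2 : R) ^+ J.*2) `^ (- sg)))).
    rewrite big_seq [leRHS]big_seq; apply: ler_sum => k.
    rewrite mem_filter mem_cube negb_forall => /andP[/existsP[j]].
    rewrite -ltnNge => hi _; rewrite weightN powRN lef_pV2 ?posrE ?powR_gt0 ?jb_gt0 ?exprn_gt0//.
    apply: ge0_ler_powR => //; rewrite ?nnegrE ?exprn_ge0 ?(ltW (jb_gt0 _))//; first exact: ltW.
    apply: le_trans (_ : freq_sq k <= _); last by rewrite lerDr.
    apply: le_trans (freq_sq_coord k j).
    rewrite -[leRHS]real_normK ?num_real// -intr_norm -muln2 exprM ler_pXn2r ?nnegrE ?exprn_ge0//.
    by rewrite -natrX -abszE -[leRHS]/(_%:R) ler_nat ltnW.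
  rewrite big_const_seq count_predT iter_addr_0.
  have st : (size t <= (5 * 2 ^ J) ^ d)%N.
    apply: (@leq_trans (size (@cube d (2 ^ J.+1)))); first by rewrite size_filter count_size.
    rewrite size_cube; have [->//|d0] := posnP d; rewrite leq_exp2r//.
    rewrite -muln2 expnS; have := expn_gt0 2 J; lia.
  rewrite -[leLHS]mulr_natr.
  apply: (@le_trans _ _ ((2 ^+ J.*2) `^ (- sg) * ((5 * 2 ^ J) ^ d)%:R)).
    by rewrite ler_wpM2l ?powR_ge0// ler_nat.
  rewrite natrX natrM natrX exprMn mulrCA ler_wpM2l ?exprn_ge0//.
  rewrite /q -!powR_mulrn ?powR_ge0 ?exprn_ge0// -!powRrM -powRD; last first.
    by rewrite pnatr_eq0 implybT.
  apply: ler_powR; first by rewrite ler1n.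
  by rewrite -muln2 natrM; lra.
have SJ J : S J <= S 0 + 5 ^+ d / (1 - q).
  suff : S J <= S 0 + 5 ^+ d * ((1 - q ^+ J) / (1 - q)).
    move=> /le_trans; apply; rewrite lerD2l ler_wpM2l ?exprn_ge0//.
    by rewrite ler_pdivrMr ?subr_gt0// mulVf ?gt_eqF ?subr_gt0// lerBlDr lerDl exprn_ge0 ?ltW.
  elim: J => [|J IH]; first by rewrite expr0 subrr mul0r mulr0 addr0.
  apply: le_trans (stepS J) _; apply: le_trans (lerD IH (lexx _)) _.
  rewrite -addrA lerD2l -mulrDr ler_wpM2l ?exprn_ge0//.
  rewrite exprS le_eqVlt; apply/orP; left; apply/eqP; field.
  by rewrite gt_eqF// subr_gt0.
have S0 : 0 <= S 0 by apply: sumr_ge0 => k _; rewrite ltW// weight_gt0.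
have Z0 : 0 < S 0 + 5 ^+ d / (1 - q).
  by rewrite ltr_wpDl// divr_gt0 ?exprn_gt0// subr_gt0.
exists (S 0 + 5 ^+ d / (1 - q)) => // s us.
have [N sN] := sub_cube s.
have sN2 : {subset s <= cube (2 ^ N)}.
  by move=> k /sN; apply: cubeS; rewrite ltnW// ltn_expl.
apply: le_trans (SJ N); rewrite /S (big_subset _ us (cube_uniq _) sN2) lerDl.
by apply: sumr_ge0 => k _; rewrite ltW// weight_gt0.
Qed.

Lemma weight_quasi_triangle sg k l : 0 <= sg -> weight sg k <= 4 `^ sg * (weight sg (k - l) + weight sg l).
Proof.
move=> s0.
have sq : freq_sq k <= 2 * freq_sq (k - l) + 2 * freq_sq l :> R.
  rewrite /freq_sq !mulr_sumr -big_split /=; apply: ler_sum => i _.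
  rewrite !mxE rmorphD rmorphN /=; move: (k 0 i)%:~R (l 0 i)%:~R => a b.
  by have := sqr_ge0 (a - 2 * b); nra.
have h1 := jb_ge1 (k - l); have h2 := jb_ge1 l.
have jbm : jb k <= 4 * Num.max (jb (k - l)) (jb l).
  have m1 : jb (k - l) <= Num.max (jb (k - l)) (jb l) by rewrite le_max lexx.
  have m2 : jb l <= Num.max (jb (k - l)) (jb l) by rewrite le_max lexx orbT.
  by move: m1 m2 h1 h2; move: (Num.max _ _) => m; rewrite /jb; lra.
apply: (@le_trans _ _ ((4 * Num.max (jb (k - l)) (jb l)) `^ sg)).
  apply: ge0_ler_powR => //; rewrite nnegrE ?(ltW (jb_gt0 _))//.
  by rewrite mulr_ge0// le_max (ltW (jb_gt0 _)).
rewrite powRM// ?le_max ?(ltW (jb_gt0 _))// ler_wpM2l ?powR_ge0//.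
have w1 := ltW (weight_gt0 sg (k - l)); have w2 := ltW (weight_gt0 sg l).
by rewrite maxEle; case: ifP => _; rewrite -/(weight sg _) ?lerDl ?lerDr.
Qed.



Definition hsum sg (a : 'rV[int]_d -> R[i]) M :=
  0 <= M /\ sum_le (fun k => weight sg k * cnorm (a k) ^+ 2) (M ^+ 2).

Lemma hsum_term_ge0 sg (a : 'rV[int]_d -> R[i]) k : 0 <= weight sg k * cnorm (a k) ^+ 2.
Proof. by rewrite mulr_ge0 ?sqr_ge0// ltW// weight_gt0. Qed.

Lemma esum_sum_le (f : 'rV[int]_d -> R) B : (forall k, 0 <= f k) ->
  (\esum_(k in [set: 'rV[int]_d]) (f k)%:E <= B%:E)%E <-> sum_le f B.
Proof.
move=> f0; split=> [h s us|h].
  rewrite -lee_fin; apply: le_trans h; apply: ereal_sup_ubound.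
  exists [set` s]; first by split => //; exact: finite_seq.
  by rewrite -fsbig_seq// sumEFin.
apply: ge_ereal_sup => _ [A [fA _] <-].
by rewrite fsbig_finite//= sumEFin lee_fin; apply: h; exact: finmap.fset_uniq.
Qed.

Lemma sobolev_le sg u M : 0 <= M ->
  (sobolev sg u <= M%:E)%E <-> hsum sg (fourier u) M.
Proof.
move=> M0; rewrite /sobolev /hsum.
rewrite -(esum_sum_le _ (hsum_term_ge0 sg (fourier u))).
have -> : (fun k => ((1 + freq_sq k) `^ sg * complex.Re (`|fourier u k| ^+ 2))%:E) =
    (fun k => (weight sg k * cnorm (fourier u k) ^+ 2)%:E).
  by apply/funext => k; rewrite Re_normX2.
set x := esum _ _.
have x0 : (0 <= x)%E by apply: esum_ge0 => k _; rewrite lee_fin hsum_term_ge0.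
have xE : ((x `^ 2^-1) `^ 2 = x)%E.
  by rewrite -poweRrM mulVf ?pnatr_eq0// poweRe1.
have M2 : (M ^+ 2)%:E = (M%:E `^ 2)%E by rewrite poweR_EFin powR_mulrn.
split=> [h|[_]].
  split=> //; rewrite -xE M2; apply: gt0_ler_poweR => //.
    by rewrite in_itv; apply/andP; split; [exact: poweR_ge0|exact: leey].
  by rewrite in_itv /= lee_fin M0 leey.
rewrite M2 => h.
have -> : M%:E = ((M%:E `^ 2) `^ 2^-1)%E.
  by rewrite -poweRrM mulfV ?pnatr_eq0// poweRe1// lee_fin.
apply: gt0_ler_poweR => //; rewrite ?invr_ge0//.
  by rewrite in_itv /= x0 leey.
by rewrite in_itv; apply/andP; split; [exact: poweR_ge0|exact: leey].
Qed.

Lemma hsum_ext sg a b M : (forall k, a k = b k) -> hsum sg a M -> hsum sg b M.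
Proof. by move=> ab; rewrite (_ : a = b)//; apply/funext. Qed.

Lemma hsum_le sg a M M' : M <= M' -> hsum sg a M -> hsum sg a M'.
Proof.
move=> MM [M0 h]; have M'0 := le_trans M0 MM; split=> // s us.
by apply: le_trans (h s us) _; rewrite ler_pXn2r ?nnegrE.
Qed.

Lemma hsum_mult sg sg' (a m : 'rV[int]_d -> R[i]) B M : 0 <= B ->
  (forall k, weight sg' k * cnorm (m k) ^+ 2 <= B ^+ 2 * weight sg k) ->
  hsum sg a M -> hsum sg' (fun k => m k * a k) (B * M).
Proof.
move=> B0 h [M0 hM]; split; first exact: mulr_ge0.
move=> s us; rewrite exprMn.
apply: (@le_trans _ _ (B ^+ 2 * \sum_(k <- s) weight sg k * cnorm (a k) ^+ 2)).
  rewrite mulr_sumr; apply: ler_sum => k _.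
  by rewrite cnormM exprMn mulrA [leRHS]mulrA ler_wpM2r ?sqr_ge0 ?h.
by rewrite ler_wpM2l ?sqr_ge0// hM.
Qed.

Lemma hsumD sg (a b : 'rV[int]_d -> R[i]) M N : hsum sg a M -> hsum sg b N ->
  hsum sg (fun k => a k + b k) (M + N).
Proof.
move=> [M0 hM] [N0 hN]; split; first exact: addr_ge0.
move=> s us.
set X := fun k => Num.sqrt (weight sg k) * cnorm (a k).
set Y := fun k => Num.sqrt (weight sg k) * cnorm (b k).
have sX : \sum_(k <- s) X k ^+ 2 <= M ^+ 2.
  under eq_bigr do rewrite exprMn sqr_sqrtr ?(ltW (weight_gt0 _ _))//.
  exact: hM.
have sY : \sum_(k <- s) Y k ^+ 2 <= N ^+ 2.
  under eq_bigr do rewrite exprMn sqr_sqrtr ?(ltW (weight_gt0 _ _))//.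
  exact: hN.
have sXY : \sum_(k <- s) X k * Y k <= M * N.
  rewrite -ler_sqr ?nnegrE ?mulr_ge0//; last first.
    by apply: sumr_ge0 => k _; rewrite !mulr_ge0 ?sqrtr_ge0 ?cnorm_ge0.
  apply: le_trans (cauchy_schwarz_sum _ _ _) _; rewrite exprMn; apply: ler_pM => //;
  by apply: sumr_ge0 => k _; exact: sqr_ge0.
apply: (@le_trans _ _ (\sum_(k <- s) (X k + Y k) ^+ 2)).
  apply: ler_sum => k _; rewrite -mulrDr exprMn sqr_sqrtr ?(ltW (weight_gt0 _ _))//.
  rewrite ler_wpM2l ?(ltW (weight_gt0 _ _))// ler_sqr ?nnegrE ?addr_ge0 ?cnorm_ge0//.
  exact: le_cnormD.
rewrite (eq_bigr (fun k => X k ^+ 2 + 2 * (X k * Y k) + Y k ^+ 2)); last by move=> k _; ring.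
rewrite !big_split /= -mulr_sumr; move: sX sY sXY; nra.
Qed.

Lemma hsum_summable sg Z (a : 'rV[int]_d -> R[i]) M : 0 < Z -> sum_le (weight (- sg)) Z ->
  hsum sg a M -> sum_le (fun k => cnorm (a k)) (Num.sqrt Z * M).
Proof.
move=> Z0 hZ [M0 hM] s us.
rewrite -ler_sqr ?nnegrE ?mulr_ge0 ?sqrtr_ge0 ?sumr_ge0//; last by move=> k _; exact: cnorm_ge0.
rewrite exprMn sqr_sqrtr ?(ltW Z0)//.
apply: le_trans (cauchy_schwarz_weight s (weight_gt0 sg) (weightN sg) (fun k => cnorm_ge0 (a k))) _.
apply: ler_pM; [| |exact: hZ|exact: hM].
  by apply: sumr_ge0 => k _; rewrite ltW// weight_gt0.
by apply: sumr_ge0 => k _; exact: hsum_term_ge0.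
Qed.

Lemma hsum_unif_cvg sg (u_ : nat -> 'rV[R]_d -> R[i]) u M : unif_cvg u_ u ->
  (forall N, ccont (u_ N)) -> (forall N, hsum sg (fourier (u_ N)) M) ->
  hsum sg (fourier u) M.
Proof.
move=> uu cu hu; have [M0 _] := hu 0; split => // s us.
have c k : (fun N => cnorm (fourier (u_ N) k)) @ \oo --> cnorm (fourier u k).
  apply/cvgrPdist_le => e /(unif_cvg_fourier uu cu)[N hN].
  exists N => // n /= Nn; apply: le_trans (hN n Nn k).
  by rewrite cnorm_dist; exact: le_dist_cnorm.
have : (fun N => \sum_(k <- s) weight sg k * cnorm (fourier (u_ N) k) ^+ 2) @ \oo -->
   \sum_(k <- s) weight sg k * cnorm (fourier u k) ^+ 2.
  elim: s {us} => [|k s IH].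
    by under eq_fun do rewrite big_nil; rewrite big_nil; exact: cvg_cst.
  under eq_fun do rewrite big_cons; rewrite big_cons; apply: cvgD IH.
  apply: cvgMr; apply: (@cvg_comp _ _ _ _ (fun x => x ^+ 2) _ _ _ (c k)).
  exact: exprn_continuous.
move=> cs; rewrite -(cvg_lim _ cs)//; apply: limr_le; first by apply/cvg_ex; eexists; exact: cs.
by exists 0 => // n _; exact: (hu n).2.
Qed.

End Weights.

Section SobolevSpace.
Context {R : realType} {d : nat}.
Implicit Types (k l : 'rV[int]_d) (s : seq 'rV[int]_d) (sg : R)
  (u v : 'rV[R]_d -> R[i]).

Definition bnd sg u M := torus_continuous u /\ hsum sg (fourier u) M.

Lemma bnd_ge0 sg u M : bnd sg u M -> 0 <= M.
Proof. by move=> [_ []]. Qed.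

Lemma bnd_le sg u M M' : M <= M' -> bnd sg u M -> bnd sg u M'.
Proof. by move=> MM [cu hu]; split => //; exact: hsum_le hu. Qed.

Lemma bndD sg u v M N : bnd sg u M -> bnd sg v N -> bnd sg (fun x => u x + v x) (M + N).
Proof.
move=> [cu hu] [cv hv]; split; first exact: tcD.
by apply: hsum_ext (hsumD hu hv) => k; rewrite fourierD//; exact: tc_ccont.
Qed.

Lemma bndZ sg u M a : bnd sg u M -> bnd sg (fun x => a * u x) (cnorm a * M).
Proof.
move=> [cu hu]; split; first exact: tcZ.
apply: (@hsum_ext _ _ _ (fun k => a * fourier u k)) => [k|].
  by rewrite fourierZ//; exact: tc_ccont.
by apply: hsum_mult hu; [exact: cnorm_ge0|move=> k; rewrite mulrC].
Qed.

Lemma bndN sg u M : bnd sg u M -> bnd sg (fun x => - u x) M.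
Proof.
move=> h; have := bndZ (-1) h; rewrite cnormN cnorm1 mul1r.
by under eq_fun do rewrite mulN1r.
Qed.

Lemma bndB sg u v M N : bnd sg u M -> bnd sg v N -> bnd sg (fun x => u x - v x) (M + N).
Proof. by move=> hu hv; apply: bndD => //; exact: bndN. Qed.

Lemma freq_sqN k : freq_sq (- k) = freq_sq k :> R.
Proof. by apply: eq_bigr => i _; rewrite mxE rmorphN sqrrN. Qed.

Lemma bndJ sg u M : bnd sg u M -> bnd sg (fun x => (u x)^*) M.
Proof.
move=> [cu [M0 hu]]; split; first exact: tcJ.
split=> // s us.
rewrite (_ : \sum_(k <- s) _ = \sum_(k <- map -%R s) weight sg k * cnorm (fourier u k) ^+ 2).
  by apply: hu; rewrite map_inj_uniq//; exact: oppr_inj.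
rewrite big_map; apply: eq_bigr => k _; rewrite /weight /jb freq_sqN fourierJ ?cnormJ//.
exact: tc_ccont.
Qed.

Lemma bnd0 sg : bnd sg (fun=> 0) 0.
Proof.
split; first exact: tc_cst.
split => // s us; rewrite big1 ?expr0n// => k _.
rewrite (_ : fourier _ _ = 0) ?cnorm0 ?expr0n ?mulr0//.
rewrite -[RHS](mul0r (fourier (fun=> 0) k)) -fourierZ; last exact: ccont_cst.
by congr fourier; apply/funext => x; rewrite mul0r.
Qed.

Lemma bnd_sum sg (I : Type) (s : seq I) (F : I -> 'rV[R]_d -> R[i]) (B : I -> R) :
  (forall i, bnd sg (F i) (B i)) ->
  bnd sg (fun x => \sum_(i <- s) F i x) (\sum_(i <- s) B i).
Proof.
move=> h; elim: s => [|i s IH].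
  by under eq_fun do rewrite big_nil; rewrite big_nil; exact: bnd0.
by under eq_fun do rewrite big_cons; rewrite big_cons; exact: bndD.
Qed.

Lemma bnd_unif_cvg sg (u_ : nat -> 'rV[R]_d -> R[i]) u M : unif_cvg u_ u ->
  (forall N, bnd sg (u_ N) M) -> bnd sg u M.
Proof.
move=> uu h; split; first by apply: unif_cvg_tc uu _ => N; exact: (h N).1.
by apply: hsum_unif_cvg uu _ _ => N; [exact: tc_ccont (h N).1|exact: (h N).2].
Qed.

Lemma bnd_weaken sg sg' u M : sg' <= sg -> bnd sg u M -> bnd sg' u M.
Proof.
move=> ss [cu hu]; split => //.
apply: (@hsum_ext _ _ _ (fun k => 1 * fourier u k)) => [k|]; first by rewrite mul1r.
rewrite -[M]mul1r; apply: hsum_mult hu => // k.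
rewrite cnorm1 expr1n mulr1 mul1r; apply: ler_powR => //; exact: jb_ge1.
Qed.

Lemma bnd_sup sg : d%:R / 2 < sg -> exists2 C, 0 < C &
  forall u M, bnd sg u M -> forall x, cnorm (u x) <= C * M.
Proof.
move=> /weight_summable[Z Z0 hZ]; exists (Num.sqrt Z); first by rewrite sqrtr_gt0.
move=> u M [cu hu] x.
have sm := hsum_summable Z0 hZ hu.
have uE := fseries_fourier cu sm.
apply/ler_addgt0Pr => e e0.
have [N hN] := fseries_unif sm e0.
rewrite -uE -[fseries _ _](subrK (fourier_psum (fourier u) N x)) addrC.
apply: le_trans (le_cnormD _ _) _; apply: lerD; last by rewrite cnorm_dist; exact: hN.
rewrite fourier_psumE; apply: le_trans (cnorm_sum _ _) _.
under eq_bigr do rewrite cnormM cnorm_ek mulr1.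
exact: sm (cube_uniq N).
Qed.

(* [weight sg k <= K (weight sg (k - l) + weight sg l)] makes
   [sum_l weight sg k / (weight sg (k - l) * weight sg l)] bounded in [k], so Cauchy-Schwarz
   in the convolution sum gives the algebra property. *)
Lemma bndM_ex sg : d%:R / 2 < sg -> exists2 K, 1 <= K &
  forall u v M N, bnd sg u M -> bnd sg v N -> bnd sg (fun x => u x * v x) (K * (M * N)).
Proof.
move=> hs; have [Z Z0 hZ] := weight_summable hs; have [C C0 hC] := bnd_sup hs.
have sg0 : 0 < sg by apply: le_lt_trans hs; rewrite divr_ge0.
set D := 4 `^ sg * (Z + Z).
have D0 : 0 <= D by rewrite mulr_ge0 ?powR_ge0// addr_ge0// ltW.
exists (1 + D); first by rewrite lerDl.
move=> u v M N hu hv; have M0 := bnd_ge0 hu; have N0 := bnd_ge0 hv.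
have [cu [_ hu2]] := hu; have [cv [_ hv2]] := hv.
have smv := hsum_summable Z0 hZ hv.2.
pose v_ n := fourier_psum (fourier v) n.
have vE : fseries (fourier v) = v := fseries_fourier cv smv.
have uv_cvg : unif_cvg (fun n x => u x * v_ n x) (fun x => u x * v x).
  move=> e e0.
  have e'0 : 0 < e / (C * M + 1) by rewrite divr_gt0// ltr_wpDl// mulr_ge0// ltW.
  have [n hn] := fseries_unif smv e'0; exists n => m nm x.
  rewrite -mulrBr cnormM.
  apply: (@le_trans _ _ ((C * M + 1) * (e / (C * M + 1)))); last first.
    by rewrite mulrC divfK// gt_eqF// ltr_wpDl// mulr_ge0// ltW.
  apply: ler_pM; rewrite ?cnorm_ge0//.
    by apply: le_trans (hC _ _ hu x) _; rewrite lerDl.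
  by have := hn m nm x; rewrite vE.
apply: (bnd_unif_cvg uv_cvg) => n.
split; first by apply: tcM => //; exact: tc_fourier_psum.
split; first by rewrite mulr_ge0 ?mulr_ge0// addr_ge0.
move=> s us.
have fE k : fourier (fun x => u x * v_ n x) k = \sum_(l <- cube n) fourier v l * fourier u (k - l).
  rewrite (_ : (fun _ => _) = fun x => \sum_(l <- cube n) fourier v l * (u x * ek l x)).
    have cc l : ccont (fun x => fourier v l * (u x * ek l x)).
      by apply: ccontZ; apply: ccontM; [exact: tc_ccont|exact: ccont_ek].
    rewrite (fourier_sum _ _ cc).2; apply: eq_bigr => l _.
    rewrite fourierZ ?fourier_mul_ek//.
    by apply: ccontM; [exact: tc_ccont|exact: ccont_ek].
  apply/funext => x; rewrite /v_ fourier_psumE mulr_sumr; apply: eq_bigr => l _.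
  by rewrite mulrCA.
pose G k l := (weight sg l * cnorm (fourier v l) ^+ 2) * (weight sg (k - l) * cnorm (fourier u (k - l)) ^+ 2).
have main k : weight sg k * cnorm (fourier (fun x => u x * v_ n x) k) ^+ 2 <=
    D * \sum_(l <- cube n) G k l.
  rewrite fE.
  apply: (@le_trans _ _ (weight sg k * (\sum_(l <- cube n) cnorm (fourier v l * fourier u (k - l))) ^+ 2)).
    rewrite ler_wpM2l ?(ltW (weight_gt0 _ _))// ler_sqr ?nnegrE ?cnorm_ge0//.
      exact: cnorm_sum.
    by apply: sumr_ge0 => l _; exact: cnorm_ge0.
  have := @cauchy_schwarz_weight R _ (cube n) (fun l => weight sg l * weight sg (k - l))
     (fun l => weight (- sg) l * weight (- sg) (k - l))
     (fun l => cnorm (fourier v l * fourier u (k - l))).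
  move=> /(_ (fun l => mulr_gt0 (weight_gt0 _ _) (weight_gt0 _ _))).
  have qE l : weight (- sg) l * weight (- sg) (k - l) = (weight sg l * weight sg (k - l))^-1.
    by rewrite !weightN invfM.
  move=> /(_ qE (fun l => cnorm_ge0 _)) h.
  apply: (le_trans (ler_wpM2l (ltW (weight_gt0 sg k)) h)).
  rewrite mulrA; apply: ler_pM.
  - rewrite mulr_ge0 ?(ltW (weight_gt0 _ _))//; apply: sumr_ge0 => l _.
    by rewrite mulr_ge0 ?(ltW (weight_gt0 _ _)).
  - apply: sumr_ge0 => l _; rewrite mulr_ge0 ?sqr_ge0// mulr_ge0 ?(ltW (weight_gt0 _ _))//.
  - rewrite mulr_sumr.
    apply: (@le_trans _ _ (\sum_(l <- cube n) 4 `^ sg * (weight (- sg) l + weight (- sg) (k - l)))).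
      apply: ler_sum => l _.
      have w1 := weight_gt0 sg l; have w2 := weight_gt0 sg (k - l).
      have w3 : 0 <= (weight sg l)^-1 * (weight sg (k - l))^-1 by rewrite mulr_ge0 ?invr_ge0 ?ltW.
      rewrite !weightN; apply: le_trans (ler_wpM2r w3 (weight_quasi_triangle k l (ltW sg0))) _.
      rewrite le_eqVlt; apply/orP; left; apply/eqP; field.
      by rewrite !gt_eqF.
    rewrite -mulr_sumr big_split /= ler_wpM2l ?powR_ge0// lerD//; first exact: hZ (cube_uniq n).
    rewrite -(big_map (fun l => k - l) predT (weight (- sg))); apply: hZ.
    by rewrite map_inj_uniq ?cube_uniq// => a b /addrI /oppr_inj.
  - apply: ler_sum => l _; rewrite /G cnormM exprMn le_eqVlt; apply/orP; left; apply/eqP; ring.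
apply: le_trans (ler_sum _ (fun k _ => main k)) _.
rewrite -mulr_sumr exchange_big /=.
apply: (@le_trans _ _ (D * (M ^+ 2 * N ^+ 2))).
  rewrite ler_wpM2l//.
  apply: (@le_trans _ _ (\sum_(l <- cube n) (weight sg l * cnorm (fourier v l) ^+ 2) * M ^+ 2)).
    apply: ler_sum => l _; rewrite -mulr_sumr ler_wpM2l ?hsum_term_ge0//.
    rewrite -(big_map (fun k => k - l) predT (fun k => weight sg k * cnorm (fourier u k) ^+ 2)).
    by apply: hu2; rewrite map_inj_uniq// => a b /addIr.
  by rewrite -mulr_suml mulrC ler_wpM2l ?sqr_ge0// hv2// cube_uniq.
rewrite !exprMn ler_wpM2r ?mulr_ge0 ?sqr_ge0//.
by rewrite sqrrD expr1n mul1r; have := sqr_ge0 D; lra.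
Qed.

Lemma fourier_fmult sg sg' u M (m : 'rV[int]_d -> R[i]) B : d%:R / 2 < sg' -> 0 <= B ->
  (forall k, weight sg' k * cnorm (m k) ^+ 2 <= B ^+ 2 * weight sg k) ->
  bnd sg u M ->
  bnd sg' (fmult m u) (B * M) /\ forall k, fourier (fmult m u) k = m k * fourier u k.
Proof.
move=> /weight_summable[Z Z0 hZ] B0 hm [cu hu].
have h := hsum_mult B0 hm hu.
have sm := hsum_summable Z0 hZ h.
have fE k : fourier (fmult m u) k = m k * fourier u k by exact: fourier_fseries sm.
split=> //; split; first exact: (tc_fseries sm).
by apply: hsum_ext h => k; rewrite fE.
Qed.

Lemma bnd_fmult sg sg' u M (m : 'rV[int]_d -> R[i]) B : d%:R / 2 < sg' -> 0 <= B ->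
  (forall k, weight sg' k * cnorm (m k) ^+ 2 <= B ^+ 2 * weight sg k) ->
  bnd sg u M -> bnd sg' (fmult m u) (B * M).
Proof. by move=> h1 h2 h3 h4; exact: (fourier_fmult h1 h2 h3 h4).1. Qed.

End SobolevSpace.

(** * The nonlinear phase *)

Section ExpSeries.
Context {R : realType}.

Lemma exprC (a : R) n : (a%:C : R[i]) ^+ n = (a ^+ n)%:C.
Proof. by rewrite -rmorphXn. Qed.

Lemma invnC n : (n%:R : R[i])^-1 = (n%:R^-1)%:C.
Proof. by rewrite -(rmorph_nat (real_complex R)) -fmorphV. Qed.

Lemma cexpI_coeff (a : R) j : ('i * a%:C) ^+ j / j`!%:R = cos_coeff a j +i* sin_coeff a j.
Proof.
have i2 m : ('i : R[i]) ^+ m.*2 = ((-1) ^+ m)%:C.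
  by rewrite -muln2 mulnC exprM sqr_i -exprC rmorphN rmorph1.
have iE : ('i : R[i]) ^+ j =
    ((~~ odd j)%:R * (-1) ^+ j./2) +i* ((odd j)%:R * (-1) ^+ j.-1./2).
  have je := odd_double_half j; move: je; case: (boolP (odd j)) => jo /= je.
    have -> : j.-1./2 = j./2 by rewrite -je /= doubleK uphalf_double.
    rewrite -{1}je exprS i2; apply: complex_eq; rewrite ?cReM ?cImM /=; ring.
  rewrite -{1}je add0n i2; apply: complex_eq; rewrite /=; ring.
rewrite exprMn iE exprC invnC /cos_coeff /sin_coeff /= -!exprnP.
apply: complex_eq; rewrite ?cReM ?cImM /= ?cReM ?cImM /=; ring.
Qed.

Lemma cexpI_psum (a : R) n :
  \sum_(j < n) ('i * a%:C) ^+ j / j`!%:R = series (cos_coeff a) n +i* series (sin_coeff a) n.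
Proof.
rewrite /series /= !big_mkord; elim: n => [|n IH]; first by rewrite !big_ord0.
by rewrite !big_ord_recr IH cexpI_coeff.
Qed.

Lemma cexpI_unif (A e : R) : 0 <= A -> 0 < e -> exists N, forall n, (N <= n)%N ->
  forall a, `|a| <= A ->
  cnorm (\sum_(j < n) ('i * a%:C) ^+ j / j`!%:R - cexp ('i * a%:C)) <= e.
Proof.
move=> A0 e0.
have e20 : 0 < e / 2 by rewrite divr_gt0.
have e40 : 0 < e / 2 / 2 by rewrite divr_gt0.
have /cvgrPdist_le /(_ _ e40) [N _ hN] := @is_cvg_series_exp_coeff R A.
exists N => n Nn a aA.
have tail m : (n <= m)%N -> series (exp_coeff A) m - series (exp_coeff A) n <= e / 2.
  move=> nm; apply: le_trans (ler_norm _) _.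
  rewrite -[X in `|X|](subrKA (limn (series (exp_coeff A)))).
  apply: le_trans (ler_normD _ _) _; rewrite (splitr (e / 2)) lerD//.
    by rewrite distrC; apply: hN; exact: leq_trans nm.
  exact: hN.
have cmp (x : nat -> R) : (forall j, `|x j| <= exp_coeff A j) -> forall m, (n <= m)%N ->
    `|series x n - series x m| <= e / 2.
  move=> hx m nm; apply: le_trans (tail m nm); rewrite distrC.
  rewrite !sub_series_geq//; apply: le_trans (ler_norm_sum _ _ _) _.
  by apply: ler_sum => j _.
have haj j : `|a| ^+ j <= A ^+ j by rewrite lerXn2r ?nnegrE.
have hc j : `|cos_coeff a j| <= exp_coeff A j.
  rewrite /cos_coeff /exp_coeff /= !normrM normfV !normrX !normr_nat normrN1 expr1n mulr1.
  rewrite ler_wpM2r ?invr_ge0//; case: (odd j); rewrite ?mul0r ?mul1r ?exprn_ge0//.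
have hs j : `|sin_coeff a j| <= exp_coeff A j.
  rewrite /sin_coeff /exp_coeff /= !normrM normfV !normrX !normr_nat normrN1 expr1n mulr1.
  rewrite ler_wpM2r ?invr_ge0//; case: (odd j); rewrite ?mul0r ?mul1r ?exprn_ge0//.
have h1 : `|series (cos_coeff a) n - cos a| <= e / 2.
  have := @limn_dist R (series (cos_coeff a)) (series (cos_coeff a) n) (e / 2) n
    (@is_cvg_series_cos_coeff R a) (cmp _ hc).
  by rewrite (_ : cos a = limn (series (cos_coeff a))); last by rewrite unlock.
have h2 : `|series (sin_coeff a) n - sin a| <= e / 2.
  have := @limn_dist R (series (sin_coeff a)) (series (sin_coeff a) n) (e / 2) n
    (@is_cvg_series_sin_coeff R a) (cmp _ hs).
  by rewrite (_ : sin a = limn (series (sin_coeff a))); last by rewrite unlock.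
rewrite cexpI_psum cexpI; apply: le_trans (cnorm_le _) _; rewrite (splitr e).
by rewrite cReD cImD; exact: lerD h1 h2.
Qed.

End ExpSeries.

Section NonlinearPhase.
Context {R : realType} {d : nat}.
Implicit Types (u v : 'rV[R]_d -> R[i]) (sg : R).

Definition cubpow j u (x : 'rV[R]_d) : R[i] := (u x * (u x)^*) ^+ j * u x.

Lemma bnd_cubpow sg K L u j : 1 <= K ->
  (forall u v M N, bnd sg u M -> bnd sg v N -> bnd sg (fun x => u x * v x) (K * (M * N))) ->
  bnd sg u L -> bnd sg (cubpow j u) ((K * L) ^+ j.*2 * L).
Proof.
move=> K1 hK hu; elim: j => [|j IH].
  by rewrite expr0 mul1r /cubpow; under eq_fun do rewrite expr0 mul1r.
have := hK _ _ _ _ (hK _ _ _ _ hu (bndJ hu)) IH.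
rewrite (_ : (fun _ => _) = cubpow j.+1 u).
  by apply: bnd_le; rewrite doubleS !exprS; nra.
by apply/funext => x; rewrite /cubpow exprS mulrA.
Qed.

Lemma bnd_cubpowB sg K L dl u v j : 1 <= K ->
  (forall u v M N, bnd sg u M -> bnd sg v N -> bnd sg (fun x => u x * v x) (K * (M * N))) ->
  bnd sg u L -> bnd sg v L -> bnd sg (fun x => u x - v x) dl ->
  bnd sg (fun x => cubpow j u x - cubpow j v x) (j.*2.+1%:R * (K * L) ^+ j.*2 * dl).
Proof.
move=> K1 hK hu hv huv; elim: j => [|j IH].
  rewrite expr0 !mul1r /cubpow.
  by rewrite (_ : (fun _ => _) = fun x => u x - v x)//; apply/funext => x; rewrite !expr0 !mul1r.
have h1 := hK _ _ _ _ (hK _ _ _ _ hu (bndJ hu)) IH.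
have h2 := hK _ _ _ _ huv (bndJ hu).
have h3 := hK _ _ _ _ hv (bndJ huv).
have h4 := hK _ _ _ _ (bndD h2 h3) (bnd_cubpow j K1 hK hv).
have := bndD h1 h4.
rewrite (_ : (fun _ => _) = fun x => cubpow j.+1 u x - cubpow j.+1 v x).
  apply: bnd_le; rewrite le_eqVlt; apply/orP; left; apply/eqP.
  rewrite doubleS !exprS !mulrS; move: (_ ^+ j.*2) => y; ring.
apply/funext => x; rewrite /cubpow !exprS.
have -> : (u x - v x)^* = (u x)^* - (v x)^* by exact: rmorphB.
move: (u x) (u x)^* (v x) (v x)^* => a a' b b'; ring.
Qed.

Lemma exp_psum_le (X : R) n : 0 <= X -> \sum_(j < n) X ^+ j / j`!%:R <= expR X.
Proof.
move=> X0; have := @nondecreasing_cvgn_le _ (series (exp_coeff X)).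
rewrite /series /= => h; rewrite -(big_mkord predT (fun j => X ^+ j / j`!%:R)).
apply: h; last exact: is_cvg_series_exp_coeff.
by apply: nondecreasing_series => j _ _; exact: exp_coeff_ge0.
Qed.

(* Both phases are expanded in their power series, whose terms are odd monomials in
   [u] and [u^*]. *)
Lemma phase_lip sg L : d%:R / 2 < sg -> 0 <= L -> exists2 P, 0 <= P &
  forall tau u v dl, 0 <= tau <= 1 -> bnd sg u L -> bnd sg v L ->
    bnd sg (fun x => u x - v x) dl ->
    bnd sg (fun x => (nl_phase tau u x - u x) - (nl_phase tau v x - v x))
      (tau * (P * dl)).
Proof.
move=> hs L0; have [K K1 hK] := bndM_ex hs; have [C C0 hC] := bnd_sup hs.
set X := (K * L) ^+ 2.
have X0 : 0 <= X by exact: sqr_ge0.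
have XE : (K * L) ^+ 2 = X by [].
clearbody X.
exists (3 * X * expR X); first by apply: mulr_ge0; [exact: mulr_ge0|exact: expR_ge0].
move=> tau u v dl /andP[t0 t1] hu hv huv; have dl0 := bnd_ge0 huv.
set lam := tau * (3 / 8).
have l0 : 0 <= lam by rewrite /lam; lra.
have l1 : lam <= tau by rewrite /lam; lra.
pose b j : R[i] := ('i * (- lam)%:C) ^+ j.+1 / j.+1`!%:R.
have cb j : cnorm (b j) <= lam / j.+1`!%:R.
  rewrite /b cnormM cnormX cnormM cnormi mul1r cnorm_real normrN ger0_norm//.
  rewrite invnC cnorm_real ger0_norm ?invr_ge0// ler_wpM2r ?invr_ge0//.
  by rewrite exprS ler_piMr// exprn_ile1//; exact: le_trans l1 t1.
pose g n (w : 'rV[R]_d -> R[i]) x := \sum_(j < n) b j * cubpow j.+1 w x.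
have gcvg w : bnd sg w L -> unif_cvg (fun n => g n w) (fun x => nl_phase tau w x - w x).
  move=> hw e e0.
  have A0 : 0 <= lam * (C * L) ^+ 2 by rewrite mulr_ge0// sqr_ge0.
  have CL0 : 0 <= C * L by rewrite mulr_ge0// ltW.
  have e'0 : 0 < e / (C * L + 1) by rewrite divr_gt0// ltr_wpDl.
  have [N hN] := cexpI_unif A0 e'0; exists N => n Nn x.
  have wx := hC _ _ hw x.
  pose a := - (lam * cnorm (w x) ^+ 2).
  have aE : a%:C = (- lam)%:C * (w x * (w x)^*).
    by rewrite -normCK cnormE exprC -rmorphM /a mulNr.
  have := hN n.+1 (leq_trans Nn (leqnSn n)) a.
  rewrite /a normrN normrM (ger0_norm l0) normrX (ger0_norm (cnorm_ge0 _)) -/a.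
  rewrite ler_wpM2l ?lerXn2r ?nnegrE ?cnorm_ge0// => /(_ isT) h.
  have -> : g n w x - (nl_phase tau w x - w x) =
      (\sum_(j < n.+1) ('i * a%:C) ^+ j / j`!%:R - cexp ('i * a%:C)) * w x.
    rewrite big_ord_recl expr0 divr1 /nl_phase -/lam.
    have -> : - ('i * lam%:C * `|w x| ^+ 2) = 'i * a%:C.
      by rewrite aE -normCK rmorphN /=; ring.
    rewrite /g [X in X - _](_ : _ = (\sum_(j < n) ('i * a%:C) ^+ j.+1 / j.+1`!%:R) * w x).
      by ring.
    rewrite mulr_suml; apply: eq_bigr => j _.
    rewrite /b /cubpow aE (mulrA 'i) [in RHS]exprMn; move: (_ ^+ _) (_ ^+ _) (_^-1) => A B D; ring.
  rewrite cnormM; apply: (@le_trans _ _ (e / (C * L + 1) * (C * L + 1))); last first.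
    by rewrite divfK// gt_eqF// ltr_wpDl.
  apply: ler_pM; rewrite ?cnorm_ge0//.
  by apply: le_trans wx _; rewrite lerDl.
have cvgB : unif_cvg (fun n x => g n u x - g n v x)
   (fun x => (nl_phase tau u x - u x) - (nl_phase tau v x - v x)).
  move=> e e0; have e20 : 0 < e / 2 by rewrite divr_gt0.
  have [N1 h1] := gcvg u hu _ e20; have [N2 h2] := gcvg v hv _ e20.
  exists (maxn N1 N2) => n; rewrite geq_max => /andP[n1 n2] x.
  have -> : g n u x - g n v x - (nl_phase tau u x - u x - (nl_phase tau v x - v x)) =
    (g n u x - (nl_phase tau u x - u x)) - (g n v x - (nl_phase tau v x - v x)) by ring.
  by apply: le_trans (le_cnormB _ _) _; rewrite (splitr e) lerD ?h1 ?h2.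
apply: (bnd_unif_cvg cvgB) => n.
rewrite (_ : (fun _ => _) = fun x => \sum_(j < n) b j * (cubpow j.+1 u x - cubpow j.+1 v x)); last first.
  by apply/funext => x; rewrite /g -sumrB; apply: eq_bigr => j _; rewrite mulrBr.
have h := bnd_sum (index_enum 'I_n) (fun j : 'I_n =>
  bndZ (b j) (bnd_cubpowB j.+1 K1 hK hu hv huv)).
apply: bnd_le h.
apply: (@le_trans _ _ (\sum_(j < n) (tau * (3 * X * dl)) * (X ^+ j / j`!%:R))).
  apply: ler_sum => j _.
  have f0 : 0 < j`!%:R :> R by rewrite ltr0n fact_gt0.
  apply: (@le_trans _ _ (lam / j.+1`!%:R * ((3 * j.+1%:R) * X ^+ j.+1 * dl))).
    have K0 : 0 <= K by apply: le_trans K1.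
    apply: ler_pM; [exact: cnorm_ge0| |exact: cb|].
      by rewrite mulr_ge0// mulr_ge0// exprn_ge0// mulr_ge0.
    rewrite -mul2n exprM XE ler_wpM2r// ler_wpM2r//; first exact: exprn_ge0.
    by have j0 := ler0n R j; rewrite -addn1 natrD natrM -(addn1 j) natrD; lra.
  rewrite factS natrM invfM [leLHS](_ : _ = lam * (3 * X * dl) * (X ^+ j / j`!%:R)).
    rewrite ler_wpM2r ?divr_ge0 ?exprn_ge0// ler_wpM2r// !mulr_ge0//.
  by rewrite exprS; field; rewrite !gt_eqF// ltr0n.
rewrite -mulr_sumr; apply: (le_trans (ler_wpM2l _ (exp_psum_le n X0))).
  by rewrite !mulr_ge0.
by rewrite le_eqVlt; apply/orP; left; apply/eqP; ring.
Qed.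

End NonlinearPhase.

(** * Fourier multipliers of the scheme *)

Section PhiBounds.
Context {R : realType}.

Lemma sin_le_norm (x : R) : `|sin x| <= `|x|.
Proof.
wlog x0 : x / 0 <= x => [h|].
  have [/h//|x0] := leP 0 x.
  by rewrite -normrN -sinN -[leRHS]normrN; apply: h; rewrite oppr_ge0 ltW.
have [->|xn0] := eqVneq x 0; first by rewrite sin0 normr0.
have xp : 0 < x by rewrite lt_neqAle eq_sym xn0.
have [y _ e] := @MVT R (@sin R) (@cos R) 0 x xp (fun y _ => is_derive_sin y)
  (continuous_subspaceT (@continuous_sin R)).
by rewrite sin0 !subr0 in e; rewrite e normrM ler_piMl// cos_max.
Qed.

Lemma cexpI_dist1 (x : R) : cnorm (cexp ('i * x%:C) - 1) <= `|x|.
Proof.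
rewrite -ler_sqr ?nnegrE ?cnorm_ge0// cexpI cnorm_sqr cReD cImD /= oppr0 addr0.
have s2 := sin_le_norm (x / 2).
have xE : x = x / 2 + x / 2 by field.
have -> : cos x = cos (x / 2 + x / 2) by rewrite -xE.
have -> : sin x = sin (x / 2 + x / 2) by rewrite -xE.
rewrite cosD sinD.
have cs := cos2Dsin2 (x / 2).
have : sin (x / 2) ^+ 2 <= (x / 2) ^+ 2 by rewrite -ler_sqr ?nnegrE// !real_normK ?num_real// in s2.
rewrite real_normK ?num_real//; move: cs; move: (cos _) (sin _) => a b cs h.
have -> : (a * a - b * b - 1) ^+ 2 + (b * a + a * b) ^+ 2 =
   (a ^+ 2 + b ^+ 2 - 1) ^+ 2 + 4 * b ^+ 2 by ring.
by rewrite cs subrr expr0n add0r; lra.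
Qed.

Lemma cexpI_dist (x y : R) : cnorm (cexp ('i * x%:C) - cexp ('i * y%:C)) <= `|x - y|.
Proof.
have -> : cexp ('i * x%:C) - cexp ('i * y%:C) =
    cexp ('i * y%:C) * (cexp ('i * (x - y)%:C) - 1).
  by rewrite mulrBr mulr1 -cexpID (addrC y) subrK.
by rewrite cnormM cnorm_cexpI mul1r cexpI_dist1.
Qed.

Lemma iC_neq0 (x : R) : x != 0 -> 'i * x%:C != 0 :> R[i].
Proof.
move=> x0; rewrite mulf_neq0//; last by rewrite eq_complex /= eqxx andbT.
by rewrite eq_complex /= eqxx oner_eq0.
Qed.

Lemma cnorm_iC (x : R) : cnorm ('i * x%:C) = `|x|.
Proof. by rewrite cnormM cnormi mul1r cnorm_real. Qed.

Lemma varphi1_le1 (x : R) : cnorm (varphi1 ('i * x%:C)) <= 1.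
Proof.
rewrite /varphi1; case: eqP => [_|]; first by rewrite cnorm1.
move=> x0; have xn : x != 0 by apply/eqP => e; apply: x0; rewrite e rmorph0 mulr0.
by rewrite cnormM cnormV cnorm_iC ler_pdivrMr ?normr_gt0// mul1r; exact: cexpI_dist1.
Qed.

Lemma varphi1_le (x : R) : x != 0 -> cnorm (varphi1 ('i * x%:C)) <= 2 / `|x|.
Proof.
move=> x0; rewrite /varphi1 (negbTE (iC_neq0 x0)).
rewrite cnormM cnormV cnorm_iC ler_wpM2r ?invr_ge0//.
by apply: le_trans (le_cnormB _ _) _; rewrite cnorm_cexpI cnorm1.
Qed.

Lemma varphi2_le (x : R) : x != 0 -> cnorm (varphi2 ('i * x%:C)) <= 2 / `|x|.
Proof.
move=> x0; rewrite /varphi2 (negbTE (iC_neq0 x0)).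
rewrite cnormM cnormV cnorm_iC ler_wpM2r ?invr_ge0//.
apply: le_trans (le_cnormB _ _) _; rewrite cnorm_cexpI.
by have := varphi1_le1 x; lra.
Qed.

End PhiBounds.

Section Symbols.
Context {R : realType} {d : nat}.
Implicit Types (k : 'rV[int]_d) (c : R).

Lemma bracket_sqr c k : bracket c k ^+ 2 = freq_sq k + c ^+ 2.
Proof. by rewrite sqr_sqrtr// addr_ge0 ?sqr_ge0 ?freq_sq_ge0. Qed.

Lemma bracket_ge c k : 0 < c -> c <= bracket c k.
Proof.
move=> c0; rewrite -ler_sqr ?nnegrE ?sqrtr_ge0 ?(ltW c0)// bracket_sqr.
by rewrite lerDr freq_sq_ge0.
Qed.

Lemma bracket_le c k : 0 < c -> bracket c k <= c + Num.sqrt (freq_sq k).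
Proof.
move=> c0; have p0 := sqrtr_ge0 (freq_sq k : R).
rewrite -ler_sqr ?nnegrE ?sqrtr_ge0 ?addr_ge0 ?(ltW c0)// bracket_sqr.
have := sqr_sqrtr (freq_sq_ge0 k : 0 <= freq_sq k :> R).
move: (Num.sqrt _) p0 => p p0 <-; have : 0 <= c * p by rewrite mulr_ge0// ltW.
by lra.
Qed.

Lemma symA_ge0 c k : 0 < c -> 0 <= symA c k.
Proof.
by move=> c0; rewrite /symA expr2 -mulrBr mulr_ge0 ?subr_ge0 ?bracket_ge// ltW.
Qed.

Lemma symA_le c k : 0 < c -> symA c k <= freq_sq k / 2.
Proof.
move=> c0; have := bracket_sqr c k; rewrite /symA.
move: (bracket c k) (freq_sq k) => b q e.
by have := sqr_ge0 (b - c); lra.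
Qed.

Lemma symA_le_freq c k : 0 < c -> symA c k <= c * Num.sqrt (freq_sq k).
Proof.
move=> c0; have := bracket_le k c0; rewrite /symA expr2 -mulrBr => h.
by rewrite ler_wpM2l ?(ltW c0)// lerBlDl.
Qed.

Lemma symA_dist c k : 0 < c -> `|symA c k - freq_sq k / 2| <= freq_sq k * Num.sqrt (freq_sq k) / c.
Proof.
move=> c0; rewrite distrC ger0_norm ?subr_ge0 ?symA_le//.
rewrite ler_pdivlMr//; have := bracket_sqr c k; rewrite /symA; have := bracket_ge k c0.
have := bracket_le k c0.
have := sqrtr_ge0 (freq_sq k : R).
move: (bracket c k) (freq_sq k) (Num.sqrt _) => b q p p0 h1 h2 e.
have qE : q = (b - c) * (b + c) by rewrite -subr_sqr e addrK.
have -> : (q / 2 - (c * b - c ^+ 2)) * c = (b - c) ^+ 2 * c / 2.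
  have -> : q = b ^+ 2 - c ^+ 2 by rewrite e addrK.
  by field.
have bc : 0 <= b - c by rewrite subr_ge0.
have : (b - c) * ((b - c) * c) <= p * ((b - c) * (b + c)).
  apply: ler_pM => //; first by rewrite mulr_ge0// ltW.
    by rewrite lerBlDl.
  by rewrite ler_wpM2l// lerDr; lra.
rewrite -qE mulrA -expr2; have : 0 <= (b - c) ^+ 2 * c by rewrite mulr_ge0 ?sqr_ge0 ?ltW.
by lra.
Qed.

Lemma cB_bound c k : 0 < c -> 0 <= c / bracket c k <= 1.
Proof.
move=> c0; have h := bracket_ge k c0; have b0 := lt_le_trans c0 h.
by rewrite divr_ge0 ?(ltW c0) ?(ltW b0)//= ler_pdivrMr// mul1r.
Qed.

Lemma cB1_le c k : 0 < c -> `|c / bracket c k - 1| <= Num.sqrt (freq_sq k) / c.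
Proof.
move=> c0; have h := bracket_ge k c0; have b0 := lt_le_trans c0 h.
have /andP[h1 h2] := cB_bound k c0.
rewrite distrC ger0_norm ?subr_ge0// -(divff (lt0r_neq0 b0)) -mulrBl.
have h3 := bracket_le k c0.
apply: ler_pM; rewrite ?subr_ge0 ?invr_ge0 ?(ltW b0)//; first by rewrite lerBlDl.
by rewrite lef_pV2.
Qed.

Lemma cB1_le1 c k : 0 < c -> `|c / bracket c k - 1| <= 1.
Proof.
by move=> c0; have /andP[h1 h2] := cB_bound k c0; rewrite distrC ger0_norm ?subr_ge0// lerBlDr lerDl.
Qed.

End Symbols.

Section UniformBounds.
Context {R : realType} {d : nat} {I : Type}.
Implicit Types (F G : I -> 'rV[R]_d -> R[i]) (g h : I -> R) (sg : R).

(* Bounds that are uniform over a family of step sizes, parameters and functions. *)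
Definition bndO sg F g := exists2 K, 0 <= K & forall i, bnd sg (F i) (K * g i).

Lemma bnd_cst sg (a : R[i]) : bnd sg (fun _ : 'rV[R]_d => a) (cnorm a).
Proof.
have h : bnd sg (ek (0 : 'rV[int]_d) : 'rV[R]_d -> R[i]) 1.
  split; first exact: tc_ek.
  split => // s us; rewrite expr1n.
  have E (k : 'rV[int]_d) : weight sg k * cnorm (fourier (ek 0) k) ^+ 2 = (k == 0)%:R :> R.
    rewrite fourier_ek; case: eqVneq => [->|_]; last by rewrite cnorm0 expr0n mulr0.
    rewrite cnorm1 expr1n mulr1 /weight /jb /freq_sq big1 ?addr0 ?powR1//.
    by move=> i _; rewrite mxE expr0n.
  rewrite (eq_bigr _ (fun k _ => E k)); case: (boolP (0 \in s)) => s0.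
    rewrite (bigD1_seq 0)//= eqxx big1 ?addr0// => k k0.
    by rewrite (negbTE k0).
  rewrite big_seq big1 // => k ks; case: eqVneq => // k0.
  by rewrite -k0 ks in s0.
have := bndZ a h; rewrite mulr1; congr bnd; apply/funext => x.
rewrite (_ : ek 0 x = 1) ?mulr1// /ek /freq_dot big1 => [|i _].
  by rewrite cexpI cos0 sin0.
by rewrite mxE mul0r.
Qed.

Lemma bndO_le sg F g h B : 0 <= B -> (forall i, g i <= B * h i) -> bndO sg F g -> bndO sg F h.
Proof.
move=> B0 gh [K K0 hF]; exists (K * B); first exact: mulr_ge0.
by move=> i; apply: bnd_le (hF i); rewrite -mulrA ler_wpM2l.
Qed.

Lemma bndO_weaken sg sg' F g : sg' <= sg -> bndO sg F g -> bndO sg' F g.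
Proof. by move=> ss [K K0 hF]; exists K => // i; exact: bnd_weaken (hF i). Qed.

Lemma bndO_D sg F G g : bndO sg F g -> bndO sg G g -> bndO sg (fun i x => F i x + G i x) g.
Proof.
move=> [K K0 hF] [L L0 hG]; exists (K + L); first exact: addr_ge0.
by move=> i; rewrite mulrDl; exact: bndD.
Qed.

Lemma bndO_N sg F g : bndO sg F g -> bndO sg (fun i x => - F i x) g.
Proof. by move=> [K K0 hF]; exists K => // i; exact: bndN. Qed.

Lemma bndO_B sg F G g : bndO sg F g -> bndO sg G g -> bndO sg (fun i x => F i x - G i x) g.
Proof. by move=> hF hG; apply: bndO_D => //; exact: bndO_N. Qed.

Lemma bndO_J sg F g : bndO sg F g -> bndO sg (fun i x => (F i x)^*) g.
Proof. by move=> [K K0 hF]; exists K => // i; exact: bndJ. Qed.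

Lemma bndO_Z sg F g h (a : I -> R[i]) B : 0 <= B -> (forall i, cnorm (a i) <= B * h i) ->
  bndO sg F g -> bndO sg (fun i x => a i * F i x) (fun i => h i * g i).
Proof.
move=> B0 ah [K K0 hF]; exists (K * B); first exact: mulr_ge0.
move=> i; apply: bnd_le (bndZ (a i) (hF i)).
have Kg := bnd_ge0 (hF i).
by apply: le_trans (ler_wpM2r Kg (ah i)) _; rewrite le_eqVlt; apply/orP; left; apply/eqP; ring.
Qed.

Lemma bndO_Z1 sg F g (a : I -> R[i]) B : 0 <= B -> (forall i, cnorm (a i) <= B) ->
  bndO sg F g -> bndO sg (fun i x => a i * F i x) g.
Proof.
move=> B0 aB hF; have := @bndO_Z sg F g (fun=> 1) a B B0 _ hF.
under [X in (_ -> bndO _ _ X) -> _]eq_fun do rewrite mul1r.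
by apply=> i; rewrite mulr1.
Qed.

Lemma bndO_Zc (z : R[i]) sg F g : bndO sg F g -> bndO sg (fun i x => z * F i x) g.
Proof. by apply: (@bndO_Z1 _ _ _ (fun=> z) (cnorm z)) => //; exact: cnorm_ge0. Qed.

Lemma bndO_M sg F G g h : d%:R / 2 < sg -> bndO sg F g -> bndO sg G h ->
  bndO sg (fun i x => F i x * G i x) (fun i => g i * h i).
Proof.
move=> hs [K K0 hF] [L L0 hG]; have [A A1 hA] := bndM_ex hs.
have A0 : 0 <= A by apply: le_trans A1.
exists (A * (K * L)); first by rewrite !mulr_ge0.
move=> i; apply: bnd_le (hA _ _ _ _ (hF i) (hG i)).
by rewrite le_eqVlt; apply/orP; left; apply/eqP; ring.
Qed.

Lemma bndO_M1 sg F G g : d%:R / 2 < sg -> bndO sg F (fun=> 1) -> bndO sg G g ->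
  bndO sg (fun i x => F i x * G i x) g.
Proof.
move=> hs hF hG; have := bndO_M hs hF hG.
by under [X in bndO _ _ X -> _]eq_fun do rewrite mul1r.
Qed.

Lemma bndO_X sg F n : d%:R / 2 < sg -> bndO sg F (fun=> 1) ->
  bndO sg (fun i x => F i x ^+ n) (fun=> 1).
Proof.
move=> hs hF; elim: n => [|n IH].
  under eq_fun do under eq_fun do rewrite expr0.
  by exists 1 => // i; rewrite mulr1 -[X in bnd _ _ X](@cnorm1 R); exact: bnd_cst.
under eq_fun do under eq_fun do rewrite exprS.
exact: bndO_M1.
Qed.

Lemma bndO_norm2 sg F : d%:R / 2 < sg -> bndO sg F (fun=> 1) ->
  bndO sg (fun i x => `|F i x| ^+ 2) (fun=> 1).
Proof.
move=> hs hF; under eq_fun do under eq_fun do rewrite normCK.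
by apply: bndO_M1 => //; exact: bndO_J.
Qed.

Lemma bndO_fm sg1 sg2 (m : I -> 'rV[int]_d -> R[i]) F g h B : d%:R / 2 < sg2 ->
  0 <= B -> (forall i, 0 <= h i) ->
  (forall i k, weight sg2 k * cnorm (m i k) ^+ 2 <= (B * h i) ^+ 2 * weight sg1 k) ->
  bndO sg1 F g -> bndO sg2 (fun i => fmult (m i) (F i)) (fun i => h i * g i).
Proof.
move=> hs B0 h0 hm [K K0 hF]; exists (K * B); first exact: mulr_ge0.
move=> i; have := bnd_fmult hs (mulr_ge0 B0 (h0 i)) (hm i) (hF i).
by apply: bnd_le; rewrite le_eqVlt; apply/orP; left; apply/eqP; ring.
Qed.

Lemma bndO_fm_same sg (m : I -> 'rV[int]_d -> R[i]) F g h B : d%:R / 2 < sg ->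
  0 <= B -> (forall i, 0 <= h i) ->
  (forall i k, cnorm (m i k) <= B * h i) ->
  bndO sg F g -> bndO sg (fun i => fmult (m i) (F i)) (fun i => h i * g i).
Proof.
move=> hs B0 h0 hm; apply: (@bndO_fm sg sg m F g h B) => // i k.
rewrite mulrC ler_wpM2r ?(ltW (weight_gt0 _ _))// !expr2.
by apply: ler_pM; rewrite ?cnorm_ge0 ?hm.
Qed.

Lemma bndO_fm_lose sg sg' n (m : I -> 'rV[int]_d -> R[i]) F g h B : d%:R / 2 < sg ->
  sg' = sg + n%:R -> 0 <= B -> (forall i, 0 <= h i) ->
  (forall i k, cnorm (m i k) ^+ 2 <= (B * h i) ^+ 2 * jb k ^+ n) ->
  bndO sg' F g -> bndO sg (fun i => fmult (m i) (F i)) (fun i => h i * g i).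
Proof.
move=> hs -> B0 h0 hm; apply: (@bndO_fm _ _ m F g h B) => // i k.
by rewrite weightD [leRHS]mulrCA ler_wpM2l ?(ltW (weight_gt0 _ _)).
Qed.

Lemma bndO_fm_gain sg sg' n (m : I -> 'rV[int]_d -> R[i]) F g h B : d%:R / 2 < sg' ->
  sg' = sg + n%:R -> 0 <= B -> (forall i, 0 <= h i) ->
  (forall i k, cnorm (m i k) ^+ 2 * jb k ^+ n <= (B * h i) ^+ 2) ->
  bndO sg F g -> bndO sg' (fun i => fmult (m i) (F i)) (fun i => h i * g i).
Proof.
move=> hs se B0 h0 hm; apply: (@bndO_fm _ _ m F g h B) => // i k.
rewrite se weightD -mulrA [leRHS]mulrC ler_wpM2l ?(ltW (weight_gt0 _ _))//.
by rewrite mulrC.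
Qed.

End UniformBounds.

Lemma two_div_le (R : realType) (t y z : R) : 0 < t -> 0 < z -> 2 * z <= y ->
  2 / (t * y) <= (t * z)^-1.
Proof.
move=> t0 z0 zy; have y0 : 0 < y by apply: lt_le_trans zy; rewrite mulr_gt0.
rewrite ler_pdivrMr ?mulr_gt0//.
have -> : (t * z)^-1 * (t * y) = y / z by field; rewrite !gt_eqF.
by rewrite ler_pdivlMr.
Qed.

Section Oscillation.
Context {R : realType}.
Implicit Types (c s t : R) (l : int).

Lemma osc_arg l c s : l%:~R * ('i * (c ^+ 2)%:C) * s%:C = 'i * (l%:~R * (c ^+ 2 * s))%:C :> R[i].
Proof. by rewrite !rmorphM /= rmorph_int; ring. Qed.

Lemma cnorm_osc l c s : cnorm (cexp (l%:~R * ('i * (c ^+ 2)%:C) * s%:C)) = 1.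
Proof. by rewrite osc_arg cnorm_cexpI. Qed.

Lemma varphi1_osc l c t : cnorm (varphi1 (l%:~R * ('i * (c ^+ 2)%:C) * t%:C)) <= 1.
Proof. by rewrite osc_arg varphi1_le1. Qed.

Lemma inv_osc l c t : l != 0 -> 0 < c -> 0 < t ->
  cnorm (l%:~R * ('i * (c ^+ 2)%:C) * t%:C)^-1 <= (t * c ^+ 2)^-1.
Proof.
move=> l0 c0 t0; rewrite osc_arg cnormV cnorm_iC normrM.
have p : 0 < t * c ^+ 2 by rewrite mulr_gt0// exprn_gt0.
rewrite (gtr0_norm (_ : 0 < c ^+ 2 * t)); last by rewrite mulrC.
have l1 : 1 <= `|l%:~R| :> R by rewrite -intr_norm ler1z; lia.
rewrite (mulrC (c ^+ 2)) lef_pV2 ?posrE// ?mulr_gt0 ?(lt_le_trans ltr01 l1)//.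
by rewrite ler_peMl// ltW.
Qed.

Lemma varphi2_osc l c t : l != 0 -> 0 < c -> 0 < t ->
  cnorm (varphi2 (l%:~R * ('i * (c ^+ 2)%:C) * t%:C)) <= 2 * (t * c ^+ 2)^-1.
Proof.
move=> l0 c0 t0; have := inv_osc l0 c0 t0.
rewrite osc_arg cnormV cnorm_iC => h.
apply: le_trans (varphi2_le _) _; last by rewrite ler_wpM2l.
by rewrite mulf_neq0 ?intr_eq0// mulf_neq0 ?expf_neq0// gt_eqF.
Qed.

End Oscillation.

Section Operators.
Context {R : realType} {d : nat} {I : Type} (tau c : I -> R).
Context (ht0 : forall i, 0 < tau i) (ht1 : forall i, tau i <= 1)
  (hc : forall i, 1 <= tau i * c i).
Implicit Types (F G : I -> 'rV[R]_d -> R[i]) (g h : I -> R) (sg : R) (k : 'rV[int]_d).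

Lemma c_gt0 i : 0 < c i.
Proof. by have := hc i; rewrite -(pmulr_rgt0 _ (ht0 i)); exact: lt_le_trans. Qed.

Lemma c_ge1 i : 1 <= c i.
Proof.
apply: le_trans (hc i) _; rewrite -[leRHS]mul1r ler_wpM2r ?(ltW (c_gt0 i))//.
Qed.

Definition alpha i : R := (tau i * c i ^+ 2)^-1.

Lemma alpha_gt0 i : 0 < alpha i.
Proof. by rewrite invr_gt0 mulr_gt0// exprn_gt0// c_gt0. Qed.

Lemma bndO_fm1 sg (m : I -> 'rV[int]_d -> R[i]) F g : d%:R / 2 < sg ->
  (forall i k, cnorm (m i k) <= 1) ->
  bndO sg F g -> bndO sg (fun i => fmult (m i) (F i)) g.
Proof.
move=> hs hm hF.
apply: (@bndO_le _ _ _ _ _ (fun i => 1 * g i) g 1) => //.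
apply: (@bndO_fm_same _ _ _ sg m F g (fun=> 1) 1) => // i k.
by rewrite mulr1.
Qed.

Lemma bndO_opE sg (s : I -> R) F g : d%:R / 2 < sg ->
  bndO sg F g -> bndO sg (fun i => opE (c i) (s i) (F i)) g.
Proof. by move=> hs; apply: bndO_fm1 => // i k; rewrite cnorm_cexpI. Qed.

Lemma bndO_opB sg F g : d%:R / 2 < sg ->
  bndO sg F g -> bndO sg (fun i => opB (c i) (F i)) g.
Proof.
move=> hs; apply: bndO_fm1 => // i k.
by have /andP[h1 h2] := cB_bound k (c_gt0 i); rewrite cnorm_real ger0_norm.
Qed.

Definition opP (vphi : R[i] -> R[i]) i := fmult (fun k : 'rV[int]_d =>
  vphi ('i * (tau i)%:C * (2 * (c i) ^+ 2 + freq_sq k / 2)%:C)).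

Definition opQ (vphi : R[i] -> R[i]) (l : int) i := fmult (fun k : 'rV[int]_d =>
  vphi ('i * (tau i)%:C * (l%:~R * (c i) ^+ 2 - symA (c i) k)%:C)).

Definition decays (vphi : R[i] -> R[i]) :=
  forall x : R, x != 0 -> cnorm (vphi ('i * x%:C)) <= 2 / `|x|.

Lemma P_bound vphi i k : decays vphi ->
  cnorm (vphi ('i * (tau i)%:C * (2 * (c i) ^+ 2 + freq_sq k / 2)%:C)) <=
  2 / (tau i * (2 * (c i) ^+ 2 + freq_sq k / 2)).
Proof.
move=> hv; rewrite -mulrA -rmorphM.
have x0 : 0 < tau i * (2 * c i ^+ 2 + freq_sq k / 2).
  by rewrite mulr_gt0// ltr_pwDl ?divr_ge0 ?freq_sq_ge0// mulr_gt0// exprn_gt0// c_gt0.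
by apply: le_trans (hv _ (lt0r_neq0 x0)) _; rewrite gtr0_norm.
Qed.

Lemma Q_bound vphi (l : int) i k : decays vphi -> l <= - 2 ->
  cnorm (vphi ('i * (tau i)%:C * (l%:~R * (c i) ^+ 2 - symA (c i) k)%:C)) <=
  2 / (tau i * (2 * (c i) ^+ 2 + symA (c i) k)).
Proof.
move=> hv hl; rewrite -mulrA -rmorphM.
have c20 : 0 < c i ^+ 2 by rewrite exprn_gt0// c_gt0.
have A0 := symA_ge0 k (c_gt0 i).
have y0 : 0 < 2 * c i ^+ 2 + symA (c i) k by lra.
have lR : l%:~R <= -2 :> R by rewrite -(ler_int R) in hl.
have le : 2 * c i ^+ 2 + symA (c i) k <= - (l%:~R * (c i) ^+ 2 - symA (c i) k) by nra.
have x0 : tau i * (l%:~R * c i ^+ 2 - symA (c i) k) < 0.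
  by rewrite pmulr_rlt0// -oppr_gt0; exact: lt_le_trans le.
apply: le_trans (hv _ (ltr0_neq0 x0)) _; rewrite ltr0_norm// ler_wpM2l//.
by rewrite -mulrN lef_pV2 ?posrE ?mulr_gt0// ?(lt_le_trans y0 le)// ler_pM2l.
Qed.

Lemma bndO_P_alpha sg vphi F : decays vphi -> d%:R / 2 < sg ->
  bndO sg F (fun=> 1) -> bndO sg (fun i => opP vphi i (F i)) alpha.
Proof.
move=> hv hs hF.
apply: (@bndO_le _ _ _ _ _ (fun i => alpha i * 1) alpha 1) => //.
  by move=> i; rewrite mulr1 mul1r.
apply: (@bndO_fm_same _ _ _ sg _ F (fun=> 1) alpha 1) => // i; first exact: ltW (alpha_gt0 i).
move=> k; rewrite mul1r; apply: le_trans (P_bound _ _ hv) _.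
have c20 : 0 < c i ^+ 2 by rewrite exprn_gt0// c_gt0.
have q0 : 0 <= freq_sq k / 2 :> R by rewrite divr_ge0 ?freq_sq_ge0.
by apply: two_div_le => //; lra.
Qed.

Lemma bndO_Q_alpha sg vphi (l : int) F : decays vphi -> l <= -2 -> d%:R / 2 < sg ->
  bndO sg F (fun=> 1) -> bndO sg (fun i => opQ vphi l i (F i)) alpha.
Proof.
move=> hv hl hs hF.
apply: (@bndO_le _ _ _ _ _ (fun i => alpha i * 1) alpha 1) => //.
  by move=> i; rewrite mulr1 mul1r.
apply: (@bndO_fm_same _ _ _ sg _ F (fun=> 1) alpha 1) => // i; first exact: ltW (alpha_gt0 i).
move=> k; rewrite mul1r; apply: le_trans (Q_bound _ _ hv hl) _.
have c20 : 0 < c i ^+ 2 by rewrite exprn_gt0// c_gt0.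
have A0 := symA_ge0 k (c_gt0 i).
by apply: two_div_le => //; lra.
Qed.

Lemma bndO_P_gain sg vphi F : decays vphi -> d%:R / 2 < sg + 2 ->
  bndO sg F (fun=> 1) -> bndO (sg + 2) (fun i => opP vphi i (F i)) (fun i => (tau i)^-1).
Proof.
move=> hv hs hF.
apply: (@bndO_le _ _ _ _ _ (fun i => (tau i)^-1 * 1) (fun i => (tau i)^-1) 1) => //.
  by move=> i; rewrite mulr1 mul1r.
apply: (@bndO_fm_gain _ _ _ sg (sg + 2) 2 _ F (fun=> 1) (fun i => (tau i)^-1) 4) => // i.
  by rewrite invr_ge0 ltW.
move=> k.
rewrite -exprMn !expr2.
have cj0 : 0 <= cnorm (vphi ('i * (tau i)%:C * (2 * c i ^+ 2 + freq_sq k / 2)%:C)) * jb k.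
  by rewrite mulr_ge0 ?cnorm_ge0 ?(ltW (jb_gt0 _)).
suff : cnorm (vphi ('i * (tau i)%:C * (2 * c i ^+ 2 + freq_sq k / 2)%:C)) * jb k <= 4 / tau i.
  by move=> h; apply: ler_pM.
have jb0 := jb_gt0 k : 0 < jb k :> R.
apply: (le_trans (ler_wpM2r (ltW jb0) (P_bound i k hv))).
have c20 : 1 <= c i ^+ 2 by rewrite exprn_ege1// c_ge1.
have y0 : jb k / 2 <= 2 * c i ^+ 2 + freq_sq k / 2 by rewrite /jb; lra.
have y1 : 0 < 2 * c i ^+ 2 + freq_sq k / 2 by apply: lt_le_trans y0; rewrite divr_gt0.
have t2 := @two_div_le _ (tau i) _ (jb k / 4) (ht0 i) (divr_gt0 jb0 (ltr0n _ 4)).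
apply: le_trans (ler_wpM2r (ltW jb0) (t2 _ _)) _; first by rewrite /jb in y0 *; lra.
rewrite le_eqVlt; apply/orP; left; apply/eqP; field.
by rewrite !gt_eqF.
Qed.

Lemma jb_ge_sqrt k : Num.sqrt (freq_sq k) ^+ 2 <= jb k :> R.
Proof. by rewrite sqr_sqrtr ?freq_sq_ge0// lerDr. Qed.

Lemma bndO_Q_gain sg vphi (l : int) F : decays vphi -> l <= -2 -> d%:R / 2 < sg + 1 ->
  bndO sg F c -> bndO (sg + 1) (fun i => opQ vphi l i (F i)) (fun i => (tau i)^-1).
Proof.
move=> hv hl hs hF.
have h0 i : 0 <= (tau i * c i)^-1 by rewrite invr_ge0 mulr_ge0 ?ltW ?c_gt0.
apply: (@bndO_le _ _ _ _ _ (fun i => (tau i * c i)^-1 * c i) (fun i => (tau i)^-1) 1) => //.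
  move=> i; rewrite mul1r le_eqVlt; apply/orP; left; apply/eqP; field.
  by rewrite !gt_eqF// c_gt0.
apply: (@bndO_fm_gain _ _ _ sg (sg + 1) 1 _ F c (fun i => (tau i * c i)^-1) 2) => // i k.
have c0 := c_gt0 i; have t0 := ht0 i.
rewrite expr1.
have b0 : 0 < bracket (c i) k by apply: lt_le_trans c0 (bracket_ge k c0).
have h1 : cnorm (vphi ('i * (tau i)%:C * (l%:~R * c i ^+ 2 - symA (c i) k)%:C)) <=
    2 / (tau i * (c i * bracket (c i) k)).
  apply: le_trans (Q_bound i k hv hl) _; rewrite ler_wpM2l//.
  have p1 : 0 < tau i * (c i * bracket (c i) k) by rewrite !mulr_gt0.
  rewrite lef_pV2 ?posrE//.
    by rewrite ler_pM2l// /symA; have := sqr_ge0 (c i); lra.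
  apply: lt_le_trans p1 _; rewrite ler_pM2l// /symA; have := sqr_ge0 (c i); lra.
have jbb : jb k <= bracket (c i) k ^+ 2.
  by rewrite bracket_sqr /jb addrC lerD2l exprn_ege1// c_ge1.
apply: (@le_trans _ _ ((2 / (tau i * (c i * bracket (c i) k))) ^+ 2 * bracket (c i) k ^+ 2)).
  apply: ler_pM => //; rewrite ?sqr_ge0 ?(ltW (jb_gt0 _))//.
  by rewrite !expr2; apply: ler_pM; rewrite ?cnorm_ge0.
rewrite -exprMn le_eqVlt; apply/orP; left; apply/eqP; congr (_ ^+ 2); field.
by rewrite !gt_eqF.
Qed.

Lemma bndO_A_lose2 sg F : d%:R / 2 < sg ->
  bndO (sg + 2) F (fun=> 1) -> bndO sg (fun i => opA (c i) (F i)) (fun=> 1).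
Proof.
move=> hs hF; apply: (@bndO_le _ _ _ _ _ (fun i => 1 * 1) _ 1) => //.
apply: (@bndO_fm_lose _ _ _ sg (sg + 2) 2 _ F (fun=> 1) (fun=> 1) 1) => // i k.
rewrite mulr1 expr1n mul1r cnorm_real real_normK ?num_real// !expr2.
have A0 := symA_ge0 k (c_gt0 i); have A1 := symA_le k (c_gt0 i).
have q0 := freq_sq_ge0 k : 0 <= freq_sq k :> R.
by apply: ler_pM => //; rewrite /jb; lra.
Qed.

Lemma bndO_A_lose1 sg F : d%:R / 2 < sg ->
  bndO (sg + 1) F (fun=> 1) -> bndO sg (fun i => opA (c i) (F i)) c.
Proof.
move=> hs hF; apply: (@bndO_le _ _ _ _ _ (fun i => c i * 1) c 1) => //.
  by move=> i; rewrite mulr1 mul1r.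
apply: (@bndO_fm_lose _ _ _ sg (sg + 1) 1 _ F (fun=> 1) c 1) => // i.
  exact: ltW (c_gt0 i).
move=> k; rewrite mul1r expr1 cnorm_real real_normK ?num_real//.
have A0 := symA_ge0 k (c_gt0 i); have A1 := symA_le_freq k (c_gt0 i).
apply: (@le_trans _ _ ((c i * Num.sqrt (freq_sq k)) ^+ 2)).
  by rewrite !expr2; apply: ler_pM.
by rewrite exprMn ler_wpM2l ?sqr_ge0// jb_ge_sqrt.
Qed.

Lemma bndO_D_lose2 sg F : d%:R / 2 < sg ->
  bndO (sg + 2) F (fun=> 1) ->
  bndO sg (fun i => fmult (fun k => (- (freq_sq k / 2) - symA (c i) k)%:C) (F i)) (fun=> 1).
Proof.
move=> hs hF; apply: (@bndO_le _ _ _ _ _ (fun i => 1 * 1) _ 1) => //.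
apply: (@bndO_fm_lose _ _ _ sg (sg + 2) 2 _ F (fun=> 1) (fun=> 1) 1) => // i k.
rewrite mulr1 expr1n mul1r cnorm_real real_normK ?num_real// -sqrrN !expr2.
have A0 := symA_ge0 k (c_gt0 i); have A1 := symA_le k (c_gt0 i).
have q0 := freq_sq_ge0 k : 0 <= freq_sq k :> R.
by apply: ler_pM; rewrite /jb; lra.
Qed.

Lemma bndO_opB1_same sg F : d%:R / 2 < sg ->
  bndO sg F (fun=> 1) -> bndO sg (fun i => opB1 (c i) (F i)) (fun=> 1).
Proof.
move=> hs; apply: bndO_fm1 => // i k.
by rewrite cnorm_real; exact: cB1_le1 (c_gt0 i).
Qed.

Lemma bndO_opB1_lose sg F : d%:R / 2 < sg -> bndO (sg + 1) F (fun=> 1) ->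
  bndO sg (fun i => opB1 (c i) (F i)) (fun i => (c i)^-1).
Proof.
move=> hs hF; apply: (@bndO_le _ _ _ _ _ (fun i => (c i)^-1 * 1) _ 1) => //.
  by move=> i; rewrite mulr1 mul1r.
apply: (@bndO_fm_lose _ _ _ sg (sg + 1) 1 _ F (fun=> 1) (fun i => (c i)^-1) 1) => // i.
  by rewrite invr_ge0 ltW// c_gt0.
move=> k; rewrite mul1r expr1 cnorm_real real_normK ?num_real//.
apply: (@le_trans _ _ ((Num.sqrt (freq_sq k) / c i) ^+ 2)).
  rewrite -[leLHS]real_normK ?num_real// !expr2.
  by apply: ler_pM => //; exact: cB1_le (c_gt0 i).
by rewrite exprMn mulrC ler_wpM2l ?sqr_ge0// jb_ge_sqrt.
Qed.

End Operators.

(** * The residual of one step *)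

Section ResidualDef.
Context {R : realType} {d : nat}.
Implicit Types (c tau tn : R) (u : 'rV[R]_d -> R[i]).

Definition residual c tau tn u : 'rV[R]_d -> R[i] := fun x =>
  let t : R[i] := tau%:C in
  let U := opE c (tau / 2) u in
  let vt := vartheta c tn tau u in
  - (t * (3 * 'i / 8)
    * opB1 c (opE c (tau / 2) (fun y => `|U y| ^+ 2 * U y)) x)
  + t ^+ 2 * theta c tau U x
  - t ^+ 2 * (3 / 64)
    * opB c (fun y => 2 * `|u y| ^+ 2 * opB c vt y
                      - u y ^+ 2 * opB c (fun y' => (vt y')^*) y) x
  - 'i / 8 * opB c (I1 c tau tn u) x.

Lemma scheme_stepE c tau tn u x : scheme_step c tau tn u x =
  opE c (tau / 2) (nl_phase tau (opE c (tau / 2) u)) x + residual c tau tn u x.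
Proof. by rewrite /scheme_step /residual !addrA. Qed.

End ResidualDef.

Section Residual.
Context {R : realType} {d : nat} {I : Type} (tau c tn : I -> R)
  (w : I -> 'rV[R]_d -> R[i]).
Context (ht0 : forall i, 0 < tau i) (ht1 : forall i, tau i <= 1)
  (hc : forall i, 1 <= tau i * c i).
Context (r : R) (hr : d%:R / 2 < r).
Context (hw : bndO (r + 3) w (fun=> 1)).

Let c0 := c_gt0 ht0 hc.
Let c1 := c_ge1 ht0 ht1 hc.
Let alpha := alpha tau c.

Let hr3 : d%:R / 2 < r + 3.
Proof. by rewrite ltr_wpDr. Qed.

Let hr1 : d%:R / 2 < r + 1.
Proof. by rewrite ltr_wpDr. Qed.

Lemma bndO_vartheta : bndO (r + 3) (fun i => vartheta (c i) (tn i) (tau i) (w i)) alpha.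
Proof.
have E (l : int) i : l != 0 ->
   cnorm ((varphi1 (l%:~R * ('i * (c i ^+ 2)%:C) * (tau i)%:C) - 1) /
     (l%:~R * ('i * (c i ^+ 2)%:C) * (tau i)%:C)) <= 2 * alpha i.
  move=> l0; rewrite cnormM; apply: ler_pM; rewrite ?cnorm_ge0//.
    apply: le_trans (le_cnormB _ _) _; rewrite cnorm1.
    by have := varphi1_osc l (c i) (tau i); lra.
  exact: inv_osc.
have T (a : I -> R[i]) B (F : I -> 'rV[R]_d -> R[i]) : 0 <= B -> (forall i, cnorm (a i) <= B * alpha i) ->
    bndO (r + 3) F (fun=> 1) -> bndO (r + 3) (fun i x => a i * F i x) alpha.
  move=> B0 aB hF; apply: (@bndO_le _ _ _ _ _ (fun i => alpha i * 1) _ 1) => //.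
    by move=> i; rewrite mulr1 mul1r.
  exact: bndO_Z B0 aB hF.
rewrite /vartheta; cbv zeta.
have p2 : (2 : R[i]) = (2 : int)%:~R by [].
have n2 : (- 2 : R[i]) = (- 2 : int)%:~R by [].
have n4 : (- 4 : R[i]) = (- 4 : int)%:~R by [].
rewrite n2 n4 p2.
apply: bndO_D; [apply: bndO_D|].
- apply: (T _ 2) => // [i|]; last exact: bndO_X.
  by rewrite cnormM cnorm_osc mul1r E.
- apply: (T _ 6) => // [i|].
    rewrite cnormM (cnormM 3) cnorm_osc mulr1.
    have := E (-2) i isT; rewrite (_ : cnorm 3 = 3); first by lra.
    by rewrite -(rmorph_nat (real_complex R)) cnorm_real ger0_norm.
  by apply: bndO_M1 => //; [exact: bndO_norm2|exact: bndO_J].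
- apply: (T _ 2) => // [i|]; last by apply: bndO_X => //; exact: bndO_J.
  by rewrite cnormM cnorm_osc mul1r E.
Qed.

Lemma bndO_Omega (l : int) : bndO (r + 3) (fun i => Omega (c i) l (tn i) (tau i) (w i)) alpha.
Proof.
have E (l1 l2 l3 : int) i : l3 != 0 ->
   cnorm ((varphi1 (l1%:~R * ('i * (c i ^+ 2)%:C) * (tau i)%:C) -
      varphi1 (l2%:~R * ('i * (c i ^+ 2)%:C) * (tau i)%:C)) /
     (l3%:~R * ('i * (c i ^+ 2)%:C) * (tau i)%:C)) <= 2 * alpha i.
  move=> l0; rewrite cnormM; apply: ler_pM; rewrite ?cnorm_ge0//.
    apply: le_trans (le_cnormB _ _) _.
    by have := varphi1_osc l1 (c i) (tau i); have := varphi1_osc l2 (c i) (tau i); lra.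
  exact: inv_osc.
have T (a : I -> R[i]) B (F : I -> 'rV[R]_d -> R[i]) : 0 <= B -> (forall i, cnorm (a i) <= B * alpha i) ->
    bndO (r + 3) F (fun=> 1) -> bndO (r + 3) (fun i x => a i * F i x) alpha.
  move=> B0 aB hF; apply: (@bndO_le _ _ _ _ _ (fun i => alpha i * 1) _ 1) => //.
    by move=> i; rewrite mulr1 mul1r.
  exact: bndO_Z B0 aB hF.
rewrite /Omega; cbv zeta.
have p2 : (2 : R[i]) = (2 : int)%:~R by [].
have n2 : (- 2 : R[i]) = (- 2 : int)%:~R by [].
have n4 : (- 4 : R[i]) = (- 4 : int)%:~R by [].
rewrite n2 n4 p2.
apply: bndO_D; [apply: bndO_D|].
- apply: (T _ 2) => // [i|]; last exact: bndO_X.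
  by rewrite cnormM cnorm_osc mul1r E.
- apply: (T _ 6) => // [i|].
    rewrite cnormM (cnormM 3) cnorm_osc mulr1.
    have := E (l - 2) l (-2) i isT; rewrite (_ : cnorm 3 = 3); first by lra.
    by rewrite -(rmorph_nat (real_complex R)) cnorm_real ger0_norm.
  by apply: bndO_M1 => //; [exact: bndO_norm2|exact: bndO_J].
- apply: (T _ 2) => // [i|]; last by apply: bndO_X => //; exact: bndO_J.
  by rewrite cnormM cnorm_osc mul1r E.
Qed.

(* [(sg, sgQ, eps, gA)] is [(r + 3, r + 2, 1, c)] for the stability of the scheme and
   [(r, r + 1, c^-1, 1)] for its local error. *)
Context (sg sgQ : R) (eps gA : I -> R) (hsg : d%:R / 2 < sg) (hsg3 : sg <= r + 3)
  (hsgQ : d%:R / 2 < sgQ) (hsgQ3 : sgQ <= r + 3) (he : forall i, (c i)^-1 <= eps i).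
Context (hB1 : forall F : I -> 'rV[R]_d -> R[i], bndO (r + 3) F (fun=> 1) ->
    bndO sg (fun i => opB1 (c i) (F i)) eps)
  (hP2 : forall F : I -> 'rV[R]_d -> R[i], bndO (r + 1) F (fun=> 1) ->
    bndO sg (fun i => opP tau c varphi2 i (F i)) (fun i => eps i / tau i))
  (hA : forall F : I -> 'rV[R]_d -> R[i], bndO (r + 3) F (fun=> 1) ->
    bndO sgQ (fun i => opA (c i) (F i)) gA)
  (hQ2 : forall (l : int) (F : I -> 'rV[R]_d -> R[i]), l <= -2 -> bndO sgQ F gA ->
    bndO sg (fun i => opQ tau c varphi2 l i (F i)) (fun i => eps i / tau i)).

Let target i := tau i * eps i.

Let e3 : r + 3 = r + 1 + 2.
Proof. by ring. Qed.

Lemma target_alpha i : tau i * alpha i <= target i.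
Proof.
apply: (@le_trans _ _ (tau i * (c i)^-1)); last by rewrite ler_pM2l.
rewrite ler_pM2l// lef_pV2 ?posrE ?mulr_gt0 ?exprn_gt0//.
by rewrite expr2 mulrA ler_peMl// ltW.
Qed.

Lemma bndO_target_alpha (a : I -> R[i]) B (F : I -> 'rV[R]_d -> R[i]) : 0 <= B -> (forall i, cnorm (a i) <= B * tau i) ->
  bndO (r + 3) F alpha -> bndO sg (fun i x => a i * F i x) target.
Proof.
move=> B0 aB hF; apply: (@bndO_le _ _ _ _ _ (fun i => tau i * alpha i) _ 1) => //.
  by move=> i; rewrite mul1r target_alpha.
by apply: bndO_weaken hsg3 _; exact: bndO_Z B0 aB hF.
Qed.

Lemma bndO_target_eps (a : I -> R[i]) B (F : I -> 'rV[R]_d -> R[i]) : 0 <= B -> (forall i, cnorm (a i) <= B * tau i) ->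
  bndO sg F eps -> bndO sg (fun i x => a i * F i x) target.
Proof. by move=> B0 aB hF; exact: bndO_Z B0 aB hF. Qed.

Lemma bndO_target_phi2 (a : I -> R[i]) B (F : I -> 'rV[R]_d -> R[i]) : 0 <= B -> (forall i, cnorm (a i) <= B * tau i ^+ 2) ->
  bndO sg F (fun i => eps i / tau i) -> bndO sg (fun i x => a i * F i x) target.
Proof.
move=> B0 aB hF; apply: (@bndO_le _ _ _ _ _ (fun i => tau i ^+ 2 * (eps i / tau i)) _ 1) => //.
  move=> i; rewrite mul1r le_eqVlt; apply/orP; left; apply/eqP; rewrite /target; field.
  by rewrite gt_eqF.
exact: bndO_Z B0 aB hF.
Qed.

Lemma cnorm_tau i : cnorm (tau i)%:C = tau i.
Proof. by rewrite cnorm_real gtr0_norm. Qed.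

Lemma tau2_le i : tau i ^+ 2 <= tau i.
Proof. by rewrite expr2 ler_piMl// ltW. Qed.

Let hwJ : bndO (r + 3) (fun i x => (w i x)^*) (fun=> 1).
Proof. exact: bndO_J. Qed.

Lemma bndO_theta (U : I -> 'rV[R]_d -> R[i]) : bndO (r + 3) U (fun=> 1) ->
  bndO sg (fun i => theta (c i) (tau i) (U i)) eps.
Proof.
move=> hU; have hUs : bndO sg U (fun=> 1) by exact: bndO_weaken hU.
rewrite /theta.
have n2 := bndO_norm2 hr3 hU.
have h1 : bndO (r + 3) (fun i y => `|U i y| ^+ 4 * U i y) (fun=> 1).
  apply: bndO_M1 => //.
  have -> : (fun i y => `|U i y| ^+ 4) = (fun i y => (`|U i y| ^+ 2) ^+ 2).
    by apply/funext => i; apply/funext => y; rewrite -exprM.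
  exact: bndO_X.
have h2 : bndO (r + 3) (fun i y => `|U i y| ^+ 2 * U i y) (fun=> 1) by exact: bndO_M1.
have h3 : bndO (r + 3) (fun i y => `|U i y| ^+ 2 * (U i y)^*) (fun=> 1).
  by apply: bndO_M1 => //; exact: bndO_J.
apply: bndO_D; [apply: bndO_B|].
- apply: (bndO_Zc (- (1 / 2) * (9 / 64))).
  by apply: bndO_opE => //; exact: hB1.
- apply: (bndO_Zc (1 / 2 * (9 / 32))).
  apply: bndO_opB => //; apply: bndO_opE => //; apply: bndO_M1 => //; first exact: bndO_norm2.
  exact: hB1.
- apply: (bndO_Zc (1 / 2 * (9 / 64))).
  apply: bndO_opB => //; apply: bndO_opE => //; apply: bndO_M1 => //; first exact: bndO_X.
  exact: hB1.
Qed.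

Lemma bndO_target_mul (a : I -> R[i]) B (W G : I -> 'rV[R]_d -> R[i]) : 0 <= B ->
  (forall i, cnorm (a i) <= B * tau i) ->
  bndO (r + 3) W (fun=> 1) -> bndO (r + 3) G alpha ->
  bndO sg (fun i x => a i * W i x * G i x) target.
Proof.
move=> B0 aB hW hG; apply: (@bndO_le _ _ _ _ _ (fun i => tau i * 1 * alpha i) _ 1) => //.
  by move=> i; rewrite mul1r mulr1 target_alpha.
apply: bndO_weaken hsg3 _; apply: bndO_M => //.
exact: bndO_Z B0 aB hW.
Qed.

Lemma bndO_phi2 (l : int) (F : I -> 'rV[R]_d -> R[i]) : l != 0 ->
  bndO (r + 3) F (fun=> 1) ->
  bndO (r + 3) (fun i x => 3 * varphi2 (l%:~R * ('i * (c i ^+ 2)%:C) * (tau i)%:C) * F i x) alpha.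
Proof.
move=> l0 hF; apply: (@bndO_le _ _ _ _ _ (fun i => alpha i * 1) _ 1) => //.
  by move=> i; rewrite mulr1 mul1r.
apply: (@bndO_Z _ _ _ _ F (fun=> 1) alpha _ (cnorm (3 : R[i]) * 2)) => //.
  by rewrite mulr_ge0 ?cnorm_ge0.
by move=> i; rewrite cnormM -[leRHS]mulrA ler_wpM2l ?cnorm_ge0// varphi2_osc.
Qed.

Let hr1sg (F : I -> 'rV[R]_d -> R[i]) : bndO (r + 3) F (fun=> 1) -> bndO (r + 1) F (fun=> 1).
Proof. by apply: bndO_weaken; lra. Qed.

Let hQsg (F : I -> 'rV[R]_d -> R[i]) : bndO (r + 3) F (fun=> 1) -> bndO sgQ F (fun=> 1).
Proof. exact: bndO_weaken. Qed.

Lemma bndO_I1 : bndO sg (fun i => I1 (c i) (tau i) (tn i) (w i)) target.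
Proof.
have hw3 : bndO (r + 3) (fun i y => w i y ^+ 3) (fun=> 1) by exact: bndO_X.
have hw2 : bndO (r + 3) (fun i y => w i y ^+ 2) (fun=> 1) by exact: bndO_X.
have hJ3 : bndO (r + 3) (fun i y => (w i y)^* ^+ 3) (fun=> 1) by exact: bndO_X.
have hJ2 : bndO (r + 3) (fun i y => (w i y)^* ^+ 2) (fun=> 1) by exact: bndO_X.
have hn2 : bndO (r + 3) (fun i y => `|w i y| ^+ 2) (fun=> 1) by exact: bndO_norm2.
have hn2w : bndO (r + 3) (fun i y => `|w i y| ^+ 2 * w i y) (fun=> 1) by exact: bndO_M1.
have hn2J : bndO (r + 3) (fun i y => `|w i y| ^+ 2 * (w i y)^*) (fun=> 1) by exact: bndO_M1.
have hP1 := bndO_P_alpha ht0 hc (@varphi1_le R) hr3 hw3.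
have hE (F : I -> 'rV[R]_d -> R[i]) : bndO (r + 3) F alpha -> bndO (r + 3) (fun i => opE (c i) (tau i) (F i)) alpha.
  by move=> hF; exact: bndO_opE.
have hEs (F : I -> 'rV[R]_d -> R[i]) g : bndO sg F g -> bndO sg (fun i => opE (c i) (tau i) (F i)) g.
  by move=> hF; exact: bndO_opE.
have a1 (z : R[i]) (l : int) i : cnorm (z * (tau i)%:C *
    cexp (l%:~R * ('i * (c i ^+ 2)%:C) * (tn i)%:C)) <= cnorm z * tau i.
  by rewrite cnormM cnorm_osc mulr1 cnormM cnorm_tau.
have a2 (z : R[i]) (l : int) i : cnorm (z * (tau i)%:C ^+ 2 *
    cexp (l%:~R * ('i * (c i ^+ 2)%:C) * (tn i)%:C)) <= cnorm z * tau i ^+ 2.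
  by rewrite cnormM cnorm_osc mulr1 cnormM cnormX cnorm_tau.
have a3 (z : R[i]) (l : int) i : cnorm ((tau i)%:C ^+ 2 * z *
    cexp (l%:~R * ('i * (c i ^+ 2)%:C) * (tn i)%:C)) <= cnorm z * tau i.
  rewrite cnormM cnorm_osc mulr1 cnormM cnormX cnorm_tau mulrC ler_wpM2l ?cnorm_ge0//.
  exact: tau2_le.
have a0 (l : int) i : cnorm ((tau i)%:C *
    cexp (l%:~R * ('i * (c i ^+ 2)%:C) * (tn i)%:C)) <= 1 * tau i.
  by rewrite cnormM cnorm_osc mulr1 cnorm_tau mul1r.
have N3 : 0 <= cnorm (3 : R[i]) by exact: cnorm_ge0.
have Ni : 0 <= cnorm ('i : R[i]) by exact: cnorm_ge0.
rewrite /I1; cbv zeta.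
apply: bndO_D; [apply: bndO_D; [apply: bndO_B; [apply: bndO_B; [apply: bndO_B;
  [apply: bndO_D; [apply: bndO_D; [apply: bndO_D; [apply: bndO_D|]|]|]|]|]|]|]|].
- apply: (bndO_target_alpha ler01 (a0 2)); apply: hE; exact: hP1.
- apply: (bndO_target_phi2 Ni (a2 'i 2)); apply: hEs.
  apply: (hP2 (F := fun i y => fmult (fun k => (- (freq_sq k / 2) - symA (c i) k)%:C)
     (fun y' => w i y' ^+ 3) y + 3 * w i y ^+ 2 * opA (c i) (w i) y)).
  apply: bndO_D.
    by apply: (bndO_D_lose2 ht0 hc hr1); rewrite -e3.
  apply: bndO_M1 => //; first by apply: bndO_Zc; exact: hr1sg.
  by apply: (bndO_A_lose2 ht0 hc hr1); rewrite -e3.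
- apply: (bndO_target_alpha N3 (a1 3 (-2))); apply: hE.
  exact: (@bndO_Q_alpha _ _ _ _ _ ht0 hc _ _ (-2) _ (@varphi1_le R) _ hr3 hn2J).
- apply: (bndO_target_phi2 (cnorm_ge0 _) (a2 (3 * 'i) (-2))); apply: hEs.
  apply: (hQ2 (F := fun i y => (w i y)^* ^+ 2 * opA (c i) (w i) y -
    2 * `|w i y| ^+ 2 * opA (c i) (fun y => (w i y)^* ) y) (l := -2)) => //.
  apply: bndO_B.
    by apply: bndO_M1 => //; [exact: hQsg|exact: hA].
  apply: bndO_M1 => //; first by apply: bndO_Zc; exact: hQsg.
  exact: hA.
- apply: (bndO_target_alpha ler01 (a0 (-4))); apply: hE.
  exact: (@bndO_Q_alpha _ _ _ _ _ ht0 hc _ _ (-4) _ (@varphi1_le R) _ hr3 hJ3).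
- apply: (bndO_target_phi2 Ni (a2 'i (-4))); apply: hEs.
  apply: (hQ2 (F := fun i y => 3 * (w i y)^* ^+ 2 * opA (c i) (fun y => (w i y)^* ) y) (l := -4)) => //.
  apply: bndO_M1 => //; first by apply: bndO_Zc; exact: hQsg.
  exact: hA.
- apply: (bndO_target_mul (cnorm_ge0 _) (a3 (3 * 'i / 8) 2) hw2).
  apply: bndO_opB => //; apply: bndO_D; last exact: bndO_Omega.
  exact: (@bndO_phi2 2 _ isT hn2w).
- apply: (bndO_target_mul (cnorm_ge0 _) (a3 (3 * 'i / 8) (-2)) hJ2).
  apply: bndO_opB => //; apply: bndO_D; last exact: bndO_Omega.
  exact: (@bndO_phi2 (-2) _ isT hn2w).
- apply: (bndO_target_mul (cnorm_ge0 _) (a3 (6 * 'i / 8) (-2)) hn2).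
  apply: bndO_opB => //; apply: bndO_D; last by apply: bndO_J; exact: bndO_Omega.
  exact: (@bndO_phi2 (-2) _ isT hn2J).
- apply: (bndO_target_mul (cnorm_ge0 _) (a3 (3 * 'i / 8) (-4)) hJ2).
  apply: bndO_opB => //; apply: bndO_D; last by apply: bndO_J; exact: bndO_Omega.
  exact: (@bndO_phi2 (-4) _ isT hn2J).
Qed.

Lemma bndO_residual : bndO sg (fun i => residual (c i) (tau i) (tn i) (w i)) target.
Proof.
have hU : bndO (r + 3) (fun i => opE (c i) (tau i / 2) (w i)) (fun=> 1) by exact: bndO_opE.
rewrite /residual; cbv zeta.
apply: bndO_B; [apply: bndO_B; [apply: bndO_D|]|].
- apply: bndO_N; apply: (@bndO_target_eps _ (cnorm (3 * 'i / 8 : R[i]))); first exact: cnorm_ge0.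
    by move=> i; rewrite cnormM cnorm_tau mulrC.
  apply: hB1; apply: bndO_opE => //; apply: bndO_M1 => //; exact: bndO_norm2.
- apply: (@bndO_target_eps _ 1) => //; last exact: bndO_theta.
  by move=> i; rewrite cnormX cnorm_tau mul1r tau2_le.
- apply: (@bndO_target_alpha _ (cnorm (3 / 64 : R[i]))); first exact: cnorm_ge0.
    by move=> i; rewrite cnormM cnormX cnorm_tau mulrC ler_wpM2l ?cnorm_ge0// tau2_le.
  apply: bndO_opB => //; apply: bndO_B.
    apply: bndO_M1 => //; first by apply: bndO_Zc; exact: bndO_norm2.
    by apply: bndO_opB => //; exact: bndO_vartheta.
  apply: bndO_M1 => //; first exact: bndO_X.
  by apply: bndO_opB => //; apply: bndO_J; exact: bndO_vartheta.
- by apply: bndO_Zc; apply: bndO_opB => //; exact: bndO_I1.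
Qed.

End Residual.

Section StepBounds.
Context {R : realType} {d : nat}.
Implicit Types (u v : 'rV[R]_d -> R[i]) (sg : R).

Lemma residual_bounds (r : R) (L : R) : d%:R / 2 < r -> 0 <= L -> exists2 P, 0 <= P &
  forall tau c tn w, 0 < tau -> tau <= 1 -> 1 <= tau * c ->
    bnd (r + 3) (w : 'rV[R]_d -> R[i]) L ->
    bnd (r + 3) (residual c tau tn w) (P * tau) /\
    bnd r (residual c tau tn w) (P * (tau * c^-1)).
Proof.
move=> hr L0.
pose I := {p : (R * R * R) * ('rV[R]_d -> R[i]) |
  [/\ 0 < p.1.1.1, p.1.1.1 <= 1, 1 <= p.1.1.1 * p.1.1.2 & bnd (r + 3) p.2 L]}.
pose tau (i : I) := (sval i).1.1.1.
pose c (i : I) := (sval i).1.1.2.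
pose tn (i : I) := (sval i).1.2.
pose w (i : I) := (sval i).2.
have ht0 i : 0 < tau i by case: (svalP i).
have ht1 i : tau i <= 1 by case: (svalP i).
have hc i : 1 <= tau i * c i by case: (svalP i).
have hw : bndO (r + 3) w (fun=> 1).
  by exists L => // i; rewrite mulr1; case: (svalP i).
have hr3 : d%:R / 2 < r + 3 by rewrite ltr_wpDr.
have hr2 : d%:R / 2 < r + 2 by rewrite ltr_wpDr.
have hr1 : d%:R / 2 < r + 1 by rewrite ltr_wpDr.
have e12 : r + 1 + 2 = r + 3 by ring.
have e21 : r + 2 + 1 = r + 3 by ring.
have c0 i := c_gt0 ht0 hc i.
have c1 i := c_ge1 ht0 ht1 hc i.
have [P1 P10 h1] : bndO (r + 3) (fun i => residual (c i) (tau i) (tn i) (w i)) tau.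
  apply: (@bndO_le _ _ _ _ _ (fun i => tau i * 1) _ 1) => //; first by move=> i; rewrite mulr1 mul1r.
  apply: (@bndO_residual _ _ _ tau c tn w ht0 ht1 hc r hr hw (r + 3) (r + 2) (fun=> 1) c) => //.
  - by lra.
  - by move=> i; rewrite invf_le1.
  - by move=> F hF; exact: (bndO_opB1_same ht0 hc hr3).
  - move=> F hF; rewrite -e12; under [X in bndO _ _ X]eq_fun do rewrite div1r.
    by apply: (bndO_P_gain ht0 ht1 hc (@varphi2_le R)) => //; rewrite e12.
  - by move=> F hF; apply: (bndO_A_lose1 ht0 hc hr2); rewrite e21.
  - move=> l F hl hF; rewrite -e21; under [X in bndO _ _ X]eq_fun do rewrite div1r.
    by apply: (bndO_Q_gain ht0 ht1 hc (@varphi2_le R) hl) => //; rewrite e21.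
have halpha i : alpha tau c i <= 1 * ((c i)^-1 / tau i).
  rewrite mul1r /alpha -invfM lef_pV2 ?posrE ?mulr_gt0 ?exprn_gt0//.
  by rewrite mulrC ler_pM2l// expr2 ler_peMl// ltW.
have [P2 P20 h2] : bndO r (fun i => residual (c i) (tau i) (tn i) (w i)) (fun i => tau i * (c i)^-1).
  apply: (@bndO_residual _ _ _ tau c tn w ht0 ht1 hc r hr hw r (r + 1) (fun i => (c i)^-1) (fun=> 1)) => //.
  - by lra.
  - by lra.
  - move=> F hF; apply: (bndO_opB1_lose ht0 hc hr); apply: bndO_weaken hF; lra.
  - move=> F hF; apply: (bndO_le ler01 halpha).
    apply: (bndO_P_alpha ht0 hc (@varphi2_le R) hr); apply: bndO_weaken hF; lra.
  - by move=> F hF; apply: (bndO_A_lose2 ht0 hc hr1); rewrite e12.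
  - move=> l F hl hF; apply: (bndO_le ler01 halpha).
    apply: (bndO_Q_alpha ht0 hc (@varphi2_le R) hl hr); apply: bndO_weaken hF; lra.
exists (P1 + P2); first exact: addr_ge0.
move=> tau' c' tn' w' t0 t1 ct hw'.
pose i : I := exist _ ((tau', c', tn'), w') (And4 t0 t1 ct hw').
have c'0 : 0 < c' by exact: (c0 i).
split.
  by apply: bnd_le (h1 i); rewrite ler_wpM2r ?(ltW t0)// lerDl.
by apply: bnd_le (h2 i); rewrite ler_wpM2r ?mulr_ge0 ?invr_ge0 ?(ltW t0) ?(ltW c'0)// lerDr.
Qed.

Lemma bnd_fmult1 sg u M (m : 'rV[int]_d -> R[i]) : d%:R / 2 < sg ->
  (forall k, cnorm (m k) <= 1) -> bnd sg u M ->
  bnd sg (fmult m u) M /\ forall k, fourier (fmult m u) k = m k * fourier u k.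
Proof.
move=> hs hm hu; rewrite -[M]mul1r; apply: fourier_fmult hs ler01 _ hu => k.
rewrite expr1n mul1r -[leRHS]mulr1 ler_wpM2l ?(ltW (weight_gt0 _ _))//.
by rewrite exprn_ile1 ?cnorm_ge0.
Qed.

Lemma bnd_opE sg c s u M : d%:R / 2 < sg -> bnd sg u M -> bnd sg (opE c s u) M.
Proof.
by move=> hs hu; apply: (bnd_fmult1 hs _ hu).1 => k; rewrite cnorm_cexpI.
Qed.

Lemma bnd_opS sg s u M : d%:R / 2 < sg -> bnd sg u M -> bnd sg (opS s u) M.
Proof.
by move=> hs hu; apply: (bnd_fmult1 hs _ hu).1 => k; rewrite cnorm_cexpI.
Qed.

Lemma fmult1B sg u v M N (m : 'rV[int]_d -> R[i]) : d%:R / 2 < sg ->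
  (forall k, cnorm (m k) <= 1) -> bnd sg u M -> bnd sg v N ->
  (fun x => fmult m u x - fmult m v x) = fmult m (fun x => u x - v x).
Proof.
move=> hs hm hu hv.
have [[cu _] fu] := bnd_fmult1 hs hm hu.
have [[cv _] fv] := bnd_fmult1 hs hm hv.
have [[cw _] fw] := bnd_fmult1 hs hm (bndB hu hv).
apply: fourier_inj => // [|k]; first exact: tcB.
rewrite fw !fourierB ?fu ?fv ?mulrBr//; apply: tc_ccont => //.
  exact: hu.1.
exact: hv.1.
Qed.

Lemma bnd_opES (r c s : R) u M : d%:R / 2 < r -> 0 < c -> 0 <= s -> bnd (r + 3) u M ->
  bnd r (fun x => opE c s u x - opS s u x) (s * c^-1 * M).
Proof.
move=> hr c0 s0 hu.
have hr3 : d%:R / 2 < r + 3 by rewrite ltr_wpDr.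
set mE := fun k : 'rV[int]_d => cexp ('i * (s * symA c k)%:C).
set mS := fun k : 'rV[int]_d => cexp ('i * (s * (freq_sq k / 2))%:C).
have hE : forall k, cnorm (mE k) <= 1 by move=> k; rewrite cnorm_cexpI.
have hS : forall k, cnorm (mS k) <= 1 by move=> k; rewrite cnorm_cexpI.
have [[cE _] fE] := bnd_fmult1 hr3 hE hu.
have [[cS _] fS] := bnd_fmult1 hr3 hS hu.
have sc0 : 0 <= s * c^-1 by rewrite mulr_ge0 ?invr_ge0 ?(ltW c0).
have hm k : weight r k * cnorm (mE k - mS k) ^+ 2 <= (s * c^-1) ^+ 2 * weight (r + 3) k.
  rewrite weightD [leRHS]mulrCA ler_wpM2l ?(ltW (weight_gt0 _ _))//.
  have q0 := freq_sq_ge0 k : 0 <= freq_sq k :> R.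
  apply: (@le_trans _ _ ((s * (freq_sq k * Num.sqrt (freq_sq k) / c)) ^+ 2)).
    rewrite !expr2; have h : cnorm (mE k - mS k) <= s * (freq_sq k * Num.sqrt (freq_sq k) / c).
      apply: le_trans (cexpI_dist _ _) _; rewrite -mulrBr normrM ger0_norm//.
      by rewrite ler_wpM2l// symA_dist.
    by apply: ler_pM; rewrite ?cnorm_ge0.
  rewrite (_ : (s * _) ^+ 2 = (s * c^-1) ^+ 2 * (freq_sq k ^+ 2 * Num.sqrt (freq_sq k) ^+ 2)); last by ring.
  rewrite ler_wpM2l ?sqr_ge0// sqr_sqrtr// -exprSr.
  by rewrite lerXn2r ?nnegrE ?(ltW (jb_gt0 _))// lerDr.
have [hD fD] := fourier_fmult hr sc0 hm hu.
rewrite (_ : (fun _ => _) = fmult (fun k => mE k - mS k) u)//.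
apply: fourier_inj => [||k]; [exact: tcB|exact: hD.1|].
by rewrite fD fourierB ?mulrBl; [rewrite -fE -fS|exact: tc_ccont|exact: tc_ccont].
Qed.

End StepBounds.

(** * Convergence *)

Section Convergence.
Context {R : realType} {d : nat}.
Implicit Types (u v : 'rV[R]_d -> R[i]) (sg : R).

Lemma phase_bnd sg L : d%:R / 2 < sg -> 0 <= L -> exists2 P, 0 <= P &
  forall tau u, 0 <= tau <= 1 -> bnd sg u L ->
    bnd sg (fun x => nl_phase tau u x - u x) (tau * P).
Proof.
move=> hs L0; have [P P0 hP] := @phase_lip R d sg L hs L0.
exists (P * L); first exact: mulr_ge0.
move=> tau u t01 hu.
have h0 : bnd sg (fun _ : 'rV[R]_d => 0) L by apply: bnd_le (bnd0 _).
have hu0 : bnd sg (fun x => u x - 0) L by under eq_fun do rewrite subr0.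
have := hP tau u (fun=> 0) L t01 hu h0 hu0.
congr bnd; apply/funext => x.
by rewrite [nl_phase _ (fun=> 0) x]/nl_phase mulr0 !subr0.
Qed.

Lemma scheme_strang_dist (r M0 S0 k0 : R) : d%:R / 2 < r -> 0 <= M0 -> 0 <= S0 -> 0 <= k0 ->
  exists T K, 0 < T /\
  forall tau c (z0 z1 : 'rV[R]_d -> R) (phi gamma : 'rV[R]_d -> R[i]),
    0 < tau -> tau <= 1 -> 1 <= tau * c ->
    bnd (r + 3) (scheme c tau z0 z1 0) M0 -> bnd r (strang tau phi gamma 0) S0 ->
    bnd r (fun x => scheme c tau z0 z1 0 x - strang tau phi gamma 0 x) (k0 * c^-1) ->
  forall n, n%:R * tau <= T ->
    bnd r (fun x => scheme c tau z0 z1 n x - strang tau phi gamma n x) (c^-1 * K).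
Proof.
move=> hr M00 S00 k00.
have hr3 : d%:R / 2 < r + 3 by rewrite ltr_wpDr.
have rr3 : r <= r + 3 by lra.
set L := M0 + 1; set LS := S0 + 1.
have L0 : 0 <= L by rewrite addr_ge0.
have LS0 : 0 <= LS by rewrite addr_ge0.
have L60 : 0 <= L + LS by rewrite addr_ge0.
have [P1 P10 hres] := @residual_bounds R d r L hr L0.
have [P2 P20 hph3] := @phase_bnd (r + 3) L hr3 L0.
have [PS PS0 hphS] := @phase_bnd r LS hr LS0.
have [P6 P60 hlip] := @phase_lip R d r (L + LS) hr L60.
set PA := P1 + P2.
have PA0 : 0 <= PA by rewrite addr_ge0.
set Q := (L + P2) + L * (1 + P6) + P1.
have Q0 : 0 <= Q by rewrite /Q !addr_ge0// mulr_ge0// addr_ge0.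
have T0 : 0 < 1 + PA + PS by lra.
exists (1 + PA + PS)^-1, ((k0 + Q) * expR P6); split; first by rewrite invr_gt0.
move=> tau c z0 z1 phi gamma t0 t1 ct hU0 hV0 hE0.
have c0 : 0 < c by rewrite -(pmulr_rgt0 _ t0); exact: lt_le_trans ct.
have ci0 : 0 < c^-1 by rewrite invr_gt0.
have t01 : 0 <= tau <= 1 by rewrite (ltW t0).
have th0 : 0 <= tau / 2 by rewrite divr_ge0// ltW.
set U := scheme c tau z0 z1; set V := strang tau phi gamma.
suff main n : n%:R * tau <= (1 + PA + PS)^-1 ->
    [/\ bnd (r + 3) (U n) (M0 + n%:R * tau * PA), bnd r (V n) (S0 + n%:R * tau * PS) &
     bnd r (fun x => U n x - V n x) ((k0 + n%:R * tau * Q) * (1 + tau * P6) ^+ n * c^-1)].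
  move=> n hn; have [_ _] := main n hn; apply: bnd_le.
  rewrite mulrC ler_pM2l//.
  have nt1 : n%:R * tau <= 1.
    by apply: le_trans hn _; rewrite invf_le1//; lra.
  have nt0 : 0 <= n%:R * tau by rewrite mulr_ge0// ltW.
  apply: ler_pM.
  - by rewrite addr_ge0// mulr_ge0.
  - by rewrite exprn_ge0// addr_ge0// mulr_ge0// ltW.
  - by rewrite lerD2l ler_piMl.
  apply: (@le_trans _ _ (expR (tau * P6) ^+ n)).
    by rewrite lerXn2r ?nnegrE ?expR_ge0 ?expR_ge1Dx// addr_ge0// mulr_ge0// ltW.
  by rewrite -expRM_natl ler_expR mulrA ler_piMl.
elim: n => [|n IH] hn.
  by rewrite !mul0r !addr0 expr0 mulr1; split.
have hn' : n%:R * tau <= (1 + PA + PS)^-1.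
  by apply: le_trans hn; rewrite ler_wpM2r ?(ltW t0)// ler_nat.
have [hU hV hE] := IH hn'.
have nt0 : 0 <= n%:R * tau by rewrite mulr_ge0// ltW.
have ntA : n%:R * tau * PA <= 1.
  apply: (@le_trans _ _ ((1 + PA + PS)^-1 * (1 + PA + PS))); last by rewrite mulVf ?gt_eqF.
  by apply: ler_pM => //; lra.
have ntS : n%:R * tau * PS <= 1.
  apply: (@le_trans _ _ ((1 + PA + PS)^-1 * (1 + PA + PS))); last by rewrite mulVf ?gt_eqF.
  by apply: ler_pM => //; lra.
have hUL : bnd (r + 3) (U n) L by apply: bnd_le hU; rewrite /L lerD2l.
have hVL : bnd r (V n) LS by apply: bnd_le hV; rewrite /LS lerD2l.
set UE := opE c (tau / 2) (U n).
set VS := opS (tau / 2) (V n).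
have hUE : bnd (r + 3) UE L by exact: bnd_opE.
have hVS : bnd r VS LS by exact: bnd_opS.
have hres' := hres tau c (n%:R * tau) (U n) t0 t1 ct hUL.
have hgU := hph3 tau UE t01 hUE.
have hgV := hphS tau VS t01 hVS.
have US : U n.+1 = fun x => opE c (tau / 2) (nl_phase tau UE) x + residual c tau (n%:R * tau) (U n) x.
  by apply/funext => x; exact: scheme_stepE.
have VE : V n.+1 = opS (tau / 2) (nl_phase tau VS) by [].
have nS : n.+1%:R = n%:R + 1 :> R by rewrite -natr1.
have nlE w : nl_phase tau w = fun x => (nl_phase tau w x - w x) + w x :> R[i].
  by apply/funext => x; rewrite subrK.
split.
- rewrite US nS.
  have h1 : bnd (r + 3) (nl_phase tau UE) (tau * P2 + (M0 + n%:R * tau * PA)).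
    by rewrite nlE; apply: bndD => //; exact: bnd_opE.
  apply: bnd_le (bndD (bnd_opE c (tau / 2) hr3 h1) hres'.1).
  rewrite /PA le_eqVlt; apply/orP; left; apply/eqP; ring.
- rewrite VE nS.
  have h1 : bnd r (nl_phase tau VS) (tau * PS + (S0 + n%:R * tau * PS)).
    by rewrite nlE; apply: bndD => //; exact: bnd_opS.
  apply: bnd_le (bnd_opS (tau / 2) hr h1).
  rewrite le_eqVlt; apply/orP; left; apply/eqP; ring.
set En := (k0 + n%:R * tau * Q) * (1 + tau * P6) ^+ n * c^-1 in hE *.
have tc0 : 0 <= tau * c^-1 by rewrite mulr_ge0 ?ltW.
have tc2 M : 0 <= M -> tau / 2 * c^-1 * M <= tau * c^-1 * M.
  move=> M0'; rewrite ler_wpM2r// ler_wpM2r ?(ltW ci0)//; lra.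
have hUVn : bnd r (fun x => UE x - VS x) (tau * c^-1 * L + En).
  have hr_Un : bnd r (U n) L by exact: bnd_weaken hUL.
  have h1 := bnd_le (tc2 _ L0) (bnd_opES hr c0 th0 hUL).
  have h2 : bnd r (fun x => opS (tau / 2) (U n) x - opS (tau / 2) (V n) x) En.
    rewrite /opS (fmult1B hr _ hr_Un hVL); first exact: bnd_opS.
    by move=> k; rewrite cnorm_cexpI.
  have := bndD h1 h2; congr bnd; apply/funext => x.
  by rewrite addrA subrK.
have hr_UE : bnd r UE (L + LS).
  by apply: bnd_le (bnd_weaken rr3 hUE); rewrite lerDl.
have hr_VS : bnd r VS (L + LS) by apply: bnd_le hVS; rewrite lerDr.
have hg := hlip tau UE VS _ t01 hr_UE hr_VS hUVn.
have hnl : bnd r (fun x => nl_phase tau UE x - nl_phase tau VS x)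
    ((tau * c^-1 * L + En) * (1 + tau * P6)).
  have := bndD hUVn hg; rewrite (_ : (fun _ => _) = fun x => nl_phase tau UE x - nl_phase tau VS x).
    by apply: bnd_le; rewrite le_eqVlt; apply/orP; left; apply/eqP; ring.
  apply/funext => x; move: (nl_phase tau UE x) (UE x) (nl_phase tau VS x) (VS x).
  by move=> a1 a2 a3 a4; ring.
have hnlU : bnd (r + 3) (nl_phase tau UE) (L + P2).
  rewrite nlE; apply: bnd_le (bndD hgU hUE); rewrite addrC lerD2l ler_piMl//.
have hnlV : bnd r (nl_phase tau VS) (LS + PS).
  rewrite nlE; apply: bnd_le (bndD hgV hVS); rewrite addrC lerD2l ler_piMl//.
have h1 := bnd_le (tc2 _ (addr_ge0 L0 P20)) (bnd_opES hr c0 th0 hnlU).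
have h2 : bnd r (fun x => opS (tau / 2) (nl_phase tau UE) x - opS (tau / 2) (nl_phase tau VS) x)
    ((tau * c^-1 * L + En) * (1 + tau * P6)).
  rewrite /opS (fmult1B hr _ (bnd_weaken rr3 hnlU) hnlV); first exact: bnd_opS.
  by move=> k; rewrite cnorm_cexpI.
have := bndD (bndD h1 h2) hres'.2.
rewrite (_ : (fun _ => _) = fun x => U n.+1 x - V n.+1 x); last first.
  apply/funext => x; rewrite US VE.
  move: (opE c (tau / 2) (nl_phase tau UE) x) (opS (tau / 2) (nl_phase tau UE) x).
  move: (opS (tau / 2) (nl_phase tau VS) x) (residual c tau (n%:R * tau) (U n) x).
  by move=> a1 a2 a3 a4; ring.
apply: bnd_le.
have tP6 : 0 <= tau * P6 by rewrite mulr_ge0// ltW.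
have e1 : 1 <= (1 + tau * P6) ^+ n.+1 by rewrite exprn_ege1// lerDl.
have tcQ : tau * c^-1 * (L + P2) + tau * c^-1 * L * (1 + tau * P6) + P1 * (tau * c^-1) <=
    tau * c^-1 * Q.
  have : tau * c^-1 * L * (tau * P6) <= tau * c^-1 * L * P6.
    by apply: ler_wpM2l; [exact: mulr_ge0|rewrite ler_piMl].
  by rewrite /Q; move: (tau * c^-1) => y; lra.
have tcQ2 : tau * c^-1 * Q <= tau * c^-1 * Q * (1 + tau * P6) ^+ n.+1.
  by rewrite ler_peMr// mulr_ge0.
have EE : En * (1 + tau * P6) = (k0 + n%:R * tau * Q) * (1 + tau * P6) ^+ n.+1 * c^-1.
  by rewrite /En exprS; ring.
rewrite nS; move: EE tcQ tcQ2; move: (_ ^+ n.+1) En {hE hUVn hg hnl h2} => X E.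
by move=> EE tcQ tcQ2; lra.
Qed.

End Convergence.

Section InitialData.
Context {R : realType} {d : nat}.
Implicit Types (u v : 'rV[R]_d -> R[i]) (sg : R).

Lemma sobolev_ge0 sg u : (0 <= sobolev sg u)%E.
Proof. exact: poweR_ge0. Qed.

Lemma ereal_sum_le (a b : \bar R) M : (0 <= a)%E -> (0 <= b)%E -> (a + b <= M%:E)%E ->
  exists A B, [/\ 0 <= A, 0 <= B, (a <= A%:E)%E, (b <= B%:E)%E & A + B <= M].
Proof.
case: a b => [a| |] [b| |] //=.
by rewrite !lee_fin => a0 b0 h; exists a, b; rewrite !lee_fin; split.
Qed.

Lemma sobolev_bnd sg u M : torus_continuous u -> 0 <= M -> (sobolev sg u <= M%:E)%E ->
  bnd sg u M.
Proof. by move=> cu M0 /(sobolev_le _ _ M0). Qed.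

Lemma tc_opV sg c u : d%:R / 2 < sg -> 0 < c -> torus_continuous u ->
  (sobolev sg u < +oo)%E -> torus_continuous (opV c u).
Proof.
move=> hs c0 cu; have := sobolev_ge0 sg u.
case E : (sobolev sg u) => [M| |] //; rewrite lee_fin => M0 _.
have hu : bnd sg u M by apply: sobolev_bnd => //; rewrite E.
have B0 : 0 <= c^-1 * c^-1 by rewrite mulr_ge0// invr_ge0 ltW.
apply: (bnd_fmult hs B0 _ hu).1 => k.
rewrite mulrC ler_wpM2r ?(ltW (weight_gt0 _ _))// !expr2.
have h : cnorm (c^-1 * (bracket c k)^-1)%:C <= c^-1 * c^-1.
  have b0 := bracket_ge k c0; have bp : 0 < bracket c k by exact: lt_le_trans b0.
  rewrite cnorm_real ger0_norm ?mulr_ge0 ?invr_ge0 ?(ltW c0) ?(ltW bp)//.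
  by rewrite ler_wpM2l ?invr_ge0 ?(ltW c0)// lef_pV2.
by apply: ler_pM; rewrite ?cnorm_ge0.
Qed.

End InitialData.

Theorem lemma30 (R : realType) (d : nat) (hd : (0 < d)%N) (r : R)
    (hr : d%:R / 2 < r) (kr : R) :
  exists K : R -> R -> R,
  forall (M3 : R) (z0 z1 : R -> 'rV[R]_d -> R) (phi gamma : 'rV[R]_d -> R[i])
    (hz0 : forall c : R, 0 < c -> torus_continuous (fun x => (z0 c x)%:C))
    (hz1 : forall c : R, 0 < c -> torus_continuous (fun x => (z1 c x)%:C))
    (hz1r : forall c : R, 0 < c ->
      (sobolev (r + 2) (fun x => (z1 c x)%:C) < +oo)%E)
    (hphi : torus_continuous phi) (hgamma : torus_continuous gamma)
    (hM3 : forall c : R, 0 < c ->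
      (sobolev (r + 3) (fun x => (z0 c x)%:C)
       + sobolev (r + 3) (opV c (fun x => (z1 c x)%:C)) <= M3%:E)%E)
    (hlim : forall c : R, 0 < c ->
      (sobolev r (fun x => ((z0 c x)%:C - phi x)%R)
       + sobolev r (fun x => (opV c (fun y => (z1 c y)%:C) x - gamma x)%R)
       <= (kr * c^-1)%:E)%E),
  exists T tau0 : R, 0 < T /\ 0 < tau0 /\
  forall (tau c : R) (n : nat),
    0 < tau -> tau <= tau0 -> n%:R * tau <= T -> 0 < c -> 1 <= tau * c ->
    (sobolev r (fun x => (scheme c tau (z0 c) (z1 c) n x
                         - strang tau phi gamma n x)%R)
     <= (c^-1 * K M3 T)%:E)%E.
Proof.
have key (M3 : R) : exists TK : R * R, 0 < TK.1 /\
  forall (tau c : R) (z0 z1 : 'rV[R]_d -> R) (phi gamma : 'rV[R]_d -> R[i]),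
    0 < tau -> tau <= 1 -> 1 <= tau * c ->
    bnd (r + 3) (scheme c tau z0 z1 0) `|M3| ->
    bnd r (strang tau phi gamma 0) (`|M3| + `|kr|) ->
    bnd r (fun x => scheme c tau z0 z1 0 x - strang tau phi gamma 0 x) (`|kr| * c^-1) ->
  forall n, n%:R * tau <= TK.1 ->
    bnd r (fun x => scheme c tau z0 z1 n x - strang tau phi gamma n x) (c^-1 * TK.2).
  have [T [K [T0 h]]] := @scheme_strang_dist R d r `|M3| (`|M3| + `|kr|) `|kr| hr
    (normr_ge0 _) (addr_ge0 (normr_ge0 _) (normr_ge0 _)) (normr_ge0 _).
  by exists (T, K).
have [TK hTK] := choice key.
exists (fun M3 _ => (TK M3).2).
move=> M3 z0 z1 phi gamma hz0 hz1 hz1r hphi hgamma hM3 hlim.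
have [T0 h] := hTK M3.
exists (TK M3).1, 1; split => //; split => // tau c n t0 t1 nT c0 ct.
have hr2 : d%:R / 2 < r + 2 by rewrite ltr_wpDr.
have rr3 : r <= r + 3 by lra.
pose W c := opV c (fun x => (z1 c x)%:C).
have hW c' : 0 < c' -> torus_continuous (W c').
  by move=> c'0; apply: (tc_opV hr2 c'0 (hz1 _ c'0) (hz1r _ c'0)).
have data c' : 0 < c' -> exists A B a b, [/\
    bnd (r + 3) (fun x => (z0 c' x)%:C) A, bnd (r + 3) (W c') B,
    bnd r (fun x => (z0 c' x)%:C - phi x) a, bnd r (fun x => W c' x - gamma x) b &
    A + B <= `|M3| /\ a + b <= `|kr| * c'^-1].
  move=> c'0.
  have [A [B [A0 B0 hA hB AB]]] := ereal_sum_le (sobolev_ge0 _ _) (sobolev_ge0 _ _) (hM3 _ c'0).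
  have [a [b [a0 b0 ha hb ab]]] := ereal_sum_le (sobolev_ge0 _ _) (sobolev_ge0 _ _) (hlim _ c'0).
  exists A, B, a, b; split.
  - exact: sobolev_bnd (hz0 _ c'0) A0 hA.
  - exact: sobolev_bnd (hW _ c'0) B0 hB.
  - exact: sobolev_bnd (tcB (hz0 _ c'0) hphi) a0 ha.
  - exact: sobolev_bnd (tcB (hW _ c'0) hgamma) b0 hb.
  - split; first exact: le_trans AB (ler_norm _).
    by apply: le_trans ab _; rewrite ler_wpM2r ?invr_ge0 ?(ltW c'0)// ler_norm.
have sch c' tau' : scheme c' tau' (z0 c') (z1 c') 0 = fun x => (z0 c' x)%:C - 'i * W c' x by [].
have hU : bnd (r + 3) (scheme c tau (z0 c) (z1 c) 0) `|M3|.
  have [A [B [a [b [hA hB _ _ [AB _]]]]]] := data c c0.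
  rewrite sch; apply: bnd_le (bndB hA (bndZ 'i hB)).
  by rewrite cnormi mul1r.
have hV : bnd r (strang tau phi gamma 0) (`|M3| + `|kr|).
  have [A [B [a [b [hA hB ha hb [AB ab]]]]]] := data 1 ltr01.
  have h1 := bndB (bnd_weaken rr3 hA) ha.
  have h2 := bndB (bnd_weaken rr3 hB) hb.
  have := bndB h1 (bndZ 'i h2).
  rewrite cnormi mul1r (_ : (fun _ => _) = strang tau phi gamma 0).
    by apply: bnd_le; move: ab; rewrite invr1 mulr1; lra.
  by apply/funext => x /=; rewrite !opprB !(addrC _ (_ - _)) !subrK.
have hE : bnd r (fun x => scheme c tau (z0 c) (z1 c) 0 x - strang tau phi gamma 0 x)
    (`|kr| * c^-1).
  have [A [B [a [b [_ _ ha hb [_ ab]]]]]] := data c c0.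
  have := bndB ha (bndZ 'i hb); rewrite cnormi mul1r sch.
  rewrite (_ : (fun _ => _) = fun x => (z0 c x)%:C - 'i * W c x - strang tau phi gamma 0 x).
    exact: bnd_le.
  by apply/funext => x /=; rewrite mulrBr; ring.
have res := h tau c (z0 c) (z1 c) phi gamma t0 t1 ct hU hV hE n nT.
by apply/(sobolev_le _ _ (bnd_ge0 res)); exact: res.2.
Qed.
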